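(* Consider the simplified dynamic model (payload and links driven by arbitrary control forces $u_i\in\mathbb{R}^3$, $1\le i\le n$, with $\mathrm{rank}[\mathcal P]\ge 6$) described in the context. Let tracking commands $x_{0_d}(t)\in\mathbb{R}^3$, $R_{0_d}(t)\in\mathsf{SO(3)}$ be given, smooth and with bounded velocities and accelerations, and let the control forces be $$u_i=u_i^\parallel+u_i^\perp,\qquad 1\le i\le n,$$ with $$u_i^\parallel=\mu_i+m_il_i\|\omega_i\|^2q_i+m_iq_iq_i^Ta_i,$$ $$u_i^\perp=m_il_i\hat q_i\{-k_qe_{q_i}-k_\omega e_{\omega_i}-(q_i\cdot\omega_{i_d})\dot q_i-\hat q_i^2\dot\omega_{i_d}\}-m_i\hat q_i^2a_i,$$ where $\mu_i,a_i,e_{q_i},e_{\omega_i},\omega_{i_d}$ are defined in the context and depend on the controller gains. Then there exist values of the positive controller gains $k_{x_0},k_{\dot x_0},k_{R_0},k_{\Omega_0},k_q,k_\omega$ such that the zero equilibrium of the tracking errors $(e_{x_0},\dot e_{x_0},e_{R_0},e_{\Omega_0},e_{q_i},e_{\omega_i})_{1\le i\le n}$ of the closed-loop system is exponentially stable.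
   Context: **Notation.** $\mathsf{SO(3)}=\{R\in\mathbb{R}^{3\times3}: R^TR=I,\ \det R=1\}$, $\mathsf{S}^2=\{q\in\mathbb{R}^3:\|q\|=1\}$. The hat map $\hat{\cdot}$ (also written $(\cdot)^\wedge$) sends $x\in\mathbb{R}^3$ to the skew-symmetric matrix with $\hat xy=x\times y$ for all $y\in\mathbb{R}^3$; its inverse is the vee map $(\cdot)^\vee$. $e_3=[0,0,1]^T$ points downward (along gravity), $g>0$ is the gravitational acceleration. **Physical data.** A rigid body payload (mass $m_0>0$, symmetric positive-definite inertia matrix $J_0\in\mathbb{R}^{3\times3}$) is connected by $n$ massless rigid links of lengths $l_i>0$ to $n$ vehicles of masses $m_i>0$, $1\le i\le n$. The $i$-th link is attached to the payload at the point $\rho_i\in\mathbb{R}^3$ (in the payload body frame). Let $$\mathcal P=\begin{bmatrix}I_{3\times3}&\cdots&I_{3\times3}\\ \hat\rho_1&\cdots&\hat\rho_n\end{bmatrix}\in\mathbb{R}^{6\times3n};$$ it is assumed that $\mathrm{rank}[\mathcal P]\ge6$. **State.** Payload position $x_0\in\mathbb{R}^3$ and velocity $\dot x_0$, payload attitude $R_0\in\mathsf{SO(3)}$ and body angular velocity $\Omega_0\in\mathbb{R}^3$, link directions $q_i\in\mathsf{S}^2$ (from vehicle $i$ toward the payload) and link angular velocities $\omega_i\in\mathbb{R}^3$ with $q_i\cdot\omega_i=0$. **Simplified dynamic model.** Kinematics: $\dot q_i=\omega_i\times q_i$, $\dot R_0=R_0\hat\Omega_0$. For a control force $u_i\in\mathbb{R}^3$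 put $u_i^\parallel=q_iq_i^Tu_i$, $u_i^\perp=(I-q_iq_i^T)u_i$. With $M_q=m_0I+\sum_{i=1}^nm_iq_iq_i^T$, $$M_q(\ddot x_0-ge_3)-\sum_{i=1}^nm_iq_iq_i^TR_0\hat\rho_i\dot\Omega_0=\sum_{i=1}^n\left(u_i^\parallel-m_il_i\|\omega_i\|^2q_i-m_iq_iq_i^TR_0\hat\Omega_0^2\rho_i\right),$$ $$\Big(J_0-\sum_{i=1}^nm_i\hat\rho_iR_0^Tq_iq_i^TR_0\hat\rho_i\Big)\dot\Omega_0+\sum_{i=1}^nm_i\hat\rho_iR_0^Tq_iq_i^T(\ddot x_0-ge_3)+\hat\Omega_0J_0\Omega_0=\sum_{i=1}^n\hat\rho_iR_0^T\left(u_i^\parallel-m_il_i\|\omega_i\|^2q_i-m_iq_iq_i^TR_0\hat\Omega_0^2\rho_i\right),$$ $$\dot\omega_i=\frac1{l_i}\hat q_i\left(\ddot x_0-ge_3-R_0\hat\rho_i\dot\Omega_0+R_0\hat\Omega_0^2\rho_i\right)-\frac1{m_il_i}\hat q_iu_i^\perp.$$ **Commands.** $x_{0_d}(t)$, $R_{0_d}(t)$ are smooth; $\Omega_{0_d}$ is defined by $\dot R_{0_d}=R_{0_d}\hat\Omega_{0_d}$; the velocities and accelerations of the desired trajectories are bounded by known constants. **Payload errors.** $e_{x_0}=x_0-x_{0_d}$, $e_{R_0}=\frac12(R_{0_d}^TR_0-R_0^TR_{0_d})^\vee$, $e_{\Omega_0}=\Omega_0-R_0^TR_{0_d}\Omega_{0_d}$.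 **Desired force and moment on the payload.** For positive gains $k_{x_0},k_{\dot x_0},k_{R_0},k_{\Omega_0}$, $$F_d=m_0(-k_{x_0}e_{x_0}-k_{\dot x_0}\dot e_{x_0}+\ddot x_{0_d}-ge_3),$$ $$M_d=-k_{R_0}e_{R_0}-k_{\Omega_0}e_{\Omega_0}+(R_0^TR_{0_d}\Omega_{0_d})^\wedge J_0R_0^TR_{0_d}\Omega_{0_d}+J_0R_0^TR_{0_d}\dot\Omega_{0_d}.$$ **Desired and virtual tensions.** $$\begin{bmatrix} \mu_{1_d} \\ \vdots \\ \mu_{n_d} \end{bmatrix}=\mathrm{diag}[R_0,\dots,R_0]\,\mathcal P^T(\mathcal P\mathcal P^T)^{-1}\begin{bmatrix} R_0^TF_d \\ M_d \end{bmatrix},\qquad \mu_i=q_iq_i^T\mu_{i_d},\qquad q_{i_d}=-\frac{\mu_{i_d}}{\|\mu_{i_d}\|}\in\mathsf{S}^2$$ (the definition of $q_{i_d}$ presupposes $\mu_{i_d}\ne0$). Further $$a_i=\frac1{m_0}\sum_{j=1}^n\mu_j+R_0\hat\Omega_0^2\rho_i+R_0\hat\rho_iJ_0^{-1}\Big(\hat\Omega_0J_0\Omega_0-\sum_{j=1}^n\hat\rho_jR_0^T\mu_j\Big),$$ which along the closed loop equals $\ddot x_0-ge_3+R_0\hat\Omega_0^2\rho_i-R_0\hat\rho_i\dot\Omega_0$. **Link errors.** $\omega_{i_d}=q_{i_d}\times\dot q_{i_d}$, $e_{q_i}=q_{i_d}\times q_i$, $e_{\omega_i}=\omega_i+\hat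 q_i^2\omega_{i_d}$, with positive gains $k_q,k_\omega$. The time derivatives $\dot q_{i_d},\dot\omega_{i_d}$ are taken along the closed-loop trajectories; using $m_0(\ddot x_0-ge_3)=\sum_i\mu_i$, $J_0\dot\Omega_0+\hat\Omega_0J_0\Omega_0=\sum_i\hat\rho_iR_0^T\mu_i$ (which hold under the stated $u_i^\parallel$) and $\dot q_i=\omega_i\times q_i$, they are functions of time and the state. **Stability notion.** The zero equilibrium of the tracking errors is the solution with $x_0=x_{0_d}$, $\dot x_0=\dot x_{0_d}$, $R_0=R_{0_d}$, $\Omega_0=\Omega_{0_d}$, $q_i=q_{i_d}$, $e_{\omega_i}=0$. Exponential stability is the usual (local) notion: there are constants $C,a>0$ and a neighborhood of this equilibrium such that for initial conditions in it the norm of the error vector at time $t$ is at most $Ce^{-a(t-t_0)}$ times its norm at the initial time $t_0$.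
   Formalization: Bounded velocities and accelerations of the commands do not suffice (the link velocities can grow without bound); it is additionally assumed that, along the commanded motion, the desired tensions μ_{i_d} are uniformly bounded away from 0 and have bounded time derivatives. *)

(* Defs.v *)
From HB Require Import structures.
From mathcomp Require Import all_boot all_order all_algebra.
From mathcomp Require Import all_classical all_reals all_analysis.

Set Implicit Arguments.
Unset Strict Implicit.
Unset Printing Implicit Defensive.

Import Order.TTheory GRing.Theory Num.Theory.
Import numFieldNormedType.Exports.

Local Open Scope ring_scope.
Local Open Scope classical_set_scope.

Section Euclidean.
Variable R : realType.

(* The library norm `|x| on matrices is the sup norm; this is the Euclidean   *)
(* norm of a vector, and the Frobenius norm of a matrix.                      *)
Definition enorm (m n : nat) (A : 'M[R]_(m, n)) : R :=
  Num.sqrt (\sum_i \sum_j A i j ^+ 2).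

Definition dot (x y : 'cV[R]_3) : R := (x^T *m y) 0 0.

Definition hat (x : 'cV[R]_3) : 'M[R]_3 :=
  \matrix_(i < 3, j < 3)
    nth 0 (nth [::] [:: [:: 0           ; - x 2%:R 0 ; x 1 0  ];
                        [:: x 2%:R 0    ; 0          ; - x 0 0];
                        [:: - x 1 0     ; x 0 0      ; 0      ]] i) j.

(* Total on 'M_3; it inverts hat on skew-symmetric matrices, and is only      *)
(* applied to such matrices.                                                  *)
Definition vee (A : 'M[R]_3) : 'cV[R]_3 :=
  \col_(i < 3) nth 0 [:: A 2%:R 1; A 0 2%:R; A 1 0] i.

Definition cross (x y : 'cV[R]_3) : 'cV[R]_3 := hat x *m y.

Definition e3 : 'cV[R]_3 := delta_mx 2%:R 0.

Definition SO3 (A : 'M[R]_3) : Prop := A^T *m A = 1%:M /\ \det A = 1.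

Definition S2 (x : 'cV[R]_3) : Prop := enorm x = 1.

Definition smooth (V : normedModType R) (f : R -> V) : Prop :=
  forall (k : nat) (t : R), derivable (derive1n k f) t 1.

(* Commands are tracked on the time interval [0, +oo[. *)
Definition bounded_motion (f : R -> 'cV[R]_3) : Prop :=
  exists B : R, forall t, 0 <= t -> enorm (f t) <= B.

End Euclidean.

Arguments e3 {R}.

Section Model.
Variables (R : realType) (n : nat).

Record plant := Plant {
  m0 : R;
  J0 : 'M[R]_3;
  grav : R;
  mass : 'I_n -> R;
  len : 'I_n -> R;
  rho : 'I_n -> 'cV[R]_3
}.

Definition Pmx (p : plant) : 'M[R]_(3 + 3, \sum_(i < n) 3) :=
  \mxrow_(i < n) col_mx 1%:M (hat (rho p i)).

Definition plant_ok (p : plant) : Prop :=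
  [/\ 0 < m0 p /\ 0 < grav p,
      (J0 p)^T = J0 p,
      forall x : 'cV[R]_3, x != 0 -> 0 < dot x (J0 p *m x),
      forall i, 0 < mass p i /\ 0 < len p i
    & (6 <= \rank (Pmx p))%N].

Record motion := Motion {
  x0 : R -> 'cV[R]_3;
  R0 : R -> 'M[R]_3;
  Om0 : R -> 'cV[R]_3;
  q : 'I_n -> R -> 'cV[R]_3;
  om : 'I_n -> R -> 'cV[R]_3
}.

Definition constraints (s : motion) (t : R) : Prop :=
  SO3 (R0 s t) /\ (forall i, S2 (q s i t) /\ dot (q s i t) (om s i t) = 0).

Definition kinematics (s : motion) (t : R) : Prop :=
  [/\ derivable (x0 s) t 1 /\ derivable (derive1 (x0 s)) t 1,
      is_derive t 1 (R0 s) (R0 s t *m hat (Om0 s t)),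
      derivable (Om0 s) t 1
    & forall i, is_derive t 1 (q s i) (cross (om s i t) (q s i t))
                /\ derivable (om s i) t 1].

Definition qq (x : 'cV[R]_3) : 'M[R]_3 := x *m x^T.

(* u is the family of control forces acting at time t. *)
Definition dynamics (p : plant) (u : 'I_n -> 'cV[R]_3) (s : motion) (t : R)
    : Prop :=
  let Rt := R0 s t in
  let Om := Om0 s t in
  let dOm := derive1 (Om0 s) t in
  let y := derive1 (derive1 (x0 s)) t - grav p *: e3 in
  let Q i := qq (q s i t) in
  let upar i := Q i *m u i in
  let uperp i := (1%:M - Q i) *m u i in
  let Mq := (m0 p)%:M + \sum_i mass p i *: Q i in
  let load i := upar i
    - (mass p i * len p i * enorm (om s i t) ^+ 2) *: q s i t
    - mass p i *: (Q i *m Rt *m hat Om *m hat Om *m rho p i) in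
  [/\ Mq *m y
        - \sum_i mass p i *: (Q i *m Rt *m hat (rho p i) *m dOm)
      = \sum_i load i,
      (J0 p - \sum_i mass p i *:
                (hat (rho p i) *m Rt^T *m Q i *m Rt *m hat (rho p i))) *m dOm
        + \sum_i mass p i *: (hat (rho p i) *m Rt^T *m Q i *m y)
        + hat Om *m J0 p *m Om
      = \sum_i hat (rho p i) *m Rt^T *m load i
    & forall i,
      derive1 (om s i) t
      = (len p i)^-1 *:
          (hat (q s i t) *m
             (y - Rt *m hat (rho p i) *m dOm
                + Rt *m hat Om *m hat Om *m rho p i))
        - (mass p i * len p i)^-1 *: (hat (q s i t) *m uperp i)].

Record command := Command {
  xd : R -> 'cV[R]_3;
  Rd : R -> 'M[R]_3
}.

(* The vector with Rd' = Rd *m hat Omd. *)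
Definition Omd (c : command) (t : R) : 'cV[R]_3 :=
  vee ((Rd c t)^T *m derive1 (Rd c) t).

Definition command_ok (c : command) : Prop :=
  [/\ smooth (xd c), smooth (Rd c), (forall t, SO3 (Rd c t)),
      bounded_motion (derive1 (xd c))
      /\ bounded_motion (derive1 (derive1 (xd c)))
    & bounded_motion (Omd c) /\ bounded_motion (derive1 (Omd c))].

(* Tensions (resolved in the inertial frame) producing the force F on the     *)
(* payload, in the inertial frame, and the moment M, in the body frame, at    *)
(* payload attitude A.                                                        *)
Definition tension (p : plant) (A : 'M[R]_3) (F M : 'cV[R]_3) (i : 'I_n)
    : 'cV[R]_3 :=
  submxcol ((\mxdiag_(j < n) A) *m (Pmx p)^T *m invmx (Pmx p *m (Pmx p)^T)
              *m col_mx (A^T *m F) M) i.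

Definition unit_opp (x : 'cV[R]_3) : 'cV[R]_3 := - (enorm x)^-1 *: x.

(* Desired tensions along the commanded motion: the tracking errors vanish    *)
(* there, so that the gains do not enter.                                     *)
Definition cmd_tension (p : plant) (c : command) (i : 'I_n) (t : R)
    : 'cV[R]_3 :=
  tension p (Rd c t)
    (m0 p *: (derive1 (derive1 (xd c)) t - grav p *: e3))
    (hat (Omd c t) *m J0 p *m Omd c t + J0 p *m derive1 (Omd c) t)
    i.

Definition cmd_qd p c i (t : R) : 'cV[R]_3 := unit_opp (cmd_tension p c i t).

Definition cmd_omd p c i (t : R) : 'cV[R]_3 :=
  cross (cmd_qd p c i t) (derive1 (cmd_qd p c i) t).

(* Makes the desired link directions well defined, with bounded velocities,   *)
(* uniformly in time near the commanded motion.  The bounds in command_ok do  *)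
(* not entail this, since the velocity of the desired tensions involves xd''' *)
(* and Omd''; without it, exponential stability can fail.                     *)
Definition link_commands_ok (p : plant) (c : command) : Prop :=
  (exists2 nu : R, 0 < nu &
     forall i t, 0 <= t -> nu <= enorm (cmd_tension p c i t))
  /\ forall i, bounded_motion (derive1 (cmd_tension p c i)).

Definition commanded_motion (p : plant) (c : command) : motion :=
  Motion (xd c) (Rd c) (Omd c) (cmd_qd p c) (cmd_omd p c).

Record gains := Gains { kx : R; kv : R; kR : R; kOm : R; kq : R; kom : R }.

Definition gains_pos (k : gains) : Prop :=
  [/\ 0 < kx k, 0 < kv k, 0 < kR k & [/\ 0 < kOm k, 0 < kq k & 0 < kom k]].

Section Controller.
Variables (p : plant) (c : command) (k : gains) (s : motion).

Definition e_x t : 'cV[R]_3 := x0 s t - xd c t.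

Definition e_v t : 'cV[R]_3 := derive1 (x0 s) t - derive1 (xd c) t.

Definition e_R t : 'cV[R]_3 :=
  2^-1 *: vee ((Rd c t)^T *m R0 s t - (R0 s t)^T *m Rd c t).

Definition e_Om t : 'cV[R]_3 := Om0 s t - (R0 s t)^T *m Rd c t *m Omd c t.

Definition Fd t : 'cV[R]_3 :=
  m0 p *: (- kx k *: e_x t - kv k *: e_v t
           + derive1 (derive1 (xd c)) t - grav p *: e3).

Definition Md t : 'cV[R]_3 :=
  let W := (R0 s t)^T *m Rd c t *m Omd c t in
  - kR k *: e_R t - kOm k *: e_Om t + hat W *m J0 p *m W
  + J0 p *m (R0 s t)^T *m Rd c t *m derive1 (Omd c) t.

Definition mud i t : 'cV[R]_3 := tension p (R0 s t) (Fd t) (Md t) i.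

Definition mu i t : 'cV[R]_3 := qq (q s i t) *m mud i t.

Definition acc i t : 'cV[R]_3 :=
  let Rt := R0 s t in
  let Om := Om0 s t in
  (m0 p)^-1 *: (\sum_j mu j t)
  + Rt *m hat Om *m hat Om *m rho p i
  + Rt *m hat (rho p i) *m invmx (J0 p) *m
      (hat Om *m J0 p *m Om - \sum_j hat (rho p j) *m Rt^T *m mu j t).

Definition qd i t : 'cV[R]_3 := unit_opp (mud i t).

(* The time derivatives of qd and omd are taken along the motion s. *)
Definition omd i t : 'cV[R]_3 := cross (qd i t) (derive1 (qd i) t).

Definition e_q i t : 'cV[R]_3 := cross (qd i t) (q s i t).

Definition e_om i t : 'cV[R]_3 :=
  om s i t + hat (q s i t) *m hat (q s i t) *m omd i t.

Definition ctrl_par i t : 'cV[R]_3 :=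
  mu i t + (mass p i * len p i * enorm (om s i t) ^+ 2) *: q s i t
  + mass p i *: (qq (q s i t) *m acc i t).

Definition ctrl_perp i t : 'cV[R]_3 :=
  (mass p i * len p i) *:
    (hat (q s i t) *m
       (- kq k *: e_q i t - kom k *: e_om i t
        - dot (q s i t) (omd i t) *: derive1 (q s i) t
        - hat (q s i t) *m hat (q s i t) *m derive1 (omd i) t))
  - mass p i *: (hat (q s i t) *m hat (q s i t) *m acc i t).

Definition ctrl i t : 'cV[R]_3 := ctrl_par i t + ctrl_perp i t.

Definition err_norm t : R :=
  Num.sqrt (enorm (e_x t) ^+ 2 + enorm (e_v t) ^+ 2
            + enorm (e_R t) ^+ 2 + enorm (e_Om t) ^+ 2
            + \sum_i (enorm (e_q i t) ^+ 2 + enorm (e_om i t) ^+ 2)).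

(* The feedback law is defined where no mud vanishes, and it uses the time    *)
(* derivatives of qd and omd.                                                 *)
Definition closed_loop_at t : Prop :=
  [/\ constraints s t, kinematics s t,
      forall i, [/\ mud i t != 0, derivable (qd i) t 1
                  & derivable (omd i) t 1]
    & dynamics p (ctrl^~ t) s t].

(* The error vector also vanishes at spurious points (q = - qd, or R0 and Rd  *)
(* differing by a half turn), so that a neighborhood of the equilibrium is    *)
(* one in the state space and not merely a bound on the error vector.         *)
Definition near_equilibrium (delta t : R) : Prop :=
  [/\ enorm (x0 s t - xd c t) < delta,
      enorm (derive1 (x0 s) t - derive1 (xd c) t) < delta,
      enorm (R0 s t - Rd c t) < delta,
      enorm (Om0 s t - Omd c t) < delta
    & forall i, enorm (q s i t - qd i t) < delta /\ enorm (e_om i t) < delta].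

End Controller.

(* Trajectories are taken on open time intervals containing the initial time, *)
(* so that no one-sided derivatives are needed; b is arbitrary, so the bound  *)
(* holds for as long as the trajectory exists.  The constants do not depend   *)
(* on t0.                                                                     *)
Definition exponentially_stable (p : plant) (c : command) (k : gains) : Prop :=
  (forall t, 0 <= t -> closed_loop_at p c k (commanded_motion p c) t
                       /\ err_norm p c k (commanded_motion p c) t = 0)
  /\
  exists C a delta : R, [/\ 0 < C, 0 < a, 0 < delta &
    forall (s : motion) (lo t0 hi : R), 0 <= t0 -> lo < t0 < hi ->
      (forall t, lo < t < hi -> closed_loop_at p c k s t) ->
      near_equilibrium p c k s delta t0 ->
      forall t, t0 <= t < hi ->
        err_norm p c k s t
          <= C * expR (- a * (t - t0)) * err_norm p c k s t0].

End Model.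

(* Main.v *)
Require Import Defs.
From HB Require Import structures.
From mathcomp Require Import all_boot all_order all_algebra.
From mathcomp Require Import all_classical all_reals all_analysis.
From mathcomp Require Import ring lra.

(* The errors obey a cascade.  Testing the payload equations against the
   deviation from the nominal accelerations gives a sum of squares, so that the
   control forces make the payload feel exactly the virtual tensions, and each
   link error then satisfies e_om' = - kq e_q - kom e_om modulo q.  The virtual
   tensions differ from the desired ones by |mud| q x e_q, hence the payload
   errors follow an exponentially stable system perturbed by a term linear in
   the e_q.  With all gains equal to 1, a sum of quadratic Lyapunov functions
   with cross terms, in which the links get a large weight, decreases
   exponentially wherever the desired link directions have bounded velocity.
   This holds near the commanded motion: there the desired tensions are close to
   the commanded ones, and their derivatives involve, besides bounded
   quantities, only the third derivative of xd and the second one of Omd, which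
   are recovered from the derivatives of the commanded tensions because these
   add up to the commanded force and moment. *)

Set Implicit Arguments.
Unset Strict Implicit.
Unset Printing Implicit Defensive.

Import Order.TTheory GRing.Theory Num.Theory.
Import numFieldNormedType.Exports.

Local Open Scope ring_scope.
Local Open Scope classical_set_scope.

(** * Vector algebra in dimension 3 *)

(** The error vector also vanishes at half turns of the attitude and at reversed links, so the
    estimates measure the state by [sqdist], in which the squares of e_R and e_q are replaced by the
    configuration functions [psiR] and [psiq]. These satisfy |e|^2 = psi (2 - psi), hence are
    comparable with the squared errors while psi <= 1, and their rates are exactly the products of
    configuration and velocity errors, which cancel the proportional feedback in the energies. The
    gains can be fixed beforehand because the gyroscopic residual does no work on e_Om: only the
    weights inside the Lyapunov function depend on the plant and the command. Besides psi <= 1, what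
    makes the result local is one term of size |qd'| |e_om| |e_q|^2 and the lower bound on |mud|
    needed to control qd'. Such bounds hold only in a region that the trajectory must not leave,
    which a sublevel set of the Lyapunov function guarantees; their constants must be common to all
    motions and initial times, whence estimates over pairs of a motion and a time. *)

Section Coordinates.
Variable R : realType.
Implicit Types (x y z w : 'cV[R]_3) (A B : 'M[R]_3).

Lemma sum3E (V : nmodType) (F : 'I_3 -> V) :
  \sum_(i < 3) F i = F 0 + F 1 + F 2%:R.
Proof.
rewrite !big_ord_recl big_ord0 addr0 addrA.
by congr (F _ + F _ + F _); apply/val_inj.
Qed.

Lemma ord3P (P : 'I_3 -> Prop) : P 0 -> P 1 -> P 2%:R -> forall i, P i.
Proof.
move=> P0 P1 P2 [[|[|[|//]]] lti].
- by rewrite (_ : Ordinal lti = 0) //; apply/val_inj.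
- by rewrite (_ : Ordinal lti = 1) //; apply/val_inj.
- by rewrite (_ : Ordinal lti = 2%:R) //; apply/val_inj.
Qed.

Lemma col3P x y :
  x 0 0 = y 0 0 -> x 1 0 = y 1 0 -> x 2%:R 0 = y 2%:R 0 -> x = y.
Proof. by move=> *; apply/colP; apply: ord3P. Qed.

Lemma mx3P A B :
  [/\ A 0 0 = B 0 0, A 0 1 = B 0 1 & A 0 2%:R = B 0 2%:R] ->
  [/\ A 1 0 = B 1 0, A 1 1 = B 1 1 & A 1 2%:R = B 1 2%:R] ->
  [/\ A 2%:R 0 = B 2%:R 0, A 2%:R 1 = B 2%:R 1 & A 2%:R 2%:R = B 2%:R 2%:R] ->
  A = B.
Proof. by move=> [???] [???] [???]; apply/matrixP; do 2!apply: ord3P. Qed.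

Lemma hatE x :
  (((hat x 0 0 = 0) * (hat x 0 1 = - x 2%:R 0) * (hat x 0 2%:R = x 1 0)) *
   ((hat x 1 0 = x 2%:R 0) * (hat x 1 1 = 0) * (hat x 1 2%:R = - x 0 0)) *
   ((hat x 2%:R 0 = - x 1 0) * (hat x 2%:R 1 = x 0 0) *
    (hat x 2%:R 2%:R = 0)))%type.
Proof. by rewrite !mxE. Qed.

Lemma veeE A :
  ((vee A 0 0 = A 2%:R 1) * (vee A 1 0 = A 0 2%:R) * (vee A 2%:R 0 = A 1 0))%type.
Proof. by rewrite !mxE. Qed.

Lemma mulmx3E p q (M : 'M[R]_(p, 3)) (N : 'M[R]_(3, q)) i j :
  (M *m N) i j = M i 0 * N 0 j + M i 1 * N 1 j + M i 2%:R * N 2%:R j.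
Proof. by rewrite mxE sum3E. Qed.

Lemma dotE x y : dot x y = x 0 0 * y 0 0 + x 1 0 * y 1 0 + x 2%:R 0 * y 2%:R 0.
Proof. by rewrite /dot mulmx3E !mxE. Qed.

Lemma mxD p q (M N : 'M[R]_(p, q)) i j : (M + N) i j = M i j + N i j.
Proof. by rewrite mxE. Qed.

Lemma mxN p q (M : 'M[R]_(p, q)) i j : (- M) i j = - M i j.
Proof. by rewrite mxE. Qed.

Lemma mxZ p q a (M : 'M[R]_(p, q)) i j : (a *: M) i j = a * M i j.
Proof. by rewrite mxE. Qed.

Lemma mxT p q (M : 'M[R]_(p, q)) i j : M^T i j = M j i.
Proof. by rewrite mxE. Qed.

Lemma mx0E p q i j : (0 : 'M[R]_(p, q)) i j = 0.
Proof. by rewrite mxE. Qed.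

Lemma scalar3E (a : R) :
  ((((a%:M : 'M[R]_3) 0 0 = a) *
    ((a%:M : 'M[R]_3) 0 1 = 0) *
    ((a%:M : 'M[R]_3) 0 2%:R = 0)) *
   (((a%:M : 'M[R]_3) 1 0 = 0) *
    ((a%:M : 'M[R]_3) 1 1 = a) *
    ((a%:M : 'M[R]_3) 1 2%:R = 0)) *
   (((a%:M : 'M[R]_3) 2%:R 0 = 0) *
    ((a%:M : 'M[R]_3) 2%:R 1 = 0) *
    ((a%:M : 'M[R]_3) 2%:R 2%:R = a)))%type.
Proof. by rewrite !mxE. Qed.

Lemma qq3E x i j : qq x i j = x i 0 * x j 0.
Proof. by rewrite /qq mxE big_ord1 mxE. Qed.

Lemma lift3E (k : 'I_2) :
  ((lift (0 : 'I_3) k = if val k == 0%N then 1 else 2%:R) *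
   (lift (1 : 'I_3) k = if val k == 0%N then 0 else 2%:R) *
   (lift (2%:R : 'I_3) k = if val k == 0%N then 0 else 1))%type.
Proof. by case: k => [[|[|[]]] //= ?]; (split; first split); apply/val_inj. Qed.

Lemma cofactor3E A i j : cofactor A i j = (-1) ^+ (i + j) *
  (A (lift i 0) (lift j 0) * A (lift i 1) (lift j 1)
   - A (lift i 0) (lift j 1) * A (lift i 1) (lift j 0)).
Proof.
rewrite /cofactor (expand_det_row _ ord0) !big_ord_recl big_ord0 /cofactor.
rewrite !det_mx11 !mxE /= !(expr0, expr1).
have -> : lift ord0 (ord0 : 'I_1) = 1 by apply/val_inj.
have -> : lift 1 (ord0 : 'I_1) = 0 by apply/val_inj.
by rewrite /= /bump /= ?(expr0, expr1); ring.
Qed.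

Lemma det3E A :
  \det A = A 0 0 * (A 1 1 * A 2%:R 2%:R - A 1 2%:R * A 2%:R 1)
         - A 0 1 * (A 1 0 * A 2%:R 2%:R - A 1 2%:R * A 2%:R 0)
         + A 0 2%:R * (A 1 0 * A 2%:R 1 - A 1 1 * A 2%:R 0).
Proof.
rewrite (expand_det_row _ 0) sum3E !cofactor3E !lift3E /= ?expr2; ring.
Qed.

(** The sum of the principal minors. For a rotation, whose adjugate is its transpose, it turns
    [\tr (X *m X)] into a function of [\tr X], as [sqr_e_R] requires. *)
Lemma mxtrace_adj3E A :
  \tr (\adj A) = (A 1 1 * A 2%:R 2%:R - A 1 2%:R * A 2%:R 1)
    + (A 0 0 * A 2%:R 2%:R - A 0 2%:R * A 2%:R 0)
    + (A 0 0 * A 1 1 - A 0 1 * A 1 0).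
Proof.
rewrite /mxtrace sum3E !mxE !cofactor3E !lift3E /= ?expr0 ?expr2.
by rewrite -?exprD; ring.
Qed.

Definition coordE :=
  (mxD, mxN, mxZ, mxT, mx0E, scalar3E, hatE, veeE, mulmx3E, dotE, qq3E).

End Coordinates.

(** Vector identities in dimension 3 are polynomial identities between entries, which [ring] decides
    once all products are expanded. *)
Ltac by_coords := rewrite /cross; (apply: col3P || (apply: mx3P; split) || idtac);
  rewrite ?coordE; ring.

Section Vectors.
Variable R : realType.
Implicit Types (x y z w : 'cV[R]_3) (A B : 'M[R]_3) (a : R).

Lemma hatD x y : hat (x + y) = hat x + hat y. Proof. by_coords. Qed.
Lemma hatN x : hat (- x) = - hat x. Proof. by_coords. Qed.
Lemma hatZ a x : hat (a *: x) = a *: hat x. Proof. by_coords. Qed.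
Lemma tr_hat x : (hat x)^T = - hat x. Proof. by_coords. Qed.
Lemma vee0 : vee 0 = 0 :> 'cV[R]_3. Proof. by_coords. Qed.

Lemma vee_skewK A : A^T = - A -> hat (vee A) = A.
Proof.
move=> /matrixP skA; have := skA 0 0; have := skA 1 1; have := skA 2%:R 2%:R.
have := skA 0 1; have := skA 0 2%:R; have := skA 1 2%:R.
rewrite !coordE => e12 e02 e01 e22 e11 e00.
by apply: mx3P; split; rewrite ?coordE; lra.
Qed.

Lemma hat_self x : hat x *m x = 0. Proof. by_coords. Qed.
Lemma hatC x y : hat x *m y = - (hat y *m x). Proof. by_coords. Qed.

Lemma hat_hat x y : hat x *m (hat x *m y) = dot x y *: x - dot x x *: y.
Proof. by_coords. Qed.

Lemma hat_hat_hat x y :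
  hat x *m (hat x *m (hat x *m y)) = - dot x x *: (hat x *m y).
Proof. by_coords. Qed.

Lemma dotC x y : dot x y = dot y x. Proof. by_coords. Qed.
Lemma dotDl x y z : dot (x + y) z = dot x z + dot y z. Proof. by_coords. Qed.
Lemma dotDr x y z : dot x (y + z) = dot x y + dot x z. Proof. by_coords. Qed.
Lemma dotNl x y : dot (- x) y = - dot x y. Proof. by_coords. Qed.
Lemma dotNr x y : dot x (- y) = - dot x y. Proof. by_coords. Qed.
Lemma dotZl a x y : dot (a *: x) y = a * dot x y. Proof. by_coords. Qed.
Lemma dotZr a x y : dot x (a *: y) = a * dot x y. Proof. by_coords. Qed.
Lemma dot0l y : dot 0 y = 0. Proof. by_coords. Qed.
Lemma dot0r y : dot y 0 = 0. Proof. by_coords. Qed.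
Lemma dot_suml n (F : 'I_n -> 'cV[R]_3) y :
  dot (\sum_i F i) y = \sum_i dot (F i) y.
Proof. by rewrite /dot !linear_sum /= mulmx_suml summxE. Qed.

Lemma dot_sumr n (F : 'I_n -> 'cV[R]_3) y :
  dot y (\sum_i F i) = \sum_i dot y (F i).
Proof. by rewrite dotC dot_suml; apply: eq_bigr => i _; rewrite dotC. Qed.

Lemma dot_mulmxl A x y : dot (A *m x) y = dot x (A^T *m y).
Proof. by rewrite /dot trmx_mul mulmxA. Qed.

Lemma dot_mulmxr A x y : dot x (A *m y) = dot (A^T *m x) y.
Proof. by rewrite dot_mulmxl trmxK. Qed.

Lemma dot_hat_self x y : dot x (hat x *m y) = 0. Proof. by_coords. Qed.
Lemma dot_hat_selfr x y : dot y (hat x *m y) = 0. Proof. by_coords. Qed.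

Lemma qq_mul x y : qq x *m y = dot x y *: x. Proof. by_coords. Qed.

(** Paired with vectors u and v, this is the multiplicativity of the triple product: Au . (Aw x Av)
    = det A times u . (w x v). It holds without any assumption on [A]. *)
Lemma mulmx_det_hat A w : A^T *m hat (A *m w) *m A = \det A *: hat w.
Proof. by apply: mx3P; split; rewrite ?coordE det3E; ring. Qed.

Lemma SO3_inv A : SO3 A -> A *m A^T = 1%:M.
Proof. by case=> AA _; exact: mulmx1C. Qed.

Lemma SO3_tr A : SO3 A -> SO3 A^T.
Proof. by move=> hA; split; [rewrite trmxK SO3_inv | rewrite det_tr; case: hA]. Qed.

Lemma SO3_mul A B : SO3 A -> SO3 B -> SO3 (A *m B).
Proof.
move=> [AA dA] [BB dB]; split; last by rewrite det_mulmx dA dB mulr1.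
by rewrite trmx_mul mulmxA -(mulmxA _ A^T) AA mulmx1.
Qed.

Lemma SO3_hat A w : SO3 A -> A *m hat w *m A^T = hat (A *m w).
Proof.
move=> hA; have := mulmx_det_hat A w; case: (hA) => _ -> /[!scale1r] <-.
by rewrite !mulmxA SO3_inv // mul1mx -mulmxA SO3_inv // mulmx1.
Qed.

End Vectors.

Ltac linmx := apply/matrixP => ? ?; rewrite ?(mxD, mxN, mxZ, mx0E); ring.

(** * Euclidean and Frobenius norms, positive definite forms *)

Section Norms.
Variable R : realType.

(** The common core of the Cauchy-Schwarz inequalities for finite sums, for [dot] and for the form
    of a positive definite matrix, each time applied to the squared length of x - t y. *)
Lemma discriminant_le (a b c : R) : 0 <= b ->
  (forall t, 0 <= a - 2 * t * c + t ^+ 2 * b) -> c ^+ 2 <= a * b.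
Proof.
move=> b0 pos; have [b0'|b0'] := eqVneq b 0.
  rewrite b0' mulr0; have [->|c0] := eqVneq c 0; first by rewrite expr0n.
  (* Without quadratic term the expression is affine in t, and this t gives it the value -1. *)
  have := pos ((a + 1) / (2 * c)); rewrite b0'.
  have -> : a - 2 * ((a + 1) / (2 * c)) * c + ((a + 1) / (2 * c)) ^+ 2 * 0 = -1.
    by field.
  by rewrite ler0N1.
have {}b0 : 0 < b by rewrite lt_neqAle eq_sym b0'.
have := pos (c / b).
have -> : a - 2 * (c / b) * c + (c / b) ^+ 2 * b = (a * b - c ^+ 2) / b by field.
by rewrite pmulr_lge0 ?invr_gt0 // subr_ge0.
Qed.

Lemma sum_CauchySchwarz (I : finType) (a b : I -> R) :
  (\sum_i a i * b i) ^+ 2 <= (\sum_i a i ^+ 2) * (\sum_i b i ^+ 2).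
Proof.
apply: discriminant_le => [|t]; first by apply: sumr_ge0 => i _; exact: sqr_ge0.
have -> : \sum_i a i ^+ 2 - 2 * t * (\sum_i a i * b i) + t ^+ 2 * (\sum_i b i ^+ 2)
    = \sum_i (a i - t * b i) ^+ 2.
  rewrite !mulr_sumr -sumrB -big_split /=; apply: eq_bigr => i _; ring.
by apply: sumr_ge0 => i _; exact: sqr_ge0.
Qed.

Lemma sqr_enorm m n (A : 'M[R]_(m, n)) : enorm A ^+ 2 = \sum_i \sum_j A i j ^+ 2.
Proof. by rewrite sqr_sqrtr //; do 2!(apply: sumr_ge0 => ? _); exact: sqr_ge0. Qed.

Lemma sqr_enorm_pair m n (A : 'M[R]_(m, n)) :
  enorm A ^+ 2 = \sum_(k : 'I_m * 'I_n) A k.1 k.2 ^+ 2.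
Proof. by rewrite sqr_enorm pair_bigA. Qed.

Lemma enorm_ge0 m n (A : 'M[R]_(m, n)) : 0 <= enorm A.
Proof. exact: sqrtr_ge0. Qed.

Lemma enormN m n (A : 'M[R]_(m, n)) : enorm (- A) = enorm A.
Proof.
congr Num.sqrt; apply: eq_bigr => i _; apply: eq_bigr => j _.
by rewrite mxN sqrrN.
Qed.

Lemma enormZ m n a (A : 'M[R]_(m, n)) : enorm (a *: A) = `|a| * enorm A.
Proof.
rewrite -sqrtr_sqr -sqrtrM ?sqr_ge0 // mulr_sumr; congr Num.sqrt.
apply: eq_bigr => i _; rewrite mulr_sumr; apply: eq_bigr => j _.
by rewrite mxZ exprMn.
Qed.

Lemma enorm0 m n : enorm (0 : 'M[R]_(m, n)) = 0.
Proof. by rewrite -(scale0r 0) enormZ normr0 mul0r. Qed.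

Lemma enorm_tr m n (A : 'M[R]_(m, n)) : enorm A^T = enorm A.
Proof.
congr Num.sqrt; rewrite exchange_big; apply: eq_bigr => i _.
by apply: eq_bigr => j _; rewrite mxT.
Qed.

Lemma enormD m n (A B : 'M[R]_(m, n)) : enorm (A + B) <= enorm A + enorm B.
Proof.
rewrite -(@ler_pXn2r _ 2) ?nnegrE ?addr_ge0 ?enorm_ge0 //.
rewrite sqrrD !sqr_enorm_pair.
have -> : \sum_(k : 'I_m * 'I_n) (A + B) k.1 k.2 ^+ 2 =
   \sum_(k : 'I_m * 'I_n) A k.1 k.2 ^+ 2 +
     (\sum_(k : 'I_m * 'I_n) A k.1 k.2 * B k.1 k.2) *+ 2 +
     \sum_(k : 'I_m * 'I_n) B k.1 k.2 ^+ 2.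
  rewrite -sumrMnl -!big_split /=; apply: eq_bigr => k _.
  by rewrite mxD sqrrD.
rewrite lerD2r lerD2l lerMn2r /=.
apply: (le_trans (ler_norm _)).
rewrite -(@ler_pXn2r _ 2) ?nnegrE ?mulr_ge0 ?enorm_ge0 ?normr_ge0 //.
rewrite real_normK ?num_real // exprMn !sqr_enorm_pair.
exact: sum_CauchySchwarz.
Qed.

Lemma enormB m n (A B : 'M[R]_(m, n)) : enorm (A - B) <= enorm A + enorm B.
Proof. by rewrite -(enormN B); exact: enormD. Qed.

Lemma enorm_sum m n (I : Type) (r : seq I) (F : I -> 'M[R]_(m, n)) :
  enorm (\sum_(i <- r) F i) <= \sum_(i <- r) enorm (F i).
Proof.
elim/big_rec2: _ => [|i y A _ IH]; first by rewrite enorm0.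
by rewrite (le_trans (enormD _ _)) ?lerD2l.
Qed.

Lemma enormM m n p (A : 'M[R]_(m, n)) (B : 'M[R]_(n, p)) :
  enorm (A *m B) <= enorm A * enorm B.
Proof.
rewrite -(@ler_pXn2r _ 2) ?nnegrE ?mulr_ge0 ?enorm_ge0 //.
rewrite exprMn !sqr_enorm mulr_suml; apply: ler_sum => i _.
rewrite [X in _ * X]exchange_big /= mulr_sumr; apply: ler_sum => j _.
rewrite mxE; exact: sum_CauchySchwarz.
Qed.

Implicit Types x y z : 'cV[R]_3.

Lemma dot_enorm x : dot x x = enorm x ^+ 2.
Proof. by rewrite sqr_enorm sum3E !big_ord1 dotE !expr2. Qed.

Lemma dot_ge0 x : 0 <= dot x x.
Proof. by rewrite dot_enorm sqr_ge0. Qed.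

Lemma enorm_eq0 x : (enorm x == 0) = (x == 0).
Proof.
apply/eqP/eqP => [x0|->]; last exact: enorm0.
have : dot x x = 0 by rewrite dot_enorm x0 expr0n.
rewrite dotE => h.
have [h0 h1 h2] : [/\ x 0 0 ^+ 2 = 0, x 1 0 ^+ 2 = 0 & x 2%:R 0 ^+ 2 = 0].
  have := sqr_ge0 (x 0 0); have := sqr_ge0 (x 1 0); have := sqr_ge0 (x 2%:R 0).
  rewrite !expr2 => *; split; lra.
by apply: col3P; rewrite mx0E; apply/eqP; rewrite -(sqrf_eq0 (x _ _)); apply/eqP.
Qed.

Lemma enorm_gt0 x : (0 < enorm x) = (x != 0).
Proof. by rewrite lt_neqAle eq_sym enorm_eq0 enorm_ge0 andbT. Qed.

Lemma ler_dot x y : dot x y <= enorm x * enorm y.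
Proof.
apply: (le_trans (ler_norm _)).
rewrite -(@ler_pXn2r _ 2) ?nnegrE ?mulr_ge0 ?enorm_ge0 ?normr_ge0 //.
rewrite real_normK ?num_real // exprMn -!dot_enorm.
apply: discriminant_le => [|t]; first exact: dot_ge0.
have := dot_ge0 (x - t *: y); rewrite dotDl !dotDr !dotNl !dotNr !dotZl !dotZr.
by rewrite (dotC y x) !expr2; nra.
Qed.

Lemma normr_dot x y : `|dot x y| <= enorm x * enorm y.
Proof. by rewrite ler_norml ler_dot lerNl -dotNl (le_trans (ler_dot _ _)) ?enormN. Qed.

Lemma sqr_enorm_hat x : enorm (hat x) ^+ 2 = 2 * enorm x ^+ 2.
Proof.
by rewrite -dot_enorm sqr_enorm sum3E !sum3E !coordE; ring.
Qed.

Lemma enorm_hat x : enorm (hat x) <= 2 * enorm x.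
Proof.
rewrite -(@ler_pXn2r _ 2) ?nnegrE ?mulr_ge0 ?enorm_ge0 //.
by rewrite sqr_enorm_hat exprMn ler_wpM2r ?sqr_ge0 // ; lra.
Qed.

Lemma enorm_vee (A : 'M[R]_3) : enorm (vee A) <= enorm A.
Proof.
rewrite -(@ler_pXn2r _ 2) ?nnegrE ?enorm_ge0 //.
rewrite -dot_enorm sqr_enorm sum3E !sum3E dotE !veeE.
have := sqr_ge0 (A 0 0); have := sqr_ge0 (A 1 1); have := sqr_ge0 (A 2%:R 2%:R).
have := sqr_ge0 (A 0 1); have := sqr_ge0 (A 1 2%:R); have := sqr_ge0 (A 2%:R 0).
rewrite !expr2 => *; lra.
Qed.

Lemma sqr_enorm_mxtrace m n (A : 'M[R]_(m, n)) : enorm A ^+ 2 = \tr (A^T *m A).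
Proof.
rewrite sqr_enorm exchange_big; apply: eq_bigr => i _.
by rewrite mxE; apply: eq_bigr => j _; rewrite mxT expr2.
Qed.

Lemma sqr_enorm_SO3 (A : 'M[R]_3) : SO3 A -> enorm A ^+ 2 = 3.
Proof. by move=> [AA _]; rewrite sqr_enorm_mxtrace AA mxtrace1. Qed.

Lemma enorm_SO3 (A : 'M[R]_3) : SO3 A -> enorm A <= 2.
Proof.
move=> hA; rewrite -(@ler_pXn2r _ 2) ?nnegrE ?enorm_ge0 // sqr_enorm_SO3 //.
by rewrite expr2; lra.
Qed.

Lemma enorm_unit_opp x : x != 0 -> enorm (unit_opp x) = 1.
Proof.
move=> x0; rewrite enormZ normrN ger0_norm ?invr_ge0 ?enorm_ge0 //.
by rewrite mulVf // enorm_eq0.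
Qed.

Lemma posdef_unitmx (J : 'M[R]_3) :
  (forall x, x != 0 -> 0 < dot x (J *m x)) -> J \in unitmx.
Proof.
move=> Jpos; rewrite -unitmx_tr -row_free_unit -kermx_eq0.
apply/eqP/row_matrixP => i; rewrite row0.
set v := row i _; have vJ : v *m J^T = 0 by rewrite -row_mul mulmx_ker row0.
apply/eqP; apply: contraT => v0.
have vT0 : v^T != 0 by rewrite -trmx0 (inj_eq trmx_inj).
by have := Jpos _ vT0; rewrite -{1}[J]trmxK -trmx_mul vJ trmx0 dot0r ltxx.
Qed.

(* Cauchy-Schwarz for the form dot _ (J *m _), applied to x and J^-1 x. *)
Lemma posdef_lower_bound (J : 'M[R]_3) : J^T = J ->
  (forall x, x != 0 -> 0 < dot x (J *m x)) ->
  exists2 j : R, 0 < j & forall x, j * enorm x ^+ 2 <= dot x (J *m x).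
Proof.
move=> JT Jpos; have J0 x : 0 <= dot x (J *m x).
  have [->|/Jpos/ltW//] := eqVneq x 0; by rewrite dot0l.
have uJ := posdef_unitmx Jpos.
(* The form of [J] at the preimage [y] of x is at most [k] |x|^2; the summand 1 keeps [k]
   positive. *)
pose k := enorm (invmx J) + 1.
have k0 : 0 < k by rewrite ltr_wpDl ?enorm_ge0.
exists k^-1; first by rewrite invr_gt0.
move=> x; rewrite ler_pdivrMl //; have [->|x0] := eqVneq x 0.
  by rewrite enorm0 dot0l expr0n mulr0.
pose y := invmx J *m x; have Jy : J *m y = x by rewrite mulmxA mulmxV // mul1mx.
have cs : dot x (J *m y) ^+ 2 <= dot x (J *m x) * dot y (J *m y).
  apply: discriminant_le => [|t]; first exact: J0.
  have := J0 (x - t *: y).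
  rewrite mulmxDr mulmxN -scalemxAr dotDl !dotDr !dotNl !dotNr !dotZl !dotZr.
  have -> : dot y (J *m x) = dot x (J *m y).
    by rewrite dot_mulmxr JT dotC.
  by rewrite !expr2 => h; nra.
have yx : dot y (J *m y) <= k * enorm x ^+ 2.
  rewrite Jy (le_trans (ler_dot _ _)) // expr2 mulrA ler_wpM2r ?enorm_ge0 //.
  rewrite (le_trans (enormM _ _)) // ler_wpM2r ?enorm_ge0 //.
  by rewrite lerDl.
have x2 : 0 < enorm x ^+ 2 by rewrite exprn_gt0 // enorm_gt0.
rewrite -(ler_pM2r x2) -expr2 -{1}dot_enorm -{2}Jy (le_trans cs) //.
rewrite (mulrC k) -mulrA; apply: ler_wpM2l => //.
Qed.

End Norms.

(** * Derivatives of matrix-valued functions *)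

Section MatrixDerivatives.
Variable R : realType.
Implicit Types t : R.

Lemma is_derive_mxP m n (M : R -> 'M[R]_(m, n)) t dM :
  is_derive t 1 M dM <-> forall i j, is_derive t 1 (fun u => M u i j) (dM i j).
Proof.
split=> [[dM1 <-] i j|h].
  have := (derivable_mxP M t 1).1 dM1 i j => d.
  by apply: DeriveDef => //; rewrite derive_mx // mxE.
have dM1 : derivable M t 1 by apply/derivable_mxP => i j; case: (h i j).
apply: DeriveDef => //; rewrite derive_mx //; apply/matrixP => i j.
by rewrite mxE; case: (h i j).
Qed.

Lemma is_derive_mulmx m n p (A : R -> 'M[R]_(m, n)) (B : R -> 'M[R]_(n, p)) t dA dB :
  is_derive t 1 A dA -> is_derive t 1 B dB ->
  is_derive t 1 (fun u => A u *m B u) (dA *m B t + A t *m dB).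
Proof.
move=> /is_derive_mxP hA /is_derive_mxP hB; apply/is_derive_mxP => i j.
have -> : (fun u => (A u *m B u) i j) = \sum_k (fun u => A u i k * B u k j).
  by apply/funext => u; rewrite mxE fct_sumE.
rewrite mxD !mxE -big_split /=; apply: is_derive_sum => k.
have -> : dA i k * B t k j + A t i k * dB k j
   = A t i k *: dB k j + B t k j *: dA i k.
  by rewrite addrC [X in _ + X]mulrC.
exact: is_deriveM.
Qed.

Lemma is_derive_tr m n (A : R -> 'M[R]_(m, n)) t dA :
  is_derive t 1 A dA -> is_derive t 1 (fun u => (A u)^T) dA^T.
Proof.
move=> /is_derive_mxP hA; apply/is_derive_mxP => i j; rewrite mxT.
by under eq_fun do rewrite mxT; exact: hA.
Qed.

Lemma is_derive_col3 (x : R -> 'cV[R]_3) t (dx : 'cV[R]_3) :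
  is_derive t 1 (fun u => x u 0 0) (dx 0 0) ->
  is_derive t 1 (fun u => x u 1 0) (dx 1 0) ->
  is_derive t 1 (fun u => x u 2%:R 0) (dx 2%:R 0) ->
  is_derive t 1 x dx.
Proof.
by move=> d0 d1 d2; apply/is_derive_mxP => i j; rewrite ord1; move: i; apply: ord3P.
Qed.

Lemma is_derive_vee (A : R -> 'M[R]_3) t (dA : 'M[R]_3) :
  is_derive t 1 A dA -> is_derive t 1 (fun u => vee (A u)) (vee dA).
Proof.
move=> /is_derive_mxP hA; apply: is_derive_col3; rewrite ?veeE;
by under eq_fun do rewrite veeE; exact: hA.
Qed.

Lemma is_derive_hat (x : R -> 'cV[R]_3) t (dx : 'cV[R]_3) :
  is_derive t 1 x dx -> is_derive t 1 (fun u => hat (x u)) (hat dx).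
Proof.
move=> /is_derive_mxP hx; apply/is_derive_mxP; do 2!apply: ord3P;
rewrite hatE; under eq_fun do rewrite hatE; try exact: hx;
try exact: is_derive_cst; exact: is_deriveN (hx _ _).
Qed.

Lemma is_derive_mxtrace n (A : R -> 'M[R]_n) t dA :
  is_derive t 1 A dA -> is_derive t 1 (fun u => \tr (A u)) (\tr dA).
Proof.
move=> /is_derive_mxP hA; rewrite /mxtrace.
have -> : (fun u => \sum_i A u i i) = \sum_i (fun u => A u i i).
  by apply/funext => u; rewrite fct_sumE.
exact: is_derive_sum.
Qed.

Lemma is_derive_dot (x y : R -> 'cV[R]_3) t dx dy :
  is_derive t 1 x dx -> is_derive t 1 y dy ->
  is_derive t 1 (fun u => dot (x u) (y u)) (dot dx (y t) + dot (x t) dy).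
Proof.
move=> hx hy; have := is_derive_mulmx (is_derive_tr hx) hy.
by move=> /is_derive_mxP /(_ 0 0); rewrite mxD.
Qed.

Lemma is_derive_fD (V : normedModType R) (f g : R -> V) t df dg :
  is_derive t 1 f df -> is_derive t 1 g dg ->
  is_derive t 1 (fun u => f u + g u) (df + dg).
Proof. exact: is_deriveD. Qed.

Lemma is_derive_fN (V : normedModType R) (f : R -> V) t df :
  is_derive t 1 f df -> is_derive t 1 (fun u => - f u) (- df).
Proof. exact: is_deriveN. Qed.

Lemma is_derive_fZ (V : normedModType R) a (f : R -> V) t df :
  is_derive t 1 f df -> is_derive t 1 (fun u => a *: f u) (a *: df).
Proof. exact: is_deriveZ. Qed.

Lemma is_derive_fM (f g : R -> R) t df dg :
  is_derive t 1 f df -> is_derive t 1 g dg ->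
  is_derive t 1 (fun u => f u * g u) (df * g t + f t * dg).
Proof.
move=> hf hg.
have -> : df * g t + f t * dg = f t *: dg + g t *: df.
  by rewrite addrC [X in _ + X]mulrC.
exact: is_deriveM.
Qed.

Lemma is_derive_fsum (V : normedModType R) n (h : 'I_n -> R -> V) t
    (dh : 'I_n -> V) :
  (forall i, is_derive t 1 (h i) (dh i)) ->
  is_derive t 1 (fun u => \sum_i h i u) (\sum_i dh i).
Proof.
move=> hh; have -> : (fun u => \sum_i h i u) = \sum_i h i.
  by apply/funext => u; rewrite fct_sumE.
exact: is_derive_sum.
Qed.

Lemma is_derive_scale m n (a : R -> R) (A : R -> 'M[R]_(m, n)) t da dA :
  is_derive t 1 a da -> is_derive t 1 A dA ->
  is_derive t 1 (fun u => a u *: A u) (da *: A t + a t *: dA).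
Proof.
move=> ha /is_derive_mxP hA; apply/is_derive_mxP => i j; rewrite mxD !mxZ.
under eq_fun do rewrite mxZ; exact: is_derive_fM.
Qed.

Lemma is_derive_enorm (x : R -> 'cV[R]_3) t (dx : 'cV[R]_3) : x t != 0 ->
  is_derive t 1 x dx ->
  is_derive t 1 (fun u => enorm (x u)) ((enorm (x t))^-1 * dot (x t) dx).
Proof.
move=> x0 hx.
have -> : (fun u => enorm (x u)) = Num.sqrt \o (fun u => dot (x u) (x u)).
  by apply/funext => u /=; rewrite dot_enorm sqrtr_sqr ger0_norm ?enorm_ge0.
have xx : 0 < dot (x t) (x t) by rewrite dot_enorm exprn_gt0 // enorm_gt0.
have h1 := is_derive1_sqrt xx.
have h2 := is_derive_dot hx hx.
have := is_derive1_comp h1 h2.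
rewrite dot_enorm sqrtr_sqr ger0_norm ?enorm_ge0 // (dotC dx).
move=> h; apply: (is_derive_eq h); have := x0; rewrite -enorm_eq0 => e0.
by rewrite mulrC; field.
Qed.

Lemma is_derive_inv (f : R -> R) t df : f t != 0 -> is_derive t 1 f df ->
  is_derive t 1 (fun u => (f u)^-1) (- (f t) ^- 2 * df).
Proof. by move=> f0 hf; exact: is_deriveV. Qed.

Lemma is_derive_unit_opp (x : R -> 'cV[R]_3) t (dx : 'cV[R]_3) : x t != 0 ->
  is_derive t 1 x dx ->
  is_derive t 1 (fun u => unit_opp (x u))
    ((enorm (x t) ^- 3 * dot (x t) dx) *: x t - (enorm (x t))^-1 *: dx).
Proof.
move=> x0 hx; have e0 : enorm (x t) != 0 by rewrite enorm_eq0.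
have hn := is_derive_enorm x0 hx.
have hi := @is_derive_inv (fun u => enorm (x u)) t _ e0 hn.
have := is_derive_scale (is_derive_fN hi) hx.
move=> h; apply: (is_derive_eq h); rewrite [- _^-1 *: dx]scaleNr.
by congr (_ *: x t + _); field.
Qed.

Lemma is_derive1 (V : normedModType R) (f : R -> V) t df :
  is_derive t 1 f df -> derive1 f t = df.
Proof. by case=> _ <-; rewrite derive1E. Qed.

Lemma derivable1 (V : normedModType R) (f : R -> V) t :
  derivable f t 1 -> is_derive t 1 f (derive1 f t).
Proof. by move=> h; apply: DeriveDef => //; rewrite derive1E. Qed.

Lemma unit_opp_rate_orth (x : R -> 'cV[R]_3) t (dx : 'cV[R]_3) : x t != 0 ->
  is_derive t 1 x dx ->
  dot (unit_opp (x t)) (derive1 (fun u => unit_opp (x u)) t) = 0.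
Proof.
move=> x0 hx; rewrite (is_derive1 (is_derive_unit_opp x0 hx)) /unit_opp.
rewrite -enorm_eq0 in x0.
by rewrite dotDr dotNr !dotZl !dotZr dot_enorm; field.
Qed.

(** Expanding the double product shows that a unit vector turns with the angular velocity x cross
    dx, which explains the definition of [omd]. *)
Lemma unit_rate_cross (x dx : 'cV[R]_3) : dot x x = 1 -> dot x dx = 0 ->
  dx = hat (hat x *m dx) *m x.
Proof. by move=> xx xdx; rewrite hatC hat_hat xdx xx scale0r scale1r sub0r opprK. Qed.

Lemma is_derive_derive1 (V : normedModType R) (f : R -> V) t df :
  is_derive t 1 f df -> is_derive t 1 f (derive1 f t).
Proof. by case=> h _; exact: derivable1. Qed.

Lemma is_derive_continuous (f : R -> R) t df :
  is_derive t 1 f df -> {for t, continuous f}.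
Proof. by case=> h _; apply/differentiable_continuous/derivable1_diffP. Qed.

End MatrixDerivatives.

(** * Tensions and payload dynamics *)

Section Tension.
Variables (R : realType) (n : nat) (p : plant R n).

Definition attach (i : 'I_n) : 'M[R]_(3 + 3, 3) := col_mx 1%:M (hat (rho p i)).

(** The i-th block row of the right inverse P^T (P P^T)^-1 of P; [gainF] and [gainM] are its halves,
    acting on the force and on the moment. *)
Definition alloc (i : 'I_n) : 'M[R]_(3, 3 + 3) :=
  (attach i)^T *m invmx (Pmx p *m (Pmx p)^T).

Definition gainF i : 'M[R]_3 := lsubmx (alloc i).
Definition gainM i : 'M[R]_3 := rsubmx (alloc i).

(** If v P P^T = 0 then |v P|^2 = 0, so v P = 0; the rank of P is its number of rows, hence v =
    0. *)
Lemma PmxPT_unit : (6 <= \rank (Pmx p))%N -> Pmx p *m (Pmx p)^T \in unitmx.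
Proof.
move=> rk; rewrite -row_free_unit -kermx_eq0; apply/eqP/row_matrixP => i.
rewrite row0; set v := row i _.
have vPP : v *m (Pmx p *m (Pmx p)^T) = 0 by rewrite -row_mul mulmx_ker row0.
have vP : v *m Pmx p = 0.
  have h : (v *m Pmx p) *m (v *m Pmx p)^T = 0.
    by rewrite trmx_mul !mulmxA -(mulmxA v) vPP mul0mx.
  have {}h : \sum_j (v *m Pmx p) 0 j ^+ 2 = 0.
    have /matrixP /(_ 0 0) := h; rewrite mxE mx0E => h0; rewrite -[RHS]h0.
    by apply: eq_bigr => j _; rewrite mxT expr2.
  apply/rowP => j; rewrite mx0E; apply/eqP; rewrite -sqrf_eq0; apply/eqP.
  by move/psumr_eq0P: h => /(_ (fun j _ => sqr_ge0 _)) /(_ j isT).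
have fr : row_free (Pmx p) by rewrite /row_free eqn_leq rank_leq_row.
by apply: (row_free_inj fr); rewrite vP mul0mx.
Qed.

(** The allocation matrices are constant, so in this form tensions can be differentiated and bounded
    through attitude, force and moment alone. *)
Lemma tensionE A F M i :
  tension p A F M i = A *m (gainF i *m (A^T *m F) + gainM i *m M).
Proof.
rewrite /tension /gainF /gainM /alloc; set G := invmx _.
rewrite /Pmx tr_mxrow mul_mxdiag_mxcol !mxcol_mul mxcolK -!mulmxA; congr (_ *m _).
by rewrite mulmxA -/(attach i) -[X in X *m _]hsubmxK mul_row_col.
Qed.

Lemma alloc_sum : (6 <= \rank (Pmx p))%N ->
  \sum_i attach i *m alloc i = 1%:M.
Proof.
move=> rk; have := mulmxV (PmxPT_unit rk).
set G := invmx _.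
rewrite /Pmx tr_mxrow mul_mxrow_mxcol mulmx_suml => <-.
by apply: eq_bigr => i _; rewrite mulmxA.
Qed.

(** P times its right inverse is the identity, read off in blocks of size three. *)
Lemma gains_sum : (6 <= \rank (Pmx p))%N ->
  [/\ \sum_i gainF i = 1%:M, \sum_i gainM i = 0,
      \sum_i hat (rho p i) *m gainF i = 0 &
      \sum_i hat (rho p i) *m gainM i = 1%:M].
Proof.
move=> /alloc_sum.
have -> : \sum_i attach i *m alloc i =
    block_mx (\sum_i gainF i) (\sum_i gainM i)
      (\sum_i hat (rho p i) *m gainF i) (\sum_i hat (rho p i) *m gainM i).
  elim: (index_enum _) => [|i r IH].
    by rewrite !big_nil; apply/matrixP => a b; rewrite !mxE; case: splitP => k _;
      rewrite !mxE; case: splitP => l _; rewrite mxE.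
  rewrite !big_cons IH -add_block_mx; congr (_ + _).
  by rewrite -[alloc i]hsubmxK mul_col_row !mul1mx.
by rewrite scalar_mx_block => /eq_block_mx [].
Qed.

Lemma sum_tension A F M : (6 <= \rank (Pmx p))%N -> SO3 A ->
  \sum_i tension p A F M i = F.
Proof.
move=> /gains_sum [gF gM _ _] hA; under eq_bigr do rewrite tensionE.
rewrite -mulmx_sumr big_split /= -!mulmx_suml gF gM mul0mx addr0 mul1mx.
by rewrite mulmxA SO3_inv // mul1mx.
Qed.

Lemma sum_moment_tension A F M : (6 <= \rank (Pmx p))%N -> SO3 A ->
  \sum_i hat (rho p i) *m A^T *m tension p A F M i = M.
Proof.
move=> /gains_sum [_ _ gF gM] [AA _]; under eq_bigr do rewrite tensionE.
under eq_bigr do rewrite mulmxA -(mulmxA _ A^T A) AA mulmx1 mulmxDr !mulmxA.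
rewrite big_split /= -!mulmx_suml.
by rewrite gF gM !mul0mx add0r mul1mx.
Qed.

End Tension.

(** * Accelerations of the payload and the links in closed loop *)

Section ClosedLoop.
Variables (R : realType) (n : nat).

(* Testing the two equations against Y and W gives a sum of squares. *)
Lemma coupling_eq0 (m : R) (J : 'M[R]_3) (a : 'I_n -> R)
    (v : 'I_n -> 'cV[R]_3) (B : 'I_n -> 'M[R]_3) (Y W : 'cV[R]_3) :
  0 < m -> (forall x, x != 0 -> 0 < dot x (J *m x)) -> (forall i, 0 <= a i) ->
  m *: Y + \sum_i a i *: (qq (v i) *m (Y - B i *m W)) = 0 ->
  J *m W - \sum_i a i *: ((B i)^T *m (qq (v i) *m (Y - B i *m W))) = 0 ->
  Y = 0 /\ W = 0.
Proof.
move=> m_gt0 Jpos a_ge0 eY eW.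
have J_ge0 : 0 <= dot W (J *m W).
  by have [->|/Jpos/ltW//] := eqVneq W 0; rewrite dot0l.
have e : m * dot Y Y + dot W (J *m W)
    + \sum_i a i * dot (v i) (Y - B i *m W) ^+ 2 = 0.
  have hY := congr1 (dot Y) eY; have hW := congr1 (dot W) eW.
  rewrite dotDr dotZr dot_sumr dot0r in hY.
  rewrite dotDr dotNr dot_sumr dot0r in hW.
  have -> : \sum_i a i * dot (v i) (Y - B i *m W) ^+ 2 =
     \sum_i dot Y (a i *: (qq (v i) *m (Y - B i *m W)))
     - \sum_i dot W (a i *: ((B i)^T *m (qq (v i) *m (Y - B i *m W)))).
    rewrite -sumrB; apply: eq_bigr => i _.
    rewrite !dotZr -mulrBr (dot_mulmxr (B i)^T) trmxK -dotNl -dotDl qq_mul dotZr.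
    by rewrite expr2 (dotC (Y - _)).
  by rewrite addrACA hY add0r hW.
have s_ge0 : 0 <= \sum_i a i * dot (v i) (Y - B i *m W) ^+ 2.
  by apply: sumr_ge0 => i _; rewrite mulr_ge0 ?sqr_ge0.
have mY : 0 <= m * dot Y Y by rewrite mulr_ge0 ?dot_ge0 // ltW.
have Y0 : m * dot Y Y = 0 by lra.
have W0 : dot W (J *m W) = 0 by lra.
split; last by apply/eqP; apply: contraT => /Jpos; rewrite W0 ltxx.
move/eqP: Y0; rewrite mulf_eq0 (gt_eqF m_gt0) /= dot_enorm sqrf_eq0 enorm_eq0.
by move/eqP.
Qed.

(** Groups the terms of each link into the projection of [x - A *m H i *m W], the acceleration of
    its attachment point up to the centripetal part. This is the shape treated by [coupling_eq0];
    [moment_balanceE] does the same for the moments. *)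
Lemma force_balanceE (m : R) (a : 'I_n -> R) (Q H : 'I_n -> 'M[R]_3)
    (A : 'M[R]_3) (x W : 'cV[R]_3) :
  (m%:M + \sum_i a i *: Q i) *m x - \sum_i a i *: (Q i *m A *m H i *m W)
  = m *: x + \sum_i a i *: (Q i *m (x - A *m H i *m W)).
Proof.
rewrite mulmxDl mul_scalar_mx mulmx_suml -addrA -sumrB; congr (_ + _).
by apply: eq_bigr => i _; rewrite mulmxBr -scalemxAl !mulmxA; linmx.
Qed.

Lemma moment_balanceE (J : 'M[R]_3) (a : 'I_n -> R) (Q H : 'I_n -> 'M[R]_3)
    (A : 'M[R]_3) (x W : 'cV[R]_3) :
  (J - \sum_i a i *: (H i *m A^T *m Q i *m A *m H i)) *m W
  + \sum_i a i *: (H i *m A^T *m Q i *m x)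
  = J *m W + \sum_i a i *: (H i *m A^T *m (Q i *m (x - A *m H i *m W))).
Proof.
rewrite mulmxBl mulmx_suml -addrA; congr (_ + _).
rewrite addrC -sumrB; apply: eq_bigr => i _.
by rewrite -scalemxAl !mulmxBr !mulmxA; linmx.
Qed.

Variables (p : plant R n) (c : command R) (k : gains R) (s : motion R n) (t : R).

Local Notation q := (q s ^~ t).
Local Notation A := (R0 s t).
Local Notation Om := (Om0 s t).
Local Notation mu := (mu p c k s ^~ t).
Local Notation omd := (omd p c k s).

(** The nominal accelerations, here and in [payload_angacc], are those of a free payload pulled by
    the virtual tensions, the translational one without gravity. *)
Definition payload_acc : 'cV[R]_3 := (m0 p)^-1 *: \sum_j mu j.

Definition payload_angacc : 'cV[R]_3 :=
  invmx (J0 p) *m (\sum_j hat (rho p j) *m A^T *m mu j - hat Om *m J0 p *m Om).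

(** The angular acceleration prescribed for a link, before projection onto the plane normal to
    it. *)
Definition link_input i : 'cV[R]_3 :=
  - kq k *: e_q p c k s i t - kom k *: e_om p c k s i t
  - dot (q i) (omd i t) *: derive1 (Defs.q s i) t
  - hat (q i) *m hat (q i) *m derive1 (omd i) t.

(** Thus [acc] is the acceleration of the attachment point computed from the nominal accelerations,
    available to the controller without measuring the actual ones. *)
Lemma accE i : acc p c k s i t =
  payload_acc + A *m hat Om *m hat Om *m rho p i
  - A *m hat (rho p i) *m payload_angacc.
Proof.
by rewrite /acc /payload_angacc /payload_acc !(mulmxBr, mulmxA); linmx.
Qed.

Lemma qq_idem (x : 'cV[R]_3) : S2 x -> qq x *m qq x = qq x.
Proof.
move=> x1; rewrite /qq mulmxA -(mulmxA x) [x^T *m x]mx11_scalar.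
by rewrite -/(dot x x) dot_enorm x1 expr1n mulmx1.
Qed.

Lemma qq_idemK m (x : 'cV[R]_3) (v : 'M[R]_(3, m)) :
  S2 x -> qq x *m (qq x *m v) = qq x *m v.
Proof. by move=> x1; rewrite mulmxA qq_idem. Qed.

Lemma qq_self (x : 'cV[R]_3) : S2 x -> qq x *m x = x.
Proof. by move=> x1; rewrite qq_mul dot_enorm x1 expr1n scale1r. Qed.

Lemma qq_hat (x : 'cV[R]_3) : qq x *m hat x = 0. Proof. by_coords. Qed.

Lemma muE i : mu i = qq (q i) *m mud p c k s i t. Proof. by []. Qed.

Lemma ctrl_split i : S2 (q i) ->
  qq (q i) *m ctrl p c k s i t = ctrl_par p c k s i t /\
  (1%:M - qq (q i)) *m ctrl p c k s i t = ctrl_perp p c k s i t.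
Proof.
move=> q1; have par : qq (q i) *m ctrl_par p c k s i t = ctrl_par p c k s i t.
  rewrite /ctrl_par muE; move: (acc _ _ _ _ _ _) => b.
  by rewrite 2!mulmxDr -!scalemxAr qq_self // !qq_idemK.
have perp : qq (q i) *m ctrl_perp p c k s i t = 0.
  rewrite /ctrl_perp; move: (acc _ _ _ _ _ _) => b.
  rewrite mulmxDr mulmxN -!scalemxAr !mulmxA qq_hat !mul0mx.
  by rewrite !scaler0 subr0.
split; first by rewrite /ctrl mulmxDr par perp addr0.
rewrite mulmxBl mul1mx {2}/ctrl mulmxDr par perp addr0 /ctrl.
by rewrite addrC addKr.
Qed.

(** Both directions are needed: trajectories obey the decoupled equations, and the commanded motion
    is checked against the coupled ones. The nominal accelerations solve the payload equations by
    the choice of the parallel control; [coupling_eq0], applied to the deviation from them, excludes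
    any other solution, and then [acc] drops out of the link equations. *)
Lemma dynamicsE : plant_ok p -> constraints s t ->
  dynamics p (ctrl p c k s ^~ t) s t <->
  [/\ derive1 (derive1 (x0 s)) t - grav p *: e3 = payload_acc,
      derive1 (Om0 s) t = payload_angacc
    & forall i, derive1 (om s i) t = - (hat (q i) *m (hat (q i) *m link_input i))].
Proof.
move=> [[m0_gt0 _] JT Jpos ml_gt0 rk] [[AA dA] hq].
rewrite /dynamics.
set y := derive1 (derive1 _) t - _; set W := derive1 (Om0 s) t.
pose B i := A *m hat (rho p i).
have BT i : (B i)^T = - (hat (rho p i) *m A^T).
  by rewrite trmx_mul tr_hat mulNmx.
(* The parallel control cancels the centripetal terms and reproduces the coupling terms at the
   nominal accelerations. *)
have loadE i : qq (q i) *m ctrl p c k s i t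
    - (mass p i * len p i * enorm (om s i t) ^+ 2) *: q i
    - mass p i *: (qq (q i) *m A *m hat Om *m hat Om *m rho p i)
    = mu i + mass p i *: (qq (q i) *m (payload_acc - B i *m payload_angacc)).
  have [-> _] := ctrl_split (hq i).1.
  rewrite /ctrl_par accE /B; move: (Defs.mu _ _ _ _ _ _) (qq _) => v Q.
  by rewrite !(mulmxDr, mulmxN) !mulmxA; linmx.
rewrite force_balanceE moment_balanceE.
rewrite (eq_bigr _ (fun i _ => loadE i)).
rewrite (eq_bigr _ (fun i _ => congr1 (mulmx (hat (rho p i) *m A^T)) (loadE i))).
have m0ya : \sum_i mu i = m0 p *: payload_acc.
  by rewrite /payload_acc scalerA divff ?gt_eqF // scale1r.
have J0wa : \sum_i hat (rho p i) *m A^T *m mu i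
    = J0 p *m payload_angacc + hat Om *m J0 p *m Om.
  by rewrite /payload_angacc mulmxA mulmxV ?posdef_unitmx // mul1mx subrK.
rewrite [X in [/\ _ = X, _ & _]]big_split /= m0ya.
have -> : \sum_i hat (rho p i) *m A^T *m
    (mu i + mass p i *: (qq (q i) *m (payload_acc - B i *m payload_angacc)))
  = J0 p *m payload_angacc + hat Om *m J0 p *m Om + \sum_i mass p i *:
    (hat (rho p i) *m A^T *m (qq (q i) *m (payload_acc - B i *m payload_angacc))).
  rewrite -J0wa -big_split /=; apply: eq_bigr => i _.
  by rewrite mulmxDr -scalemxAr.
have linkE i : (len p i)^-1 *: (hat (q i) *m
      (payload_acc - A *m hat (rho p i) *m payload_angacc
        + A *m hat Om *m hat Om *m rho p i))
    - (mass p i * len p i)^-1 *: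
      (hat (q i) *m ((1%:M - qq (q i)) *m ctrl p c k s i t))
    = - (hat (q i) *m (hat (q i) *m link_input i)).
  have [_ ->] := ctrl_split (hq i).1.
  have [m_gt0 l_gt0] := ml_gt0 i.
  rewrite /ctrl_perp -/(link_input i) addrAC -accE.
  rewrite mulmxBr -!scalemxAr -(mulmxA (hat _) (hat _)) hat_hat_hat.
  rewrite dot_enorm (hq i).1 expr1n.
  move: (hat _ *m acc _ _ _ _ _ _) (hat _ *m (hat _ *m _)) => u v.
  by apply/colP => j; rewrite ?(mxD, mxN, mxZ); field; rewrite !gt_eqF.
split=> [[eF eM eL]|[-> -> eL]]; last first.
  by split=> // [|i]; [exact: addrAC | rewrite linkE].
have dE i : y - B i *m W - (payload_acc - B i *m payload_angacc)
    = y - payload_acc - B i *m (W - payload_angacc).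
  by rewrite mulmxBr; linmx.
have [Y0 W0] : y - payload_acc = 0 /\ W - payload_angacc = 0.
  apply: (@coupling_eq0 (m0 p) (J0 p) (mass p) q B) => // [i||].
  - by have [/ltW] := ml_gt0 i.
  - have : m0 p *: y - m0 p *: payload_acc +
      (\sum_i mass p i *: (qq (q i) *m (y - B i *m W)) -
       \sum_i mass p i *: (qq (q i) *m (payload_acc - B i *m payload_angacc))) = 0.
      by rewrite addrACA eF -opprD subrr.
    move=> h; rewrite -[RHS]h -scalerBr -sumrB; congr (_ + _); apply: eq_bigr => i _.
    by rewrite -scalerBr -mulmxBr dE.
  - have : J0 p *m W - J0 p *m payload_angacc +
      (\sum_i mass p i *: (hat (rho p i) *m A^T *m (qq (q i) *m (y - B i *m W))) -
       \sum_i mass p i *: (hat (rho p i) *m A^T *m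
         (qq (q i) *m (payload_acc - B i *m payload_angacc)))) = 0.
      apply/eqP; rewrite addrACA -opprD subr_eq0; apply/eqP.
      by apply: (addIr (hat Om *m J0 p *m Om)); rewrite eM addrAC.
    move=> h; rewrite -[RHS]h -mulmxBr -sumrB; congr (_ + _).
    rewrite -sumrN; apply: eq_bigr => i _.
    by rewrite BT mulNmx scalerN opprK -scalerBr -!mulmxBr dE.
have ey : y = payload_acc by apply/eqP; rewrite -subr_eq0 Y0.
have eW : W = payload_angacc by apply/eqP; rewrite -subr_eq0 W0.
by split=> // i; rewrite eL ey eW linkE.
Qed.


End ClosedLoop.

(** * Smooth commands *)

Section Smooth.
Variable R : realType.

Lemma smooth_derive (V : normedModType R) (f : R -> V) (t : R) :
  smooth f -> is_derive t 1 f (derive1 f t).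
Proof. by move=> /(_ 0%N t) h; apply: derivable1. Qed.

Lemma smooth_derive1 (V : normedModType R) (f : R -> V) :
  smooth f -> smooth (derive1 f).
Proof. by move=> h j t; have := h j.+1 t; rewrite derive1Sn. Qed.

(** A finite-order form of [smooth] that peels off the innermost derivative. Closure under products
    then goes by induction on the order, the derivative of a product being a sum of products of
    lower order. *)
Fixpoint diffn (V : normedModType R) (k : nat) (f : R -> V) : Prop :=
  if k is k'.+1 then (forall t : R, derivable f t 1) /\ diffn k' (derive1 f)
  else True.

Lemma smoothP (V : normedModType R) (f : R -> V) :
  smooth f <-> forall k, diffn k f.
Proof.
split=> [fs k|fk k t].
  elim: k f fs => [//|k IH] f fs; split; first exact: (fs 0%N).
  exact/IH/smooth_derive1.
have := fk k.+1; elim: k f {fk} => [|k IH] f [df dk]; first exact: df.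
by rewrite derive1Sn; exact: IH.
Qed.

Lemma diffnW (V : normedModType R) k (f : R -> V) : diffn k.+1 f -> diffn k f.
Proof.
elim: k f => [//|k IH] f [df dk]; split=> //; exact: IH.
Qed.

Lemma diffnS (V : normedModType R) k (f df : R -> V) :
  (forall t : R, is_derive t 1 f (df t)) -> diffn k df -> diffn k.+1 f.
Proof.
move=> h hk; split; first by move=> t; case: (h t).
by have -> : derive1 f = df by apply/funext => t; exact: is_derive1.
Qed.

Lemma diffn_derive (V : normedModType R) k (f : R -> V) : diffn k.+1 f ->
  (forall t : R, is_derive t 1 f (derive1 f t)) /\ diffn k (derive1 f).
Proof. by case=> h hk; split=> // t; exact: derivable1. Qed.

Lemma diffn_cst (V : normedModType R) k (v : V) : diffn k (fun _ : R => v).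
Proof.
elim: k v => [//|k IH] v; exact: (diffnS (df := fun=> 0)).
Qed.

Lemma diffnD (V : normedModType R) k (f g : R -> V) :
  diffn k f -> diffn k g -> diffn k (fun u => f u + g u).
Proof.
elim: k f g => [//|k IH] f g /diffn_derive[df fk] /diffn_derive[dg gk].
apply: (diffnS (fun t => is_derive_fD (df t) (dg t))); exact: IH.
Qed.

Lemma diffnZ (V : normedModType R) k a (f : R -> V) :
  diffn k f -> diffn k (fun u => a *: f u).
Proof.
elim: k f => [//|k IH] f /diffn_derive[df fk].
apply: (diffnS (fun t => is_derive_fZ a (df t))); exact: IH.
Qed.

Lemma diffn_mulmx k m l r (f : R -> 'M[R]_(m, l)) (g : R -> 'M[R]_(l, r)) :
  diffn k f -> diffn k g -> diffn k (fun u => f u *m g u).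
Proof.
elim: k f g => [//|k IH] f g hf hg.
have [df fk] := diffn_derive hf; have [dg gk] := diffn_derive hg.
apply: (diffnS (fun t => is_derive_mulmx (df t) (dg t))).
by apply: diffnD; apply: IH => //; exact: diffnW.
Qed.

Lemma diffn_tr k m l (f : R -> 'M[R]_(m, l)) :
  diffn k f -> diffn k (fun u => (f u)^T).
Proof.
elim: k f => [//|k IH] f /diffn_derive[df fk].
apply: (diffnS (fun t => is_derive_tr (df t))); exact: IH.
Qed.

Lemma diffn_vee k (f : R -> 'M[R]_3) : diffn k f -> diffn k (fun u => vee (f u)).
Proof.
elim: k f => [//|k IH] f /diffn_derive[df fk].
apply: (diffnS (fun t => is_derive_vee (df t))); exact: IH.
Qed.

Lemma diffn_hat k (f : R -> 'cV[R]_3) : diffn k f -> diffn k (fun u => hat (f u)).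
Proof.
elim: k f => [//|k IH] f /diffn_derive[df fk].
apply: (diffnS (fun t => is_derive_hat (df t))); exact: IH.
Qed.

Lemma smooth_cst (V : normedModType R) (v : V) : smooth (fun _ : R => v).
Proof. by apply/smoothP => k; exact: diffn_cst. Qed.

Lemma smoothD (V : normedModType R) (f g : R -> V) :
  smooth f -> smooth g -> smooth (fun u => f u + g u).
Proof. by move=> /smoothP hf /smoothP hg; apply/smoothP => k; exact: diffnD. Qed.

Lemma smoothZ (V : normedModType R) a (f : R -> V) :
  smooth f -> smooth (fun u => a *: f u).
Proof. by move=> /smoothP hf; apply/smoothP => k; exact: diffnZ. Qed.

Lemma smooth_mulmx m l r (f : R -> 'M[R]_(m, l)) (g : R -> 'M[R]_(l, r)) :
  smooth f -> smooth g -> smooth (fun u => f u *m g u).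
Proof. by move=> /smoothP hf /smoothP hg; apply/smoothP => k; exact: diffn_mulmx. Qed.

Lemma smooth_tr m l (f : R -> 'M[R]_(m, l)) : smooth f -> smooth (fun u => (f u)^T).
Proof. by move=> /smoothP hf; apply/smoothP => k; exact: diffn_tr. Qed.

Lemma smooth_vee (f : R -> 'M[R]_3) : smooth f -> smooth (fun u => vee (f u)).
Proof. by move=> /smoothP hf; apply/smoothP => k; exact: diffn_vee. Qed.

Lemma smooth_hat (f : R -> 'cV[R]_3) : smooth f -> smooth (fun u => hat (f u)).
Proof. by move=> /smoothP hf; apply/smoothP => k; exact: diffn_hat. Qed.

End Smooth.

Section CommandSmooth.
Variables (R : realType) (n : nat) (p : plant R n) (c : command R).
Hypothesis c_ok : command_ok c.

Lemma smooth_Omd : smooth (Omd c).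
Proof.
have [_ Rs _ _ _] := c_ok.
exact: smooth_vee (smooth_mulmx (smooth_tr Rs) (smooth_derive1 Rs)).
Qed.

Definition cmd_F (t : R) : 'cV[R]_3 :=
  m0 p *: (derive1 (derive1 (xd c)) t - grav p *: e3).

Definition cmd_M (t : R) : 'cV[R]_3 :=
  hat (Omd c t) *m J0 p *m Omd c t + J0 p *m derive1 (Omd c) t.

Lemma smooth_cmd_F : smooth cmd_F.
Proof.
have [xs _ _ _ _] := c_ok.
apply: smoothZ; apply: smoothD; last exact: smooth_cst.
exact/smooth_derive1/smooth_derive1.
Qed.

Lemma smooth_cmd_M : smooth cmd_M.
Proof.
have Os := smooth_Omd; apply: smoothD; apply: smooth_mulmx.
- by apply: smooth_mulmx; [exact: smooth_hat|exact: smooth_cst].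
- by [].
- exact: smooth_cst.
- exact: smooth_derive1.
Qed.

Lemma smooth_cmd_tension i : smooth (cmd_tension p c i).
Proof.
have [_ Rs _ _ _] := c_ok.
have -> : cmd_tension p c i = fun u => Rd c u *m
    (gainF p i *m ((Rd c u)^T *m cmd_F u) + gainM p i *m cmd_M u).
  by apply/funext => u; rewrite /cmd_tension tensionE.
have hF := smooth_mulmx (@smooth_cst R _ (gainF p i))
  (smooth_mulmx (smooth_tr Rs) smooth_cmd_F).
have hM := smooth_mulmx (@smooth_cst R _ (gainM p i)) smooth_cmd_M.
have hFM := smoothD hF hM.
exact: smooth_mulmx Rs hFM.
Qed.

End CommandSmooth.

(** * Error dynamics *)

Section ErrorDynamics.
Variables (R : realType) (n : nat).
Variables (p : plant R n) (c : command R) (k : gains R) (s : motion R n).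
Hypotheses (p_ok : plant_ok p) (c_ok : command_ok c).
Implicit Types t : R.

Local Notation J := (J0 p).

(** Since [vee] reads only three entries, this requires [(Rd c t)^T *m derive1 (Rd c) t] to be skew,
    which follows by differentiating Rd^T Rd = 1. *)
Lemma is_derive_Rd t : is_derive t 1 (Rd c) (Rd c t *m hat (Omd c t)).
Proof.
have [_ Rd_smooth Rd_SO3 _ _] := c_ok.
have dRd := smooth_derive t Rd_smooth.
suff -> : Rd c t *m hat (Omd c t) = derive1 (Rd c) t by [].
rewrite vee_skewK ?mulmxA ?SO3_inv ?mul1mx //.
have h : is_derive t 1 (fun u => (Rd c u)^T *m Rd c u)
    ((derive1 (Rd c) t)^T *m Rd c t + (Rd c t)^T *m derive1 (Rd c) t).
  exact: is_derive_mulmx (is_derive_tr dRd) dRd.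
have e : (fun u => (Rd c u)^T *m Rd c u) = cst (1%:M : 'M[R]_3).
  by apply/funext => u; case: (Rd_SO3 u).
rewrite e in h; have := is_derive1 h; rewrite derive1_cst => h0.
by rewrite trmx_mul trmxK; apply/eqP; rewrite -addr_eq0 -h0.
Qed.

(** Moving [hat w] across the rotation [A^T *m B] transports w by its transpose, so the relative
    rotation has the difference of the two angular velocities, resolved in one frame, as its own. *)
Lemma att_err_rate (A B : 'M[R]_3) (v w : 'cV[R]_3) : SO3 A -> SO3 B ->
  (A *m hat w)^T *m B + A^T *m (B *m hat v)
  = A^T *m B *m hat (v - (A^T *m B)^T *m w).
Proof.
move=> hA hB; have hX := SO3_mul (SO3_tr hA) hB.
rewrite hatD hatN mulmxDr mulmxN -(SO3_hat _ (SO3_tr hX)) trmxK.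
have hX1 := SO3_inv hX; rewrite trmx_mul tr_hat !mulNmx addrC mulmxA -[X in _ - X]mulmxA.
congr (_ - _); rewrite -[LHS]mul1mx -hX1.
by move: (A^T *m B) => X; rewrite -!mulmxA.
Qed.

Definition att_err t : 'M[R]_3 := (Rd c t)^T *m R0 s t.

(** One minus the cosine of the relative rotation angle; it equals 2 at a half turn, where [e_R]
    vanishes. *)
Definition psiR t : R := 2^-1 * (3 - \tr (att_err t)).

(** The desired angular velocity resolved in the payload frame. *)
Definition W t : 'cV[R]_3 := (att_err t)^T *m Omd c t.

Definition F_err t : 'cV[R]_3 := \sum_i (mu p c k s i t - mud p c k s i t).

Definition M_err t : 'cV[R]_3 :=
  \sum_i hat (rho p i) *m (R0 s t)^T *m (mu p c k s i t - mud p c k s i t).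

(** What the feedforward moment leaves uncompensated: the gyroscopic moments of the desired and the
    actual angular velocity differ, and [W] itself turns with [e_Om]. *)
Definition gyro t : 'cV[R]_3 :=
  hat (W t) *m (J *m W t) - hat (Om0 s t) *m (J *m Om0 s t)
  + J *m (hat (e_Om c s t) *m W t).

Lemma e_RE t : e_R c s t = 2^-1 *: vee (att_err t - (att_err t)^T).
Proof. by rewrite /e_R /att_err trmx_mul trmxK. Qed.

Lemma e_OmE t : e_Om c s t = Om0 s t - W t.
Proof. by rewrite /e_Om /W /att_err trmx_mul trmxK. Qed.

Section AtTime.
Variable t : R.
Hypothesis cl : closed_loop_at p c k s t.

Let q_unit i : S2 (q s i t). Proof. by case: cl => -[_ /(_ i) []]. Qed.
Let q_om i : dot (q s i t) (om s i t) = 0.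
Proof. by case: cl => -[_ /(_ i) []]. Qed.
Let R_SO3 : SO3 (R0 s t). Proof. by case: cl => -[]. Qed.
Let Rd_SO3 u : SO3 (Rd c u). Proof. by case: c_ok. Qed.
Let rkP : (6 <= \rank (Pmx p))%N. Proof. by case: p_ok. Qed.

Let dyn : [/\ derive1 (derive1 (x0 s)) t - grav p *: e3 = payload_acc p c k s t,
      derive1 (Om0 s) t = payload_angacc p c k s t
    & forall i, derive1 (om s i) t =
      - (hat (q s i t) *m (hat (q s i t) *m link_input p c k s t i))].
Proof. by case: cl => con _ _ /(dynamicsE c k p_ok con). Qed.

Lemma att_err_SO3 : SO3 (att_err t).
Proof. by apply: SO3_mul => //; exact: SO3_tr. Qed.

Lemma is_derive_e_x : is_derive t 1 (e_x c s) (e_v c s t).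
Proof.
case: cl => _ [[dx _] _ _ _] _ _; case: c_ok => xs _ _ _ _.
exact: is_derive_fD (derivable1 dx) (is_derive_fN (smooth_derive t xs)).
Qed.

(** The desired tensions add up to [Fd], so that [F_err] is the only deviation from the linear error
    equation. *)
Lemma is_derive_e_v : is_derive t 1 (e_v c s)
  (- kx k *: e_x c s t - kv k *: e_v c s t + (m0 p)^-1 *: F_err t).
Proof.
case: cl => _ [[_ dv] _ _ _] _ _; case: c_ok => xs _ _ _ _.
have := is_derive_fD (derivable1 dv)
  (is_derive_fN (smooth_derive t (smooth_derive1 xs))).
move=> h; apply: (is_derive_eq h); case: dyn => e _ _; move: e.
have -> : payload_acc p c k s t = (m0 p)^-1 *: (Fd p c k s t + F_err t).
  congr (_ *: _); rewrite /F_err sumrB.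
  by rewrite -{1}(sum_tension (Fd p c k s t) (Md p c k s t) rkP R_SO3) addrC subrK.
have m0N : m0 p != 0 by case: p_ok => -[] /gt_eqF ->.
rewrite /Fd scalerDr scalerA mulVf // scale1r => /eqP; rewrite subr_eq => /eqP ->.
by move: (e_x _ _ _) (e_v _ _ _) (F_err _) (derive1 _ _) => a b d e; linmx.
Qed.

Lemma is_derive_att_err :
  is_derive t 1 att_err (att_err t *m hat (e_Om c s t)).
Proof.
case: cl => _ [_ dR _ _] _ _.
have h := is_derive_mulmx (is_derive_tr (is_derive_Rd t)) dR.
apply: (is_derive_eq h).
by rewrite e_OmE; exact: att_err_rate.
Qed.

Lemma is_derive_e_R : is_derive t 1 (e_R c s)
  (2^-1 *: vee (att_err t *m hat (e_Om c s t) + hat (e_Om c s t) *m (att_err t)^T)).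
Proof.
have -> : e_R c s = fun u => 2^-1 *: vee (att_err u - (att_err u)^T).
  by apply/funext => u; exact: e_RE.
have h := is_derive_att_err.
have := is_derive_fZ 2^-1 (is_derive_vee
  (is_derive_fD h (is_derive_fN (is_derive_tr h)))).
move=> {}h; apply: (is_derive_eq h).
by rewrite trmx_mul tr_hat mulNmx opprK.
Qed.

(** The trace of a product with a skew matrix sees only the skew part of the other factor, here
    given by [e_R]. *)
Lemma is_derive_psiR : is_derive t 1 psiR (dot (e_R c s t) (e_Om c s t)).
Proof.
have h := is_derive_fN (is_derive_mxtrace is_derive_att_err).
have := is_derive_fZ (2^-1 : R) (is_derive_fD (is_derive_cst (3 : R) t 1) h).
move=> {}h; apply: (is_derive_eq h).
rewrite add0r e_RE /mxtrace sum3E /GRing.scale /=.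
by move: (att_err t) (e_Om c s t) => X e; rewrite !coordE; ring.
Qed.

(** In terms of the rotation angle, sin^2 = (1 - cos)(1 + cos). For a rotation X the adjugate is
    X^T, hence tr X^2 = (tr X)^2 - 2 tr X, and both sides become polynomials in tr X. *)
Lemma sqr_e_R : enorm (e_R c s t) ^+ 2 = psiR t * (2 - psiR t).
Proof.
rewrite -dot_enorm e_RE /psiR.
have [XX dX] := att_err_SO3; move: XX dX; move: (att_err t) => X XX dX.
have adjX : \adj X = X^T.
  have := mul_mx_adj X; rewrite dX => h.
  by rewrite -[LHS]mul1mx -XX -mulmxA h mulmx1.
have h : \tr (X *m X) = \tr X ^+ 2 - 2 * \tr (\adj X).
  by rewrite mxtrace_adj3E /mxtrace !sum3E !coordE; ring.
rewrite adjX mxtrace_tr in h.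
have h2 : 3 = \tr (X^T *m X) by rewrite XX mxtrace1.
have -> : 2^-1 * (3 - \tr X) * (2 - 2^-1 * (3 - \tr X)) =
  4^-1 * (3 - (\tr X ^+ 2 - 2 * \tr X)) by field.
by rewrite -h {1}h2 /mxtrace !sum3E; move: X {h XX dX adjX h2} => X; rewrite !coordE; lra.
Qed.

Lemma is_derive_W : is_derive t 1 W
  (- (hat (e_Om c s t) *m W t) + (att_err t)^T *m derive1 (Omd c) t).
Proof.
have [_ Rd_smooth _ _ _] := c_ok.
have dOmd : is_derive t 1 (Omd c) (derive1 (Omd c) t).
  exact/smooth_derive/smooth_Omd.
have h := is_derive_mulmx (is_derive_tr is_derive_att_err) dOmd.
by apply: (is_derive_eq h); rewrite trmx_mul tr_hat !mulNmx mulmxA.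
Qed.

Lemma is_derive_e_Om : is_derive t 1 (e_Om c s)
  (invmx J *m (- kR k *: e_R c s t - kOm k *: e_Om c s t + gyro t + M_err t)).
Proof.
have [_ _ Jpos _ _] := p_ok; have uJ := posdef_unitmx Jpos.
have -> : e_Om c s = fun u => Om0 s u - W u by apply/funext => u; exact: e_OmE.
case: cl => _ [_ _ dOm _] _ _.
have h := is_derive_fD (derivable1 dOm) (is_derive_fN is_derive_W).
apply: (is_derive_eq h); case: dyn => _ -> _; rewrite /payload_angacc.
have -> : \sum_j hat (rho p j) *m (R0 s t)^T *m mu p c k s j t =
    Md p c k s t + M_err t.
  rewrite /M_err (eq_bigr _ (fun i _ => mulmxBr _ _ _)) sumrB.
  by rewrite -{1}(sum_moment_tension (Fd p c k s t) (Md p c k s t) rkP R_SO3) addrC subrK.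
rewrite -[X in _ + X](mulKmx uJ) -mulmxDr; congr (_ *m _).
rewrite /Md /gyro.
have -> : (R0 s t)^T *m Rd c t = (att_err t)^T by rewrite trmx_mul trmxK.
have -> : J *m (R0 s t)^T *m Rd c t = J *m (att_err t)^T.
  by rewrite trmx_mul trmxK mulmxA.
rewrite -/(W t) -e_OmE.
move: (e_R _ _ _) (e_Om _ _ _) (W t) (att_err t)^T (M_err t) (Om0 s t) (derive1 _ _).
move=> eR eOm w XT d Om dOmd; rewrite !(mulmxDr, mulmxN) -!mulmxA.
by linmx.
Qed.

End AtTime.
End ErrorDynamics.

(** * Rates of the desired tensions and of the link errors *)

Section LinkDynamics.
Variables (R : realType) (n : nat).
Variables (p : plant R n) (c : command R) (k : gains R) (s : motion R n).
Hypotheses (p_ok : plant_ok p) (c_ok : command_ok c).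
Implicit Types t : R.

Local Notation J := (J0 p).

(** This and the following rates are closed-loop time derivatives with all accelerations of the
    state eliminated, so that they can be bounded factor by factor. *)
Definition e_v_rate t : 'cV[R]_3 :=
  - kx k *: e_x c s t - kv k *: e_v c s t + (m0 p)^-1 *: F_err p c k s t.

Definition e_R_rate t : 'cV[R]_3 :=
  2^-1 *: vee (att_err c s t *m hat (e_Om c s t)
               + hat (e_Om c s t) *m (att_err c s t)^T).

Definition e_Om_rate t : 'cV[R]_3 :=
  invmx J *m (- kR k *: e_R c s t - kOm k *: e_Om c s t
              + gyro p c s t + M_err p c k s t).

Definition W_rate t : 'cV[R]_3 :=
  - (hat (e_Om c s t) *m W c s t) + (att_err c s t)^T *m derive1 (Omd c) t.

Definition Fd_rate t : 'cV[R]_3 :=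
  m0 p *: (- kx k *: e_v c s t - kv k *: e_v_rate t
           + derive1 (derive1 (derive1 (xd c))) t).

Definition Md_rate t : 'cV[R]_3 :=
  - kR k *: e_R_rate t - kOm k *: e_Om_rate t
  + (hat (W_rate t) *m J *m W c s t + hat (W c s t) *m J *m W_rate t)
  + J *m ((att_err c s t *m hat (e_Om c s t))^T *m derive1 (Omd c) t
          + (att_err c s t)^T *m derive1 (derive1 (Omd c)) t).

Definition mud_rate i t : 'cV[R]_3 :=
  (R0 s t *m hat (Om0 s t)) *m
    (gainF p i *m ((R0 s t)^T *m Fd p c k s t) + gainM p i *m Md p c k s t)
  + R0 s t *m
    (gainF p i *m ((R0 s t *m hat (Om0 s t))^T *m Fd p c k s t
                   + (R0 s t)^T *m Fd_rate t)
     + gainM p i *m Md_rate t).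

Definition psiq i t : R := 1 - dot (qd p c k s i t) (q s i t).

Lemma is_derive_const_mulmx m l r (A : 'M[R]_(m, l)) (B : R -> 'M[R]_(l, r)) t
    (dB : 'M[R]_(l, r)) :
  is_derive t 1 B dB -> is_derive t 1 (fun u => A *m B u) (A *m dB).
Proof.
move=> hB; have h := is_derive_mulmx (is_derive_cst A t 1) hB.
by apply: (is_derive_eq h); rewrite mul0mx add0r.
Qed.

Section AtTime.
Variable t : R.
Hypothesis cl : closed_loop_at p c k s t.

Let q_unit i : dot (q s i t) (q s i t) = 1.
Proof. by case: cl => -[_ /(_ i) [h _]] _ _ _; rewrite dot_enorm h expr1n. Qed.
Let q_om i : dot (q s i t) (om s i t) = 0.
Proof. by case: cl => -[_ /(_ i) []]. Qed.
Let mud_neq0 i : mud p c k s i t != 0.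
Proof. by case: cl => _ _ /(_ i) []. Qed.

Lemma is_derive_Fd : is_derive t 1 (Fd p c k s) (Fd_rate t).
Proof.
have [xs _ _ _ _] := c_ok.
have h := is_derive_fZ (m0 p) (is_derive_fD (is_derive_fD (is_derive_fD
  (is_derive_fZ (- kx k) (is_derive_e_x c_ok cl))
  (is_derive_fN (is_derive_fZ (kv k) (is_derive_e_v p_ok c_ok cl))))
  (smooth_derive t (smooth_derive1 (smooth_derive1 xs))))
  (is_derive_fN (is_derive_cst (grav p *: e3 : 'cV[R]_3) t 1))).
by apply: (is_derive_eq h); rewrite subr0.
Qed.

Lemma is_derive_Md : is_derive t 1 (Md p c k s) (Md_rate t).
Proof.
have hW := is_derive_W c_ok cl.
have -> : Md p c k s = fun u => - kR k *: e_R c s u - kOm k *: e_Om c s u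
   + hat (W c s u) *m J *m W c s u
   + J *m ((att_err c s u)^T *m derive1 (Omd c) u).
  by apply/funext => u; rewrite /Md /W /att_err trmx_mul trmxK -!mulmxA.
have h := is_derive_fD (is_derive_fD (is_derive_fD
  (is_derive_fZ (- kR k) (is_derive_e_R c_ok cl))
  (is_derive_fN (is_derive_fZ (kOm k) (is_derive_e_Om p_ok c_ok cl))))
  (is_derive_mulmx (is_derive_mulmx (is_derive_hat hW) (is_derive_cst J t 1)) hW))
  (is_derive_const_mulmx J (is_derive_mulmx
    (is_derive_tr (is_derive_att_err c_ok cl)) (smooth_derive t (smooth_derive1 (smooth_Omd c_ok))))).
by apply: (is_derive_eq h); rewrite mulmx0 addr0.
Qed.

Lemma is_derive_mud i : is_derive t 1 (mud p c k s i) (mud_rate i t).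
Proof.
have [_ [_ hR _ _] _ _] := cl.
have -> : mud p c k s i = fun u => R0 s u *m
    (gainF p i *m ((R0 s u)^T *m Fd p c k s u) + gainM p i *m Md p c k s u).
  by apply/funext => u; rewrite /mud tensionE.
exact: is_derive_mulmx hR (is_derive_fD
  (is_derive_const_mulmx (gainF p i) (is_derive_mulmx (is_derive_tr hR) is_derive_Fd))
  (is_derive_const_mulmx (gainM p i) is_derive_Md)).
Qed.

Lemma is_derive_qd i : is_derive t 1 (qd p c k s i)
  ((enorm (mud p c k s i t) ^- 3 * dot (mud p c k s i t) (mud_rate i t))
     *: mud p c k s i t - (enorm (mud p c k s i t))^-1 *: mud_rate i t).
Proof. exact: is_derive_unit_opp (mud_neq0 i) (is_derive_mud i). Qed.

Lemma qd_unit i : dot (qd p c k s i t) (qd p c k s i t) = 1.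
Proof. by rewrite dot_enorm enorm_unit_opp ?mud_neq0 // expr1n. Qed.

Lemma qd_rate_orth i : dot (qd p c k s i t) (derive1 (qd p c k s i) t) = 0.
Proof.
exact: unit_opp_rate_orth (mud_neq0 i) (is_derive_mud i).
Qed.

(** Each of the two terms of the derivative of a normalised vector is at most |mud'| / |mud|;
    estimating them separately gives the factor 2. *)
Lemma qd_rate_le i : enorm (derive1 (qd p c k s i) t) <=
  2 * (enorm (mud p c k s i t))^-1 * enorm (mud_rate i t).
Proof.
rewrite (is_derive1 (is_derive_qd i)).
have e0 := mud_neq0 i; rewrite -enorm_gt0 in e0.
rewrite (le_trans (enormB _ _)) // !enormZ normrM.
rewrite [`|_ ^- 3|]ger0_norm ?invr_ge0 ?exprn_ge0 ?enorm_ge0 //.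
rewrite [`|_^-1|]ger0_norm ?invr_ge0 ?enorm_ge0 //.
rewrite -mulrA mulr_natl mulr2n lerD2r.
have d := normr_dot (mud p c k s i t) (mud_rate i t).
rewrite -(ler_pM2l (exprn_gt0 3 e0)) !mulrA divff ?gt_eqF ?exprn_gt0 // mul1r.
rewrite exprSr mulrK ?unitfE ?gt_eqF //.
rewrite expr2 -mulrA [leRHS]mulrC. by rewrite ler_wpM2r ?enorm_ge0.
Qed.

Lemma omd_cross_qd i :
  derive1 (qd p c k s i) t = hat (omd p c k s i t) *m qd p c k s i t.
Proof.
exact: unit_rate_cross (qd_unit i) (qd_rate_orth i).
Qed.

Lemma e_om_orth i : dot (q s i t) (e_om p c k s i t) = 0.
Proof. by rewrite /e_om dotDr q_om -mulmxA dot_hat_self addr0. Qed.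

Lemma is_derive_e_q i : is_derive t 1 (e_q p c k s i)
  (hat (derive1 (qd p c k s i) t) *m q s i t
   + hat (qd p c k s i t) *m (hat (om s i t) *m q s i t)).
Proof.
have [_ [_ _ _ /(_ i) [hq _]] /(_ i) [_ hqd _] _] := cl.
exact: is_derive_mulmx (is_derive_hat (derivable1 hqd)) hq.
Qed.

(** The errors pair e_q with om - omd. Replacing om - omd by [e_om] only adds a multiple of q, to
    which e_q is orthogonal. *)
Lemma is_derive_psiq i :
  is_derive t 1 (psiq i) (dot (e_q p c k s i t) (e_om p c k s i t)).
Proof.
have [_ [_ _ _ /(_ i) [hq _]] /(_ i) [_ hqd _] _] := cl.
have h := is_derive_fD (is_derive_cst (1 : R) t 1)
  (is_derive_fN (is_derive_dot (derivable1 hqd) hq)).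
apply: (is_derive_eq h).
rewrite /e_om -mulmxA hat_hat q_unit scale1r omd_cross_qd /e_q.
move: (omd _ _ _ _ _ _) (qd _ _ _ _ _ _) (q _ _ _) (om _ _ _) => a b d e.
by_coords.
Qed.

Lemma sqr_e_q i : enorm (e_q p c k s i t) ^+ 2 = psiq i t * (2 - psiq i t).
Proof.
have -> : psiq i t * (2 - psiq i t) = 
  1 * 1 - dot (qd p c k s i t) (q s i t) ^+ 2 by rewrite /psiq; ring.
rewrite -dot_enorm -{1}(q_unit i) -(qd_unit i) /e_q.
by move: (qd _ _ _ _ _ _) (q _ _ _) => a b; by_coords.
Qed.

(** The feedforward terms cancel the rate of the projected [omd] up to a multiple of q. That
    multiple keeps [e_om] orthogonal to q and disappears when tested against [e_om] or [e_q]. *)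
Lemma is_derive_e_om i : is_derive t 1 (e_om p c k s i)
  (- kq k *: e_q p c k s i t - kom k *: e_om p c k s i t
   + dot (hat (om s i t) *m q s i t) (omd p c k s i t) *: q s i t).
Proof.
have [con [_ _ _ /(_ i) [hq hom]] /(_ i) [_ _ homd] dyn] := cl.
have [_ _ /(_ i) eom] := (dynamicsE c k p_ok con).1 dyn.
have h := is_derive_fD (derivable1 hom) (is_derive_mulmx
  (is_derive_mulmx (is_derive_hat hq) (is_derive_hat hq)) (derivable1 homd)).
apply: (is_derive_eq h); rewrite eom /link_input (is_derive1 hq).
have eo := e_om_orth i; have qe : dot (q s i t) (e_q p c k s i t) = 0.
  exact: dot_hat_selfr.
have qo := q_om i; have qu := q_unit i; move: eo qe qo qu.
move: (derive1 _ _) (e_om _ _ _ _ _ _) (e_q _ _ _ _ _ _) (omd _ _ _ _ _ _).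
move: (om _ _ _) (q _ _ _) => w v d a b e eo qe qo qu.
have vwv : dot v (hat w *m v) = 0 by exact: dot_hat_selfr.
rewrite hat_hat qu scale1r -mulmxA hat_hat qu scale1r.
rewrite !(dotDr, dotNr, dotZr) eo qe vwv qu /cross.
rewrite [(_ + _) *m e]mulmxDl -!mulmxA.
have -> : hat (hat w *m v) *m (hat v *m e) =
  dot (hat w *m v) e *: v - dot v (hat w *m v) *: e by by_coords.
have -> : hat v *m (hat (hat w *m v) *m e) =
  dot v e *: (hat w *m v) - dot v (hat w *m v) *: e by by_coords.
rewrite vwv !scale0r !subr0.
by move: (hat w *m v) => x; linmx.
Qed.

End AtTime.
End LinkDynamics.

(** * Exponential decay below a barrier *)

Section ExponentialDecay.
Variable R : realType.
Implicit Types (t u : R).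

Lemma is_derive_expR_affine (a t0 t : R) :
  is_derive t 1 (fun u => expR (a * (u - t0))) (a * expR (a * (t - t0))).
Proof.
have h1 := is_derive_expR (a * (t - t0)).
have h2 : is_derive t 1 (fun u => a * (u - t0)) a.
  have h := is_derive_fZ a (is_derive_fD (is_derive_id t 1) (is_derive_cst (- t0) t 1)).
  by apply: (is_derive_eq h); rewrite addr0 /GRing.scale /= mulr1.
have h := @is_derive1_comp _ expR (fun u => a * (u - t0)) t _ _ h1 h2.
by apply: (is_derive_eq h); rewrite mulrC.
Qed.

(** The sign is asked for in the open interval only, because [barrier] knows nothing about it at the
    exit time. *)
Lemma derive_le0_le (f df : R -> R) (x y : R) : x <= y ->
  (forall u, x <= u <= y -> is_derive u 1 f (df u)) ->
  (forall u, x < u < y -> df u <= 0) -> f y <= f x.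
Proof.
move=> xy hd hn.
have [->|yx] := eqVneq y x; first by [].
have {}xy : x < y by rewrite lt_neqAle eq_sym yx.
have [||c] := @MVT R f df x y xy.
- by move=> u; rewrite in_itv /= => /andP[/ltW a /ltW b]; apply: hd; rewrite a b.
- apply: derivable_within_continuous => u; rewrite in_itv /= => h.
  by case: (hd u h).
rewrite in_itv /= => /hn dc e; rewrite -subr_le0 e.
by rewrite mulr_le0_ge0 // subr_ge0 ltW.
Qed.

(** Before the first time at which V reaches eps, V does not increase, so its value there would be
    at most V t0 < eps. *)
Lemma barrier (V dV : R -> R) (t0 hi eps : R) :
  (forall t, t0 <= t < hi -> is_derive t 1 V (dV t)) ->
  (forall t, t0 <= t < hi -> V t < eps -> dV t <= 0) ->
  V t0 < eps -> forall t, t0 <= t < hi -> V t < eps.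
Proof.
move=> hd hn V0 t1 /andP[t01 t1hi]; rewrite ltNge; apply/negP => Vt1.
pose E := [set t : R | t0 <= t <= t1 /\ eps <= V t].
have E1 : E t1 by split=> //; rewrite t01 lexx.
have hE : has_inf E by split; [exists t1 | exists t0 => u -[/andP[]]].
pose tau := inf E.
have t0tau : t0 <= tau by apply: lb_le_inf; [exists t1 | move=> u -[/andP[]]].
have taut1 : tau <= t1 by apply: ge_inf => //; case: hE.
have tauhi : t0 <= tau < hi by rewrite t0tau (le_lt_trans taut1).
(* By continuity: otherwise V would stay below eps on a neighborhood of the infimum, which contains
   points of [E]. *)
have Vtau : eps <= V tau.
  rewrite leNgt; apply/negP => Vtau.
  have hc := is_derive_continuous (hd tau tauhi).
  have : \forall u \near tau, V u < eps by exact: (cvgr_lt _ hc _ Vtau).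
  move=> /nbhs_ballP[d /= d_gt0 hball].
  have [u Eu ud] := inf_adherent d_gt0 hE.
  have tauu : tau <= u by apply: ge_inf => //; case: hE.
  have : V u < eps.
    apply: hball; rewrite /ball /= distrC ger0_norm ?subr_ge0 //.
    by rewrite ltrBlDl.
  by rewrite ltNge; case: Eu => _ ->.
have : V tau <= V t0.
  apply: (derive_le0_le t0tau) => u /andP[t0u utau].
    by apply: hd; rewrite t0u (le_lt_trans utau) // (le_lt_trans taut1).
  have uhi : t0 <= u < hi by rewrite ltW // (lt_trans utau) // (le_lt_trans taut1).
  apply: hn => //; rewrite ltNge; apply/negP => Vu.
  suff : tau <= u by rewrite leNgt utau.
  apply: ge_inf; first by case: hE.
  by split=> //; rewrite (ltW t0u) (ltW (lt_le_trans utau taut1)).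
by move=> /(le_trans Vtau); rewrite leNgt V0.
Qed.

(** Since V is nonnegative, the decay inequality makes it nonincreasing below eps, so the barrier is
    never reached and the inequality persists; then exp(a (t - t0)) V does not increase. *)
Lemma barrier_exp_decay (V dV : R -> R) (t0 hi eps a : R) : 0 <= a ->
  (forall t, t0 <= t < hi -> is_derive t 1 V (dV t)) ->
  (forall t, t0 <= t < hi -> 0 <= V t) ->
  (forall t, t0 <= t < hi -> V t < eps -> dV t <= - a * V t) ->
  V t0 < eps -> forall t, t0 <= t < hi -> V t <= expR (- a * (t - t0)) * V t0.
Proof.
move=> a_ge0 hd hp hn V0 t1 ht1.
have Vlt : forall t, t0 <= t < hi -> V t < eps.
  apply: (barrier hd) => // t ht Vt; rewrite (le_trans (hn t ht Vt)) //.
  by rewrite mulNr oppr_le0 mulr_ge0 ?hp.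
have [t01 t1hi] := andP ht1.
pose g u := expR (a * (u - t0)) * V u.
pose dg u := a * expR (a * (u - t0)) * V u + expR (a * (u - t0)) * dV u.
have hg : g t1 <= g t0.
  apply: (@derive_le0_le g dg _ _ t01) => u /andP[t0u ut1].
    apply: is_derive_fM; first exact: is_derive_expR_affine.
    by apply: hd; rewrite t0u (le_lt_trans ut1).
  have hu : t0 <= u < hi by rewrite ltW // (lt_trans ut1).
  have := hn u hu (Vlt u hu); rewrite mulNr => h.
  rewrite /dg -mulrA mulrCA -mulrDr mulr_ge0_le0 ?expR_ge0 //.
  by rewrite -subr_ge0 sub0r opprD addrC subr_ge0 lerNr.
have e : 0 < expR (a * (t1 - t0)) by exact: expR_gt0.
rewrite mulNr expRN mulrC ler_pdivlMr // mulrC.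
by have := hg; rewrite /g subrr mulr0 expR0 mul1r.
Qed.

End ExponentialDecay.

(** * Uniform bounds *)

Section UniformBounds.
Variables (R : realType) (T : Type).
Implicit Types (D : T -> Prop) (w : T -> R).

(** One constant serves all of [D]: with pairs of a motion and a time as points, the bounds are
    uniform over trajectories and initial times. *)
Definition bigO D w m n (f : T -> 'M[R]_(m, n)) : Prop :=
  exists2 K : R, 0 <= K & forall x, D x -> enorm (f x) <= K * w x.

Definition ubounded D m n (f : T -> 'M[R]_(m, n)) : Prop := bigO D (fun=> 1) f.

Section Ops.
Variables (D : T -> Prop) (w : T -> R).

Lemma bigO_le w' m n (f : T -> 'M[R]_(m, n)) :
  (forall x, D x -> w x <= w' x) -> bigO D w f -> bigO D w' f.
Proof.
move=> ww [K K0 h]; exists K => // x Dx.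
by rewrite (le_trans (h x Dx)) // ler_wpM2l // ww.
Qed.

Lemma bigOD m n (f g : T -> 'M[R]_(m, n)) :
  bigO D w f -> bigO D w g -> bigO D w (fun x => f x + g x).
Proof.
move=> [K K0 hf] [L L0 hg]; exists (K + L); first exact: addr_ge0.
by move=> x Dx; rewrite (le_trans (enormD _ _)) // mulrDl lerD ?hf ?hg.
Qed.

Lemma bigON m n (f : T -> 'M[R]_(m, n)) : bigO D w f -> bigO D w (fun x => - f x).
Proof. by move=> [K K0 hf]; exists K => // x Dx; rewrite enormN hf. Qed.

Lemma bigOB m n (f g : T -> 'M[R]_(m, n)) :
  bigO D w f -> bigO D w g -> bigO D w (fun x => f x - g x).
Proof. by move=> hf hg; exact: bigOD hf (bigON hg). Qed.

Lemma bigOZ a m n (f : T -> 'M[R]_(m, n)) :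
  bigO D w f -> bigO D w (fun x => a *: f x).
Proof.
move=> [K K0 hf]; exists (`|a| * K); first by rewrite mulr_ge0.
by move=> x Dx; rewrite enormZ -mulrA ler_wpM2l // hf.
Qed.

Lemma bigOMl m n p (f : T -> 'M[R]_(m, n)) (g : T -> 'M[R]_(n, p)) :
  ubounded D f -> bigO D w g -> bigO D w (fun x => f x *m g x).
Proof.
move=> [K K0 hf] [L L0 hg]; exists (K * L); first exact: mulr_ge0.
move=> x Dx; rewrite (le_trans (enormM _ _)) // -mulrA.
by rewrite ler_pM ?enorm_ge0 ?hg // -[K]mulr1 hf.
Qed.

Lemma bigOMr m n p (f : T -> 'M[R]_(m, n)) (g : T -> 'M[R]_(n, p)) :
  bigO D w f -> ubounded D g -> bigO D w (fun x => f x *m g x).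
Proof.
move=> [K K0 hf] [L L0 hg]; exists (K * L); first exact: mulr_ge0.
move=> x Dx; rewrite (le_trans (enormM _ _)) // mulrAC.
by rewrite ler_pM ?enorm_ge0 ?hf // -[L]mulr1 hg.
Qed.

Lemma bigO_tr m n (f : T -> 'M[R]_(m, n)) : bigO D w f -> bigO D w (fun x => (f x)^T).
Proof. by move=> [K K0 hf]; exists K => // x Dx; rewrite enorm_tr hf. Qed.

Lemma bigO_hat (f : T -> 'cV[R]_3) : bigO D w f -> bigO D w (fun x => hat (f x)).
Proof.
move=> [K K0 hf]; exists (2 * K); first by rewrite mulr_ge0.
by move=> x Dx; rewrite (le_trans (enorm_hat _)) // -mulrA ler_wpM2l // hf.
Qed.

Lemma bigO_vee (f : T -> 'M[R]_3) : bigO D w f -> bigO D w (fun x => vee (f x)).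
Proof.
move=> [K K0 hf]; exists K => // x Dx.
by rewrite (le_trans (enorm_vee _)) // hf.
Qed.

Lemma bigO_sum (I : finType) m n (f : I -> T -> 'M[R]_(m, n)) :
  (forall i, bigO D w (f i)) -> bigO D w (fun x => \sum_i f i x).
Proof.
move=> hf; have hK i : {K | 0 <= K /\ forall x, D x -> enorm (f i x) <= K * w x}.
  by apply: cid; have [K ? ?] := hf i; exists K.
exists (\sum_i sval (hK i)); first by apply: sumr_ge0 => i _; case: (svalP (hK i)).
move=> x Dx; rewrite (le_trans (enorm_sum _ _)) // mulr_suml.
by apply: ler_sum => i _; case: (svalP (hK i)) => _ ->.
Qed.

End Ops.

Section Unif.
Variable D : T -> Prop.

Lemma unif_cst m n (A : 'M[R]_(m, n)) : ubounded D (fun=> A).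
Proof. by exists (enorm A); [exact: enorm_ge0 | move=> x _; rewrite mulr1]. Qed.

Lemma unifP m n (f : T -> 'M[R]_(m, n)) B :
  (forall x, D x -> enorm (f x) <= B) -> ubounded D f.
Proof.
move=> h; exists `|B| => [//|x Dx]; rewrite mulr1 (le_trans (h x Dx)) //.
exact: ler_norm.
Qed.

Lemma unif_SO3 (f : T -> 'M[R]_3) : (forall x, D x -> SO3 (f x)) -> ubounded D f.
Proof. by move=> h; apply: (@unifP _ _ _ 2) => x /h; exact: enorm_SO3. Qed.

End Unif.

Lemma bigO_self D m n (f : T -> 'M[R]_(m, n)) : bigO D (fun x => enorm (f x)) f.
Proof. by exists 1 => // x _; rewrite mul1r. Qed.

End UniformBounds.

(** * Bounds on the higher derivatives of the commands *)

Section CommandBounds.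
Variables (R : realType) (n : nat) (p : plant R n) (c : command R).
Hypotheses (p_ok : plant_ok p) (c_ok : command_ok c) (l_ok : link_commands_ok p c).

Let nonneg (t : R) := 0 <= t.

Lemma bounded_motionE (f : R -> 'cV[R]_3) : bounded_motion f <-> ubounded nonneg f.
Proof.
split=> [[B hB]|[K K0 h]]; first exact: (@unifP _ _ _ _ _ _ B).
by exists K => t /h; rewrite mulr1.
Qed.

Let unif_Rd : ubounded nonneg (Rd c).
Proof. by apply: unif_SO3 => t _; case: c_ok. Qed.

Let unif_cmd_F : ubounded nonneg (cmd_F p c).
Proof.
have [_ _ _ [_ /bounded_motionE h] _] := c_ok.
exact: bigOZ (bigOB h (unif_cst _ _)).
Qed.

Let unif_Omd : ubounded nonneg (Omd c).
Proof. by have [_ _ _ _ [/bounded_motionE h _]] := c_ok. Qed.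

Let unif_Omd' : ubounded nonneg (derive1 (Omd c)).
Proof. by have [_ _ _ _ [_ /bounded_motionE h]] := c_ok. Qed.

Let unif_cmd_M : ubounded nonneg (cmd_M p c).
Proof.
exact: bigOD (bigOMl (bigOMl (bigO_hat unif_Omd) (unif_cst _ _)) unif_Omd)
  (bigOMl (unif_cst _ _) unif_Omd').
Qed.

Lemma cmd_tensionE i : cmd_tension p c i = fun u => Rd c u *m
    (gainF p i *m ((Rd c u)^T *m cmd_F p c u) + gainM p i *m cmd_M p c u).
Proof. by apply/funext => u; rewrite /cmd_tension tensionE. Qed.

Let unif_cmd_tension i : ubounded nonneg (cmd_tension p c i).
Proof.
rewrite cmd_tensionE; apply: bigOMl => //.
exact: bigOD (bigOMl (unif_cst _ _) (bigOMl (bigO_tr unif_Rd) unif_cmd_F))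
  (bigOMl (unif_cst _ _) unif_cmd_M).
Qed.

Let unif_cmd_tension' i : ubounded nonneg (derive1 (cmd_tension p c i)).
Proof. by case: l_ok => _ /(_ i) /bounded_motionE. Qed.

(* The commanded tensions add up to the commanded force, so that a bound on
   their derivatives bounds the third derivative of the position command. *)
Lemma unif_xd3 : ubounded nonneg (derive1 (derive1 (derive1 (xd c)))).
Proof.
have [xs _ Rd_SO3 _ _] := c_ok; have [[m0_gt0 _] _ _ _ rk] := p_ok.
have e : derive1 (derive1 (derive1 (xd c))) =
    fun t => (m0 p)^-1 *: \sum_i derive1 (cmd_tension p c i) t.
  apply/funext => t.
  have h1 := is_derive_fsum (fun i => smooth_derive t (@smooth_cmd_tension R n p c c_ok i)).
  have h2 := is_derive_fZ (m0 p) (is_derive_fD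
    (smooth_derive t (smooth_derive1 (smooth_derive1 xs)))
    (is_derive_cst (- (grav p *: e3 : 'cV[R]_3)) t 1)).
  have E : (fun u => \sum_i cmd_tension p c i u) =
     (fun u => m0 p *: (derive1 (derive1 (xd c)) u + - (grav p *: e3))).
    by apply/funext => u; rewrite sum_tension.
  rewrite E in h1; have := is_derive1 h1; rewrite (is_derive1 h2) addr0 => <-.
  by rewrite scalerA mulVf ?gt_eqF // scale1r.
rewrite e; apply: bigOZ; exact: bigO_sum.
Qed.

(** The commanded tensions produce the commanded moment, whose rate contains J0 Omd''; solving for
    it leaves bounded terms only. *)
Lemma unif_Omd2 : ubounded nonneg (derive1 (derive1 (Omd c))).
Proof.
have [_ Rs Rd_SO3 _ _] := c_ok; have [_ _ Jpos _ rk] := p_ok.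
have uJ := posdef_unitmx Jpos; have Os := smooth_Omd c_ok.
pose g t := \sum_i hat (rho p i) *m
   ((Rd c t *m hat (Omd c t))^T *m cmd_tension p c i t
    + (Rd c t)^T *m derive1 (cmd_tension p c i) t).
pose h t := hat (derive1 (Omd c) t) *m (J0 p *m Omd c t)
   + hat (Omd c t) *m (J0 p *m derive1 (Omd c) t).
have e : derive1 (derive1 (Omd c)) = fun t => invmx (J0 p) *m (g t - h t).
  apply/funext => t.
  have dR := is_derive_Rd c_ok t.
  have dO := smooth_derive t Os; have dO1 := smooth_derive t (smooth_derive1 Os).
  have h1 := is_derive_fsum (fun i => is_derive_mulmx
    (is_derive_cst (hat (rho p i)) t 1) (is_derive_mulmx (is_derive_tr dR)
      (smooth_derive t (@smooth_cmd_tension R n p c c_ok i)))).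
  have h2 := is_derive_fD (is_derive_mulmx (is_derive_hat dO)
      (is_derive_mulmx (is_derive_cst (J0 p) t 1) dO))
    (is_derive_mulmx (is_derive_cst (J0 p) t 1) dO1).
  have E : (fun u => \sum_i (hat (rho p i) *m ((Rd c u)^T *m cmd_tension p c i u))) =
     (fun u => hat (Omd c u) *m (J0 p *m Omd c u) + J0 p *m derive1 (Omd c) u).
    apply/funext => u; rewrite mulmxA.
    rewrite -[RHS](sum_moment_tension (cmd_F p c u) _ rk (Rd_SO3 u)).
    by apply: eq_bigr => i _; rewrite mulmxA.
  rewrite E in h1; have := is_derive1 h1; rewrite (is_derive1 h2).
  have -> : \sum_i (0 *m ((Rd c t)^T *m cmd_tension p c i t) + hat (rho p i) *m
     ((Rd c t *m hat (Omd c t))^T *m cmd_tension p c i t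
      + (Rd c t)^T *m derive1 (cmd_tension p c i) t)) = g t.
    by apply: eq_bigr => i _; rewrite mul0mx add0r.
  by rewrite !mul0mx !add0r => <-; rewrite /h addrC addKr mulKmx.
rewrite e; apply: bigOMl; first exact: unif_cst.
have uRO : ubounded nonneg (fun t => (Rd c t *m hat (Omd c t))^T).
  exact: bigO_tr (bigOMl unif_Rd (bigO_hat unif_Omd)).
apply: bigOB.
  apply: bigO_sum => i; apply: bigOMl; first exact: unif_cst.
  exact: bigOD (bigOMl uRO (unif_cmd_tension i))
    (bigOMl (bigO_tr unif_Rd) (unif_cmd_tension' i)).
exact: bigOD
  (bigOMl (bigO_hat unif_Omd') (bigOMl (unif_cst _ _) unif_Omd))
  (bigOMl (bigO_hat unif_Omd) (bigOMl (unif_cst _ _) unif_Omd')).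
Qed.

End CommandBounds.

(** * Bounds on the state near the commanded motion *)

Section StateBounds.
Variables (R : realType) (n : nat).
Variables (p : plant R n) (c : command R) (k : gains R).
Hypotheses (p_ok : plant_ok p) (c_ok : command_ok c) (l_ok : link_commands_ok p c).

Local Notation J := (J0 p).
Local Notation state := (motion R n * R)%type.
Implicit Types (x : state) (s : motion R n) (t : R).

(* Unlike the error vector, this vanishes only at the equilibrium. *)
Definition sqdist s t : R :=
  enorm (e_x c s t) ^+ 2 + enorm (e_v c s t) ^+ 2
  + psiR c s t + enorm (e_Om c s t) ^+ 2
  + \sum_i (psiq p c k s i t + enorm (e_om p c k s i t) ^+ 2).

(** The bound 1 is half the value taken by [psiR] or [psiq] at the spurious zeros of the error
    vector, and it makes all errors bounded. *)
Definition region x : Prop :=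
  [/\ closed_loop_at p c k x.1 x.2, 0 <= x.2 & sqdist x.1 x.2 <= 1].

(** Connects the configuration function with the distance used in [near_equilibrium], and shows that
    it is nonnegative. *)
Lemma psiR_dist s t : SO3 (R0 s t) ->
  psiR c s t = 4^-1 * enorm (R0 s t - Rd c t) ^+ 2.
Proof.
move=> hR; have hRd : SO3 (Rd c t) by case: c_ok.
have -> : psiR c s t = 4^-1 * (3 + 3 - \tr (att_err c s t) - \tr (att_err c s t)).
  by rewrite /psiR; field.
rewrite sqr_enorm_mxtrace [(_ - _)^T]linearB /= mulmxBl !mulmxBr.
case: (hR) => -> _; case: (hRd) => -> _.
rewrite !(@raddfB _ _ (@mxtrace R 3)) /= !mxtrace1.
have -> : \tr ((R0 s t)^T *m Rd c t) = \tr (att_err c s t).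
  by rewrite -mxtrace_tr trmx_mul trmxK.
congr (_ * _); by rewrite /att_err; ring.
Qed.

Lemma psiq_dist s t i : closed_loop_at p c k s t ->
  psiq p c k s i t = 2^-1 * enorm (q s i t - qd p c k s i t) ^+ 2.
Proof.
move=> cl; have h := qd_unit cl i.
have q1 : dot (q s i t) (q s i t) = 1.
  by case: cl => -[_ /(_ i) [e _]] _ _ _; rewrite dot_enorm e expr1n.
rewrite -dot_enorm dotDl !dotDr !dotNl !dotNr h q1 (dotC (q _ _ _)) /psiq.
by field.
Qed.

Section Sqdist.
Variables (s : motion R n) (t : R).
Hypothesis cl : closed_loop_at p c k s t.

Let psiR0 : 0 <= psiR c s t.
Proof.
by rewrite psiR_dist; [rewrite mulr_ge0 ?sqr_ge0 ?invr_ge0 | case: cl => -[]].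
Qed.

Let psiq0 i : 0 <= psiq p c k s i t.
Proof. by rewrite psiq_dist // mulr_ge0 ?sqr_ge0 ?invr_ge0. Qed.

Lemma psiR_ge0 : 0 <= psiR c s t. Proof. exact: psiR0. Qed.
Lemma psiq_ge0 i : 0 <= psiq p c k s i t. Proof. exact: psiq0. Qed.

Let link_ge0 i : 0 <= psiq p c k s i t + enorm (e_om p c k s i t) ^+ 2.
Proof. by rewrite addr_ge0 ?sqr_ge0. Qed.

Lemma sqdist_ge :
  [/\ enorm (e_x c s t) ^+ 2 <= sqdist s t, enorm (e_v c s t) ^+ 2 <= sqdist s t,
      psiR c s t <= sqdist s t, enorm (e_Om c s t) ^+ 2 <= sqdist s t &
      forall i, psiq p c k s i t <= sqdist s t
        /\ enorm (e_om p c k s i t) ^+ 2 <= sqdist s t].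
Proof.
have hs : 0 <= \sum_i (psiq p c k s i t + enorm (e_om p c k s i t) ^+ 2).
  by apply: sumr_ge0 => i _.
have hx := sqr_ge0 (enorm (e_x c s t)); have hv := sqr_ge0 (enorm (e_v c s t)).
have hO := sqr_ge0 (enorm (e_Om c s t)); have hR := psiR0.
rewrite /sqdist; split; try lra.
move=> i; have := sqr_ge0 (enorm (e_om p c k s i t)); have := psiq0 i.
have : psiq p c k s i t + enorm (e_om p c k s i t) ^+ 2 <=
  \sum_i (psiq p c k s i t + enorm (e_om p c k s i t) ^+ 2).
  by rewrite (bigD1 i) //= lerDl sumr_ge0.
by split; lra.
Qed.

Lemma sqdist_ge0 : 0 <= sqdist s t.
Proof. by have [h _ _ _ _] := sqdist_ge; rewrite (le_trans _ h) ?sqr_ge0. Qed.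

Lemma sqr_e_R_le : enorm (e_R c s t) ^+ 2 <= 2 * psiR c s t.
Proof. by rewrite (sqr_e_R c_ok cl) mulrC ler_wpM2r ?psiR0 // gerDl oppr_le0 psiR0. Qed.

Lemma sqr_e_q_le i : enorm (e_q p c k s i t) ^+ 2 <= 2 * psiq p c k s i t.
Proof. by rewrite (sqr_e_q cl) mulrC ler_wpM2r ?psiq0 // gerDl oppr_le0 psiq0. Qed.

End Sqdist.

Let E x := Num.sqrt (sqdist x.1 x.2).

Lemma bigO_sqdist D a m l (f : state -> 'M[R]_(m, l)) :
  (forall x, D x -> closed_loop_at p c k x.1 x.2) -> 0 <= a ->
  (forall x, D x -> enorm (f x) ^+ 2 <= a ^+ 2 * sqdist x.1 x.2) -> bigO D E f.
Proof.
move=> Dcl a0 h; exists a => // x Dx.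
rewrite -(@ler_pXn2r _ 2) ?nnegrE ?mulr_ge0 ?sqrtr_ge0 ?enorm_ge0 //.
rewrite exprMn [E x ^+ 2]sqr_sqrtr ?h //.
by apply: sqdist_ge0; exact: Dcl.
Qed.

Local Notation D := region.

Let Dcl x : D x -> closed_loop_at p c k x.1 x.2. Proof. by case. Qed.

Let E_le1 x : D x -> E x <= 1.
Proof. by case=> _ _ h; rewrite -sqrtr1 ler_wsqrtr. Qed.

Let EO m l (f : state -> 'M[R]_(m, l)) : bigO D E f -> ubounded D f.
Proof. exact: bigO_le E_le1. Qed.

Let cmdO m l (f : R -> 'M[R]_(m, l)) :
  ubounded (fun t => 0 <= t) f -> ubounded D (fun x => f x.2).
Proof. by move=> [K K0 h]; exists K => // x [_ t0 _]; exact: h. Qed.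

Lemma small_e_x : bigO D E (fun x => e_x c x.1 x.2).
Proof.
apply: (@bigO_sqdist _ 1) => // x /Dcl cl; rewrite expr1n mul1r.
by have [] := sqdist_ge cl.
Qed.

Lemma small_e_v : bigO D E (fun x => e_v c x.1 x.2).
Proof.
apply: (@bigO_sqdist _ 1) => // x /Dcl cl; rewrite expr1n mul1r.
by have [] := sqdist_ge cl.
Qed.

Lemma small_e_Om : bigO D E (fun x => e_Om c x.1 x.2).
Proof.
apply: (@bigO_sqdist _ 1) => // x /Dcl cl; rewrite expr1n mul1r.
by have [] := sqdist_ge cl.
Qed.

Lemma small_att : bigO D E (fun x => R0 x.1 x.2 - Rd c x.2).
Proof.
apply: (@bigO_sqdist _ 2) => // x /Dcl cl.
have [_ _ h _ _] := sqdist_ge cl; rewrite psiR_dist in h; last by case: cl => -[].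
by rewrite expr2; lra.
Qed.

Lemma small_e_R : bigO D E (fun x => e_R c x.1 x.2).
Proof.
apply: (@bigO_sqdist _ 2) => // x /Dcl cl.
have [_ _ h _ _] := sqdist_ge cl; have h2 := sqr_e_R_le cl.
have h0 := sqdist_ge0 cl; by rewrite [_ ^+ 2 * _]mulrC expr2; lra.
Qed.

Lemma unif_R0 : ubounded D (fun x => R0 x.1 x.2).
Proof. by apply: unif_SO3 => x /Dcl [[]]. Qed.

Lemma unif_Rdx : ubounded D (fun x => Rd c x.2).
Proof. by apply: unif_SO3 => x _; case: c_ok. Qed.

Lemma unif_att_err : ubounded D (fun x => att_err c x.1 x.2).
Proof. exact: bigOMl (bigO_tr unif_Rdx) unif_R0. Qed.

Let uOmd : ubounded D (fun x => Omd c x.2).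
Proof. by case: c_ok => _ _ _ _ [/bounded_motionE/cmdO]. Qed.

Let uOmd1 : ubounded D (fun x => derive1 (Omd c) x.2).
Proof. by case: c_ok => _ _ _ _ [_ /bounded_motionE/cmdO]. Qed.

Let uOmd2 : ubounded D (fun x => derive1 (derive1 (Omd c)) x.2).
Proof. exact: cmdO (unif_Omd2 p_ok c_ok l_ok). Qed.

Let uxd2 : ubounded D (fun x => derive1 (derive1 (xd c)) x.2).
Proof. by case: c_ok => _ _ _ [_ /bounded_motionE/cmdO]. Qed.

Let uxd3 : ubounded D (fun x => derive1 (derive1 (derive1 (xd c))) x.2).
Proof. exact: cmdO (unif_xd3 p_ok c_ok l_ok). Qed.

Lemma unif_W : ubounded D (fun x => W c x.1 x.2).
Proof. exact: bigOMl (bigO_tr unif_att_err) uOmd. Qed.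

Lemma unif_Om0 : ubounded D (fun x => Om0 x.1 x.2).
Proof.
have -> : (fun x => Om0 x.1 x.2) = fun x => e_Om c x.1 x.2 + W c x.1 x.2.
  by apply/funext => x; rewrite e_OmE subrK.
exact: bigOD (EO small_e_Om) unif_W.
Qed.

Lemma unif_Fd : ubounded D (fun x => Fd p c k x.1 x.2).
Proof.
exact: bigOZ (bigOB (bigOD (bigOB (bigOZ _ (EO small_e_x)) (bigOZ _ (EO small_e_v)))
  uxd2) (unif_cst _ _)).
Qed.

Lemma Md_eq s t : Md p c k s t = - kR k *: e_R c s t - kOm k *: e_Om c s t
   + hat (W c s t) *m J *m W c s t + J *m ((att_err c s t)^T *m derive1 (Omd c) t).
Proof. by rewrite /Md /W /att_err trmx_mul trmxK -!mulmxA. Qed.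

Lemma unif_Md : ubounded D (fun x => Md p c k x.1 x.2).
Proof.
have -> : (fun x => Md p c k x.1 x.2) = fun x => - kR k *: e_R c x.1 x.2
   - kOm k *: e_Om c x.1 x.2 + hat (W c x.1 x.2) *m J *m W c x.1 x.2
   + J *m ((att_err c x.1 x.2)^T *m derive1 (Omd c) x.2).
  by apply/funext => x; exact: Md_eq.
exact: bigOD (bigOD (bigOB (bigOZ _ (EO small_e_R)) (bigOZ _ (EO small_e_Om)))
    (bigOMl (bigOMl (bigO_hat unif_W) (unif_cst _ _)) unif_W))
  (bigOMl (unif_cst _ _) (bigOMl (bigO_tr unif_att_err) uOmd1)).
Qed.

Lemma unif_mud i : ubounded D (fun x => mud p c k x.1 i x.2).
Proof.
have -> : (fun x => mud p c k x.1 i x.2) = fun x => R0 x.1 x.2 *m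
    (gainF p i *m ((R0 x.1 x.2)^T *m Fd p c k x.1 x.2) + gainM p i *m Md p c k x.1 x.2).
  by apply/funext => x; rewrite /mud tensionE.
exact: bigOMl unif_R0 (bigOD
  (bigOMl (unif_cst _ _) (bigOMl (bigO_tr unif_R0) unif_Fd))
  (bigOMl (unif_cst _ _) unif_Md)).
Qed.

(** The difference is minus the component of [mud] normal to the link, a double cross product with
    q; writing [mud] as a multiple of [qd] makes [e_q] appear. *)
Lemma mu_subE s t i : closed_loop_at p c k s t -> mu p c k s i t - mud p c k s i t
  = enorm (mud p c k s i t) *: (hat (q s i t) *m e_q p c k s i t).
Proof.
move=> cl; have q1 : dot (q s i t) (q s i t) = 1.
  by case: cl => -[_ /(_ i) [e _]] _ _ _; rewrite dot_enorm e expr1n.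
have m0 : enorm (mud p c k s i t) != 0.
  by rewrite enorm_eq0; case: cl => _ _ /(_ i) [].
rewrite /mu qq_mul /e_q /cross /qd /unit_opp hatZ -scalemxAl -scalemxAr scalerA.
rewrite mulrN mulfV // scaleN1r hatC mulmxN opprK hat_hat q1 scale1r.
by rewrite dotC.
Qed.

(** The coupling errors are measured by the e_q alone, without payload errors, so that a large
    weight on the links can absorb them. *)
Definition link_dist x : R :=
  Num.sqrt (\sum_i enorm (e_q p c k x.1 i x.2) ^+ 2).

Lemma bigO_mu_sub i :
  bigO D link_dist (fun x => mu p c k x.1 i x.2 - mud p c k x.1 i x.2).
Proof.
have [K K0 h] := unif_mud i; exists (K * 2); first by rewrite mulr_ge0.
move=> x Dx; rewrite mu_subE; last exact: Dcl.
rewrite enormZ ger0_norm ?enorm_ge0 // -mulrA ler_pM ?enorm_ge0 //.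
  by have := h x Dx; rewrite mulr1.
have q1 : enorm (q x.1 i x.2) = 1 by case: (Dcl Dx) => -[_ /(_ i) []].
rewrite (le_trans (enormM _ _)) // ler_pM ?enorm_ge0 //.
  by rewrite (le_trans (enorm_hat _)) // q1 mulr1.
rewrite -(@ler_pXn2r _ 2) ?nnegrE ?sqrtr_ge0 ?enorm_ge0 //.
rewrite [link_dist x ^+ 2]sqr_sqrtr; last by apply: sumr_ge0 => j _; exact: sqr_ge0.
by rewrite (bigD1 i) //= lerDl; apply: sumr_ge0 => j _; exact: sqr_ge0.
Qed.

Lemma bigO_F_err : bigO D link_dist (fun x => F_err p c k x.1 x.2).
Proof. exact: bigO_sum bigO_mu_sub. Qed.

Lemma bigO_M_err : bigO D link_dist (fun x => M_err p c k x.1 x.2).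
Proof.
by apply: bigO_sum => i; exact: bigOMl
  (bigOMl (unif_cst _ _) (bigO_tr unif_R0)) (bigO_mu_sub i).
Qed.

Lemma unif_mu i : ubounded D (fun x => mu p c k x.1 i x.2).
Proof.
have uq : ubounded D (fun x => q x.1 i x.2).
  by apply: (@unifP _ _ _ _ _ _ 1) => x /Dcl [[_ /(_ i) [-> _]]].
exact: bigOMl (bigOMl uq (bigO_tr uq)) (unif_mud i).
Qed.

Let uFerr : ubounded D (fun x => F_err p c k x.1 x.2).
Proof. by apply: bigO_sum => i; exact: bigOB (unif_mu i) (unif_mud i). Qed.

Let uMerr : ubounded D (fun x => M_err p c k x.1 x.2).
Proof.
by apply: bigO_sum => i; exact: bigOMl
  (bigOMl (unif_cst _ _) (bigO_tr unif_R0)) (bigOB (unif_mu i) (unif_mud i)).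
Qed.

(** The terms quadratic in [W] cancel, and each remaining one has a factor [e_Om]. *)
Lemma gyroE s t : gyro p c s t = J *m (hat (e_Om c s t) *m W c s t)
  - hat (W c s t) *m (J *m e_Om c s t) - hat (e_Om c s t) *m (J *m Om0 s t).
Proof.
have -> : Om0 s t = e_Om c s t + W c s t by rewrite e_OmE subrK.
rewrite /gyro; have -> : Om0 s t = e_Om c s t + W c s t by rewrite e_OmE subrK.
move: (e_Om _ _ _) (W _ _ _) => a b.
by rewrite hatD !(mulmxDl, mulmxDr); linmx.
Qed.

Lemma bigO_gyro : bigO D (fun x => enorm (e_Om c x.1 x.2)) (fun x => gyro p c x.1 x.2).
Proof.
have -> : (fun x => gyro p c x.1 x.2) = fun x =>
   J *m (hat (e_Om c x.1 x.2) *m W c x.1 x.2)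
  - hat (W c x.1 x.2) *m (J *m e_Om c x.1 x.2)
  - hat (e_Om c x.1 x.2) *m (J *m Om0 x.1 x.2).
  by apply/funext => x; exact: gyroE.
have e := bigO_self D (fun x => e_Om c x.1 x.2).
exact: bigOB (bigOB (bigOMl (unif_cst _ _) (bigOMr (bigO_hat e) unif_W))
  (bigOMl (bigO_hat unif_W) (bigOMl (unif_cst _ _) e)))
  (bigOMr (bigO_hat e) (bigOMl (unif_cst _ _) unif_Om0)).
Qed.

Lemma bigO_e_R_rate :
  bigO D (fun x => enorm (e_Om c x.1 x.2)) (fun x => e_R_rate c x.1 x.2).
Proof.
have e := bigO_self D (fun x => e_Om c x.1 x.2).
exact: bigOZ (bigO_vee (bigOD (bigOMl unif_att_err (bigO_hat e))
  (bigOMr (bigO_hat e) (bigO_tr unif_att_err)))).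
Qed.

Lemma unif_mud_rate i : ubounded D (fun x => mud_rate p c k x.1 i x.2).
Proof.
have ueOm := EO small_e_Om; have ueR := EO small_e_R.
have uev := EO small_e_v; have uex := EO small_e_x.
have uevr : ubounded D (fun x => e_v_rate p c k x.1 x.2).
  exact: bigOD (bigOB (bigOZ _ uex) (bigOZ _ uev)) (bigOZ _ uFerr).
have ueRr : ubounded D (fun x => e_R_rate c x.1 x.2).
  exact: bigOZ (bigO_vee (bigOD (bigOMl unif_att_err (bigO_hat ueOm))
    (bigOMr (bigO_hat ueOm) (bigO_tr unif_att_err)))).
have ugyro : ubounded D (fun x => gyro p c x.1 x.2).
  exact: bigOD (bigOB (bigOMl (bigO_hat unif_W) (bigOMl (unif_cst _ _) unif_W))
    (bigOMl (bigO_hat unif_Om0) (bigOMl (unif_cst _ _) unif_Om0)))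
    (bigOMl (unif_cst _ _) (bigOMl (bigO_hat ueOm) unif_W)).
have ueOmr : ubounded D (fun x => e_Om_rate p c k x.1 x.2).
  exact: bigOMl (unif_cst _ _) (bigOD (bigOD (bigOB (bigOZ _ ueR) (bigOZ _ ueOm))
    ugyro) uMerr).
have uWr : ubounded D (fun x => W_rate c x.1 x.2).
  exact: bigOD (bigON (bigOMl (bigO_hat ueOm) unif_W))
    (bigOMl (bigO_tr unif_att_err) uOmd1).
have uFdr : ubounded D (fun x => Fd_rate p c k x.1 x.2).
  exact: bigOZ (bigOD (bigOB (bigOZ _ uev) (bigOZ _ uevr)) uxd3).
have uMdr : ubounded D (fun x => Md_rate p c k x.1 x.2).
  have h1 := bigOMl (bigOMl (bigO_hat uWr) (unif_cst D J)) unif_W.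
  have h2 := bigOMl (bigOMl (bigO_hat unif_W) (unif_cst D J)) uWr.
  have h3 := bigOMl (bigO_tr (bigOMl unif_att_err (bigO_hat ueOm))) uOmd1.
  have h4 := bigOMl (bigO_tr unif_att_err) uOmd2.
  have h5 := bigOMl (unif_cst D J) (bigOD h3 h4).
  exact: bigOD (bigOD (bigOB (bigOZ _ ueRr) (bigOZ _ ueOmr)) (bigOD h1 h2)) h5.
have uRr : ubounded D (fun x => R0 x.1 x.2 *m hat (Om0 x.1 x.2)).
  exact: bigOMl unif_R0 (bigO_hat unif_Om0).
have h1 := bigOD (bigOMl (unif_cst D (gainF p i)) (bigOMl (bigO_tr unif_R0) unif_Fd))
  (bigOMl (unif_cst D (gainM p i)) unif_Md).
have h2 := bigOMl (unif_cst D (gainF p i))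
  (bigOD (bigOMl (bigO_tr uRr) unif_Fd) (bigOMl (bigO_tr unif_R0) uFdr)).
have h3 := bigOMl (unif_cst D (gainM p i)) uMdr.
exact: bigOD (bigOMl uRr h1) (bigOMl unif_R0 (bigOD h2 h3)).
Qed.

(** Both tensions are the same expression in attitude, force and moment, so their difference
    telescopes into products of a small factor with bounded ones. *)
Lemma small_mud i : bigO D E (fun x => mud p c k x.1 i x.2 - cmd_tension p c i x.2).
Proof.
have Rd_SO3 u : SO3 (Rd c u) by case: c_ok.
pose dR x := R0 x.1 x.2 - Rd c x.2; have sR : bigO D E dR := small_att.
have XE x : D x -> (att_err c x.1 x.2)^T = (dR x)^T *m Rd c x.2 + 1%:M.
  move=> _; rewrite /att_err /dR trmx_mul trmxK linearB /= mulmxBl.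
  by case: (Rd_SO3 x.2) => -> _; rewrite subrK.
(* The deviation of the transposed relative rotation from the identity. *)
pose Y x := (dR x)^T *m Rd c x.2.
have sY : bigO D E Y by exact: bigOMr (bigO_tr sR) unif_Rdx.
pose dW x := Y x *m Omd c x.2.
have sW : bigO D E dW by exact: bigOMr sY uOmd.
have WE x : D x -> W c x.1 x.2 = dW x + Omd c x.2.
  by move=> Dx; rewrite /W XE // mulmxDl mul1mx.
have sF : bigO D E (fun x => Fd p c k x.1 x.2 - cmd_F p c x.2).
  have -> : (fun x => Fd p c k x.1 x.2 - cmd_F p c x.2) =
     fun x => m0 p *: (- kx k *: e_x c x.1 x.2 - kv k *: e_v c x.1 x.2).
    apply/funext => x; rewrite /Fd /cmd_F -scalerBr.
    move: (e_x _ _ _) (e_v _ _ _) (derive1 _ _) (grav p *: e3) => a b d e; linmx.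
  exact: bigOZ (bigOB (bigOZ _ small_e_x) (bigOZ _ small_e_v)).
have sM : bigO D E (fun x => Md p c k x.1 x.2 - cmd_M p c x.2).
  have h : bigO D E (fun x => - kR k *: e_R c x.1 x.2 - kOm k *: e_Om c x.1 x.2
     + (hat (dW x) *m J *m W c x.1 x.2 + hat (Omd c x.2) *m J *m dW x)
     + J *m (Y x *m derive1 (Omd c) x.2)).
    have h1 := bigOMr (bigOMr (bigO_hat sW) (unif_cst D J)) unif_W.
    have h2 := bigOMl (bigOMl (bigO_hat uOmd) (unif_cst D J)) sW.
    have h3 := bigOMl (unif_cst D J) (bigOMr sY uOmd1).
    exact: bigOD (bigOD (bigOB (bigOZ _ small_e_R) (bigOZ _ small_e_Om))
      (bigOD h1 h2)) h3.
  have [K K0 {}h] := h; exists K => // x Dx; move: (h x Dx); congr (enorm _ <= _).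
  rewrite Md_eq /cmd_M WE // XE // -/(Y x).
  move: (e_R _ _ _) (e_Om _ _ _) (dW x) (Y x) (Omd c x.2) (derive1 _ _).
  move=> a b d e f g; rewrite hatD !(mulmxDl, mulmxDr) mul1mx; linmx.
have h : bigO D E (fun x =>
   dR x *m (gainF p i *m ((R0 x.1 x.2)^T *m Fd p c k x.1 x.2)
            + gainM p i *m Md p c k x.1 x.2)
   + Rd c x.2 *m (gainF p i *m ((dR x)^T *m Fd p c k x.1 x.2
       + (Rd c x.2)^T *m (Fd p c k x.1 x.2 - cmd_F p c x.2))
      + gainM p i *m (Md p c k x.1 x.2 - cmd_M p c x.2))).
  have h1 := bigOMr sR (bigOD
    (bigOMl (unif_cst D (gainF p i)) (bigOMl (bigO_tr unif_R0) unif_Fd))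
    (bigOMl (unif_cst D (gainM p i)) unif_Md)).
  have h2 := bigOMl (unif_cst D (gainF p i)) (bigOD (bigOMr (bigO_tr sR) unif_Fd)
    (bigOMl (bigO_tr unif_Rdx) sF)).
  have h3 := bigOMl (unif_cst D (gainM p i)) sM.
  exact: bigOD h1 (bigOMl unif_Rdx (bigOD h2 h3)).
have [K K0 {}h] := h; exists K => // x Dx; move: (h x Dx); congr (enorm _ <= _).
rewrite /mud tensionE cmd_tensionE /dR.
move: (R0 _ _) (Rd _ _) (Fd _ _ _ _ _) (cmd_F _ _ _) (Md _ _ _ _ _) (cmd_M _ _ _).
move: (gainF p i) (gainM p i) => L N A B a b d e.
rewrite linearB /= !(mulmxBl, mulmxBr, mulmxDr); linmx.
Qed.

End StateBounds.

(** * Lyapunov function *)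

Section LyapunovRates.
Variable R : realType.

Lemma young (x y e : R) : 0 < e -> x * y <= e * x ^+ 2 + (4 * e)^-1 * y ^+ 2.
Proof.
move=> e_gt0; rewrite -subr_ge0.
have -> : e * x ^+ 2 + (4 * e)^-1 * y ^+ 2 - x * y = e * (x - (2 * e)^-1 * y) ^+ 2.
  by field; rewrite gt_eqF.
by rewrite mulr_ge0 ?sqr_ge0 // ltW.
Qed.

(** The weight 3/4 is the one for which the products ex . ev cancel: -1 + 3/2 - 1/2 = 0. Young's
    inequality then separates the perturbation d. *)
Lemma position_rate_le (ex ev d : 'cV[R]_3) :
  let ev' := - 1 *: ex - 1 *: ev + d in
  2^-1 * (dot ev' ev + dot ev ev') + 3 / 4 * (dot ev ex + dot ex ev)
    + 2^-1 * (dot ev ev + dot ex ev')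
  <= - 4^-1 * (enorm ex ^+ 2 + enorm ev ^+ 2) + 2 * enorm d ^+ 2.
Proof.
rewrite /= !(dotDl, dotDr, dotNl, dotNr, dotZl, dotZr) (dotC ev ex) (dotC d) !dot_enorm.
have h1 : dot ev d <= 4^-1 * enorm ev ^+ 2 + enorm d ^+ 2.
  apply: (le_trans (ler_dot _ _)).
  by have := @young (enorm ev) (enorm d) 4^-1 ltac:(lra); rewrite mulfV ?invr1 ?mul1r.
have h2 : dot ex d <= 2^-1 * enorm ex ^+ 2 + enorm d ^+ 2.
  apply: (le_trans (ler_dot _ _)); have := sqr_ge0 (enorm d).
  have := @young (enorm ex) (enorm d) 2^-1 ltac:(lra).
  have -> : (4 * 2^-1)^-1 = 2^-1 :> R by field.
  lra.
by have := sqr_ge0 (enorm d); lra.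
Qed.

Lemma position_lyap_bounds (ex ev : 'cV[R]_3) :
  4^-1 * (enorm ex ^+ 2 + enorm ev ^+ 2) <=
  2^-1 * dot ev ev + 3 / 4 * dot ex ex + 2^-1 * dot ex ev
  <= enorm ex ^+ 2 + enorm ev ^+ 2.
Proof.
rewrite !dot_enorm; have := normr_dot ex ev; rewrite ler_norml => /andP[h1 h2].
have h := sqr_ge0 (enorm ex - enorm ev); rewrite sqrrB in h.
by apply/andP; split; nra.
Qed.

(** The delicate term is (omd . q)(qd . eom), due to the motion of qd. Its factors equal -(dqd . eq)
    and (q x eq) . eom, so it is at most |dqd| |eom| |eq|^2, and the smallness hypothesis lets the
    decay in eq absorb it. *)
Lemma link_rate_le (q qd om omd dqd eq eom : 'cV[R]_3) :
  dot q q = 1 -> dot qd qd = 1 -> dot q om = 0 -> dqd = hat omd *m qd ->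
  omd = hat qd *m dqd ->
  eq = hat qd *m q -> eom = om + hat q *m (hat q *m omd) ->
  enorm dqd * enorm eom <= 4^-1 ->
  let deom := - 1 *: eq - 1 *: eom + dot (hat om *m q) omd *: q in
  let deq := hat dqd *m q + hat qd *m (hat om *m q) in
  2^-1 * (dot deom eom + dot eom deom) + dot eq eom
    + 2^-1 * (dot deq eom + dot eq deom)
  <= - 8^-1 * (enorm eq ^+ 2 + enorm eom ^+ 2).
Proof.
move=> q1 qd1 qom dqdE omdE eqE eomE small /=.
have qeom : dot q eom = 0 by rewrite eomE dotDr qom dot_hat_self addr0.
have qeq : dot q eq = 0 by rewrite eqE; exact: dot_hat_selfr.
have omE : om = eom + omd - dot q omd *: q.
  by rewrite eomE hat_hat q1; linmx.
have deqE : dot (hat dqd *m q + hat qd *m (hat om *m q)) eom =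
   dot omd q * dot qd eom + dot qd q * enorm eom ^+ 2.
  have -> : dot (hat dqd *m q + hat qd *m (hat om *m q)) eom =
    dot omd q * dot qd eom + dot qd q * dot (om - omd) eom - dot q eom * dot qd om.
    rewrite dqdE; move: eom {small omE qeom omdE eomE qeq} => e.
    by_coords.
  rewrite qeom mul0r subr0 {1}omE -dot_enorm.
  by rewrite !(dotDl, dotNl, dotZl) qeom mulr0 subr0 addrK.
rewrite deqE !(dotDl, dotDr, dotNl, dotNr, dotZl, dotZr) qeom (dotC eom q) qeom.
rewrite (dotC eq q) qeq (dotC eom eq) !dot_enorm.
have omdq : dot omd q = - dot dqd eq.
  by rewrite omdE eqE; move: dqd {dqdE omdE small deqE} => e; by_coords.
have qdeom : dot qd eom = dot (hat q *m eq) eom.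
  have -> : hat q *m eq = qd - dot q qd *: q.
    rewrite eqE [hat qd *m q]hatC mulmxN hat_hat q1.
    by linmx.
  by rewrite dotDl dotNl dotZl qeom mulr0 subr0.
have crossle : enorm (hat q *m eq) <= enorm eq.
  rewrite -(@ler_pXn2r _ 2) ?nnegrE ?enorm_ge0 // -!dot_enorm.
  have -> : dot (hat q *m eq) (hat q *m eq) = dot q q * dot eq eq - dot q eq ^+ 2.
    by_coords.
  by rewrite q1 qeq expr0n subr0 mul1r.
have qdq : dot qd q <= 1.
  rewrite (le_trans (ler_dot _ _)) //.
  have -> : enorm qd = 1.
    by rewrite -[LHS]ger0_norm ?enorm_ge0 // -sqrtr_sqr -dot_enorm qd1 sqrtr1.
  have -> : enorm q = 1.
    by rewrite -[LHS]ger0_norm ?enorm_ge0 // -sqrtr_sqr -dot_enorm q1 sqrtr1.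
  by rewrite mulr1.
have h1 : dot omd q * dot qd eom <= 4^-1 * enorm eq ^+ 2.
  rewrite omdq qdeom (le_trans (ler_norm _)) // normrM normrN.
  have a1 := normr_dot dqd eq.
  have a2 : `|dot (hat q *m eq) eom| <= enorm eq * enorm eom.
    by rewrite (le_trans (normr_dot _ _)) // ler_wpM2r ?enorm_ge0.
  rewrite (le_trans (ler_pM _ _ a1 a2)) //.
  have -> : enorm dqd * enorm eq * (enorm eq * enorm eom) =
    enorm dqd * enorm eom * enorm eq ^+ 2 by ring.
  by rewrite ler_wpM2r ?sqr_ge0.
have h2 := ler_dot eq eom.
have h3 : dot qd q * enorm eom ^+ 2 <= enorm eom ^+ 2.
  by rewrite -[leRHS]mul1r ler_wpM2r ?sqr_ge0.
have h4 := normr_dot eq eom; rewrite ler_norml in h4; have /andP[h5 h6] := h4.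
have h7 := sqr_ge0 (enorm eq - enorm eom); rewrite sqrrB in h7.
by nra.
Qed.

Lemma link_lyap_bounds (eq eom : 'cV[R]_3) (psi : R) :
  enorm eq ^+ 2 <= 2 * psi ->
  4^-1 * (psi + enorm eom ^+ 2) <= 2^-1 * dot eom eom + psi + 2^-1 * dot eq eom
  <= 2 * (psi + enorm eom ^+ 2).
Proof.
rewrite dot_enorm => h; have := normr_dot eq eom; rewrite ler_norml => /andP[h1 h2].
have h3 := sqr_ge0 (enorm eq - enorm eom); rewrite sqrrB in h3.
have := sqr_ge0 (enorm eq); have := sqr_ge0 (enorm eom).
by move=> ??; apply/andP; split; nra.
Qed.

(** By symmetry of J the gyroscopic term g is orthogonal to eOm, so the energy decays in eOm
    whatever the size of g. The cross term of weight [cR] adds decay in eR, and its cost in eOm is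
    kept below 1/4 by the last hypothesis. *)
Lemma attitude_rate_le (J : 'M[R]_3) (eR eOm deR g d W Om : 'cV[R]_3)
    (cR Kg KR : R) :
  J^T = J -> J \in unitmx -> 0 < cR <= 2^-1 ->
  0 <= Kg -> 0 <= KR ->
  g = J *m (hat eOm *m W) - hat W *m (J *m eOm) - hat eOm *m (J *m Om) ->
  enorm g <= Kg * enorm eOm -> enorm deR <= KR * enorm eOm ->
  cR * (KR * enorm J + (1 + Kg) ^+ 2) <= 4^-1 ->
  let deOm := invmx J *m (- 1 *: eR - 1 *: eOm + g + d) in
  2^-1 * (dot deOm (J *m eOm) + dot eOm (J *m deOm)) + dot eR eOm
   + cR * (dot deR (J *m eOm) + dot eR (J *m deOm))
  <= - 2^-1 * (cR * enorm eR ^+ 2 + enorm eOm ^+ 2) + 2 * enorm d ^+ 2.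
Proof.
move=> JT uJ /andP[cR_gt0 cR_le] Kg0 KR0 gE gle deRle small /=.
set deOm := invmx J *m _.
have JdeOm : J *m deOm = - 1 *: eR - 1 *: eOm + g + d by rewrite mulKVmx.
have -> : dot deOm (J *m eOm) = dot eOm (J *m deOm).
  by rewrite dot_mulmxr JT dotC.
have eg : dot eOm g = 0.
  rewrite gE !(dotDr, dotNr) dot_hat_self subr0 dot_mulmxr JT.
  by move: (J *m eOm) => v; by_coords.
rewrite JdeOm !(dotDr, dotNr, dotZr) eg (dotC eOm eR) !dot_enorm.
have b1 : dot deR (J *m eOm) <= KR * enorm J * enorm eOm ^+ 2.
  rewrite (le_trans (ler_dot _ _)) //.
  have -> : KR * enorm J * enorm eOm ^+ 2 = (KR * enorm eOm) * (enorm J * enorm eOm) by ring.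
  by rewrite ler_pM ?enorm_ge0 // enormM.
have /(ler_wpM2l (enorm_ge0 eR)) b2 := gle.
have {}b2 := le_trans (ler_dot eR g) b2.
have b3 := ler_dot eOm d; have b4 := ler_dot eR d.
have b5 := ler_dot eR eOm.
have b6 := normr_dot eR eOm; rewrite ler_norml in b6; have /andP[b7 _] := b6.
set a := enorm eR in b2 b4 b5 b7 *; set b := enorm eOm in gle deRle b1 b2 b3 b5 b7 *.
set e := enorm d in b3 b4 *.
have a0 : 0 <= a by exact: enorm_ge0.
have b0 : 0 <= b by exact: enorm_ge0.
have y1 : b * e <= 4^-1 * b ^+ 2 + e ^+ 2.
  by have := @young b e 4^-1 ltac:(lra); rewrite mulfV ?invr1 ?mul1r.
have y2 : a * e <= 4^-1 * a ^+ 2 + e ^+ 2.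
  by have := @young a e 4^-1 ltac:(lra); rewrite mulfV ?invr1 ?mul1r.
have y3 : a * ((1 + Kg) * b) <= 4^-1 * a ^+ 2 + (1 + Kg) ^+ 2 * b ^+ 2.
  by have := @young a ((1 + Kg) * b) 4^-1 ltac:(lra); rewrite mulfV ?invr1 ?mul1r // exprMn.
have c1 : cR * (dot deR (J *m eOm) + (- 1 * a ^+ 2 - 1 * dot eR eOm + dot eR g + dot eR d))
  <= cR * (KR * enorm J * b ^+ 2 + (1 + Kg) ^+ 2 * b ^+ 2 - 2^-1 * a ^+ 2 + e ^+ 2).
  rewrite ler_pM2l //; nra.
have c2 : cR * (KR * enorm J * b ^+ 2 + (1 + Kg) ^+ 2 * b ^+ 2) <= 4^-1 * b ^+ 2.
  by rewrite -mulrDl mulrA ler_wpM2r ?sqr_ge0.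
have c3 : cR * e ^+ 2 <= 2^-1 * e ^+ 2 by rewrite ler_wpM2r ?sqr_ge0.
have e2 := sqr_ge0 e.
nra.
Qed.

(** The cross term is charged partly to psi and partly to the kinetic energy, whence two bounds on
    [cR]. *)
Lemma attitude_lyap_bounds (J : 'M[R]_3) (eR eOm : 'cV[R]_3) (psi cR j : R) :
  0 < cR -> 0 < j -> j * enorm eOm ^+ 2 <= dot eOm (J *m eOm) ->
  cR * enorm J <= 2^-1 -> cR * enorm J <= 2^-1 * j ->
  enorm eR ^+ 2 <= 2 * psi ->
  2^-1 * psi + 4^-1 * j * enorm eOm ^+ 2 <=
  2^-1 * dot eOm (J *m eOm) + psi + cR * dot eR (J *m eOm)
  <= 2 * psi + (enorm J + 1) * enorm eOm ^+ 2.
Proof.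
move=> cR0 j0 hj c1 c2 hpsi.
have psi0 : 0 <= psi by have := sqr_ge0 (enorm eR); lra.
have b2 := sqr_ge0 (enorm eOm).
have JeOm : enorm (J *m eOm) <= enorm J * enorm eOm by exact: enormM.
have h1 : `|cR * dot eR (J *m eOm)| <= cR * enorm J * (psi + 2^-1 * enorm eOm ^+ 2).
  rewrite normrM (gtr0_norm cR0) -mulrA ler_pM2l //.
  rewrite (le_trans (normr_dot _ _)) //.
  apply: (le_trans (ler_wpM2l (enorm_ge0 _) JeOm)).
  rewrite mulrCA ler_wpM2l ?enorm_ge0 //.
  have h3 := sqr_ge0 (enorm eR - enorm eOm); rewrite sqrrB in h3; lra.
move: h1; rewrite ler_norml => /andP[h1 h2].
have h3 : dot eOm (J *m eOm) <= enorm J * enorm eOm ^+ 2.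
  rewrite (le_trans (ler_dot _ _)) //.
  apply: (le_trans (ler_wpM2l (enorm_ge0 _) JeOm)).
  by rewrite mulrCA expr2.
have h4 : cR * enorm J * psi <= 2^-1 * psi by rewrite ler_wpM2r.
have h5 : cR * enorm J * enorm eOm ^+ 2 <= 2^-1 * enorm eOm ^+ 2 by rewrite ler_wpM2r.
have h6 : cR * enorm J * enorm eOm ^+ 2 <= 2^-1 * j * enorm eOm ^+ 2 by rewrite ler_wpM2r.
have h7 : 0 <= enorm J * enorm eOm ^+ 2 by rewrite mulr_ge0 ?enorm_ge0.
apply/andP; split; nra.
Qed.

End LyapunovRates.

(** * Decay of the Lyapunov function with unit gains *)

Section Stability.
Variables (R : realType) (n : nat) (p : plant R n) (c : command R).
Hypotheses (p_ok : plant_ok p) (c_ok : command_ok c) (l_ok : link_commands_ok p c).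

Definition unit_gains : gains R := Gains 1 1 1 1 1 1.

Local Notation k := unit_gains.
Local Notation J := (J0 p).
Local Notation state := (motion R n * R)%type.
Implicit Types (x : state) (s : motion R n) (t u : R).

Lemma common_bound (D : state -> Prop) (w : state -> R) m l
    (f : 'I_n -> state -> 'M[R]_(m, l)) : (forall x, D x -> 0 <= w x) ->
  (forall i, bigO D w (f i)) ->
  exists2 K : R, 0 <= K & forall i x, D x -> enorm (f i x) <= K * w x.
Proof.
move=> w0 hf; have hK i : {K | 0 <= K /\ forall x, D x -> enorm (f i x) <= K * w x}.
  by apply: cid; have [K ? ?] := hf i; exists K.
exists (\sum_i sval (hK i)); first by apply: sumr_ge0 => i _; case: (svalP (hK i)).
move=> i x Dx; case: (svalP (hK i)) => _ /(_ x Dx) h; rewrite (le_trans h) //.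
rewrite ler_wpM2r ?w0 // (bigD1 i) //= lerDl.
by apply: sumr_ge0 => j _; case: (svalP (hK j)).
Qed.

(** Close to the commanded motion the desired tension stays within nu / 2 of the commanded one,
    hence has length at least nu / 2, while its rate is bounded. *)
Lemma qd_rate_bound : exists r B : R, [/\ 0 < r, 0 <= B &
  forall s t, region p c k (s, t) -> sqdist p c k s t <= r ^+ 2 ->
    forall i, enorm (derive1 (qd p c k s i) t) <= B].
Proof.
have [K K0 hK] := common_bound (fun x _ => sqrtr_ge0 (sqdist p c k x.1 x.2))
  (small_mud p k c_ok).
have [L L0 hL] := common_bound (fun _ _ => ler01) (unif_mud_rate k p_ok c_ok l_ok).
have [[nu nu_gt0 hnu] _] := l_ok.
have K1 : 0 < 2 * (K + 1) by rewrite mulr_gt0 // ltr_wpDl.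
(* With this radius K times the distance is at most nu / 2; the summand 1 covers K = 0. *)
exists (nu / (2 * (K + 1))), (2 * (2 / nu) * L); split.
- by rewrite divr_gt0.
- by rewrite !mulr_ge0 // invr_ge0 ltW.
move=> s t Dst hr i; have [cl t0 _] := Dst.
have E_le : Num.sqrt (sqdist p c k s t) <= nu / (2 * (K + 1)).
  rewrite -[leRHS]ger0_norm; last by rewrite divr_ge0 // ltW.
  by rewrite -sqrtr_sqr ler_wsqrtr.
have h1 := hK i (s, t) Dst; rewrite /= in h1.
have h2 : enorm (mud p c k s i t - cmd_tension p c i t) <= 2^-1 * nu.
  rewrite (le_trans h1) // (le_trans (ler_wpM2l K0 E_le)) //.
  rewrite mulrA ler_pdivrMr // mulrA; have := mulr_ge0 K0 (ltW nu_gt0); nra.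
have h3 := hnu i t t0.
have h4 : enorm (cmd_tension p c i t) <= enorm (mud p c k s i t) + 2^-1 * nu.
  have -> : cmd_tension p c i t = mud p c k s i t - (mud p c k s i t - cmd_tension p c i t).
    by rewrite opprB addrC subrK.
  by rewrite (le_trans (enormB _ _)) // lerD2l.
have h5 : nu / 2 <= enorm (mud p c k s i t) by lra.
rewrite (le_trans (qd_rate_le p_ok c_ok cl i)) // ler_pM ?enorm_ge0 //.
- by rewrite mulr_ge0 // invr_ge0 enorm_ge0.
- rewrite ler_pM2l // -[2 / nu]invrK lef_pV2 ?posrE ?invf_div ?divr_gt0 //.
  by rewrite (lt_le_trans _ h5) // divr_gt0.
- by have := hL i (s, t) Dst; rewrite mulr1.
Qed.

Section Function.
Variables (cR lam : R).

(** Energies of the position, attitude and link errors, each with a cross term that turns damping of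
    the velocity error into decay of the configuration error as well. [cR] will be small and [lam]
    large. *)
Definition lyap s u : R :=
  (2^-1 * dot (e_v c s u) (e_v c s u) + 3 / 4 * dot (e_x c s u) (e_x c s u)
   + 2^-1 * dot (e_x c s u) (e_v c s u))
  + (2^-1 * dot (e_Om c s u) (J *m e_Om c s u) + psiR c s u
     + cR * dot (e_R c s u) (J *m e_Om c s u))
  + lam * \sum_i (2^-1 * dot (e_om p c k s i u) (e_om p c k s i u)
      + psiq p c k s i u + 2^-1 * dot (e_q p c k s i u) (e_om p c k s i u)).

Definition e_om_rate s i t : 'cV[R]_3 :=
  - 1 *: e_q p c k s i t - 1 *: e_om p c k s i t
  + dot (hat (om s i t) *m q s i t) (omd p c k s i t) *: q s i t.

Definition e_q_rate s i t : 'cV[R]_3 :=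
  hat (derive1 (qd p c k s i) t) *m q s i t
  + hat (qd p c k s i t) *m (hat (om s i t) *m q s i t).

Definition lyap_rate s t : R :=
  (2^-1 * (dot (e_v_rate p c k s t) (e_v c s t) + dot (e_v c s t) (e_v_rate p c k s t))
   + 3 / 4 * (dot (e_v c s t) (e_x c s t) + dot (e_x c s t) (e_v c s t))
   + 2^-1 * (dot (e_v c s t) (e_v c s t) + dot (e_x c s t) (e_v_rate p c k s t)))
  + (2^-1 * (dot (e_Om_rate p c k s t) (J *m e_Om c s t)
             + dot (e_Om c s t) (J *m e_Om_rate p c k s t))
     + dot (e_R c s t) (e_Om c s t)
     + cR * (dot (e_R_rate c s t) (J *m e_Om c s t)
             + dot (e_R c s t) (J *m e_Om_rate p c k s t)))
  + lam * \sum_i (2^-1 * (dot (e_om_rate s i t) (e_om p c k s i t)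
                         + dot (e_om p c k s i t) (e_om_rate s i t))
      + dot (e_q p c k s i t) (e_om p c k s i t)
      + 2^-1 * (dot (e_q_rate s i t) (e_om p c k s i t)
               + dot (e_q p c k s i t) (e_om_rate s i t))).

Lemma is_derive_lyap s t : closed_loop_at p c k s t ->
  is_derive t 1 (lyap s) (lyap_rate s t).
Proof.
move=> cl.
have dx := is_derive_e_x c_ok cl; have dv := is_derive_e_v p_ok c_ok cl.
have dR := is_derive_e_R c_ok cl; have dOm := is_derive_e_Om p_ok c_ok cl.
have dJ := is_derive_const_mulmx J dOm.
have h1 := is_derive_fD (is_derive_fD (is_derive_fZ (2^-1 : R) (is_derive_dot dv dv))
  (is_derive_fZ (3 / 4 : R) (is_derive_dot dx dx)))
  (is_derive_fZ (2^-1 : R) (is_derive_dot dx dv)).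
have h2 := is_derive_fD (is_derive_fD (is_derive_fZ (2^-1 : R) (is_derive_dot dOm dJ))
  (is_derive_psiR c_ok cl)) (is_derive_fZ cR (is_derive_dot dR dJ)).
have h3 i := is_derive_fD (is_derive_fD (is_derive_fZ (2^-1 : R)
   (is_derive_dot (is_derive_e_om p_ok cl i) (is_derive_e_om p_ok cl i)))
  (is_derive_psiq p_ok c_ok cl i))
  (is_derive_fZ (2^-1 : R) (is_derive_dot (is_derive_e_q cl i)
    (is_derive_e_om p_ok cl i))).
exact: is_derive_fD (is_derive_fD h1 h2) (is_derive_fZ lam (is_derive_fsum h3)).
Qed.

End Function.

Lemma lyapunov_exists : exists (V dV : motion R n -> R -> R) (kap K al r : R),
  [/\ [/\ 0 < kap, 0 < K, 0 < al, 0 < r & r <= 1],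
   (forall s t, closed_loop_at p c k s t -> is_derive t 1 (V s) (dV s t)),
   (forall s t, closed_loop_at p c k s t ->
      kap * sqdist p c k s t <= V s t <= K * sqdist p c k s t) &
   (forall s t, closed_loop_at p c k s t -> 0 <= t -> sqdist p c k s t < r ->
      dV s t <= - al * V s t)].
Proof.
have [[m0_gt0 _] JT Jpos _ _] := p_ok; have uJ := posdef_unitmx Jpos.
have [j j_gt0 hj] := posdef_lower_bound JT Jpos.
have [KF KF0 hF] := bigO_F_err p k c_ok.
have [KM KM0 hM] := bigO_M_err p k c_ok.
have [Kg Kg0 hg] := bigO_gyro p k c_ok.
have [KR KR0 hR] := bigO_e_R_rate p k c_ok.
have [r1 [B [r1_gt0 B0 hB]]] := qd_rate_bound.
have Jn0 := enorm_ge0 J.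
(* Each summand secures one upper bound on its inverse [cR]: for the attitude rate, for the two
   halves of the attitude bounds, and [cR <= 1/2]. *)
pose Z := 4 * (KR * enorm J + (1 + Kg) ^+ 2) + 2 * enorm J + 2 * (enorm J / j) + 2.
have Z1 : 0 <= KR * enorm J + (1 + Kg) ^+ 2.
  by apply: addr_ge0; [exact: mulr_ge0 | exact: sqr_ge0].
have Z2 : 0 <= enorm J / j by rewrite divr_ge0 // ltW.
have Z_gt0 : 0 < Z by rewrite /Z; lra.
pose cR := Z^-1.
have cR_gt0 : 0 < cR by rewrite invr_gt0.
have cRle y z : y <= z * Z -> cR * y <= z by move=> h; rewrite /cR mulrC ler_pdivrMr.
have cR1 : cR <= 2^-1 by rewrite -[leLHS]mulr1; apply: cRle; rewrite /Z; lra.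
have cR2 : cR * enorm J <= 2^-1 by apply: cRle; rewrite /Z; lra.
have cR3 : cR * enorm J <= 2^-1 * j.
  apply: cRle; have -> : 2^-1 * j * Z = enorm J + 2^-1 * j *
    (4 * (KR * enorm J + (1 + Kg) ^+ 2) + 2 * enorm J + 2).
    by rewrite /Z; field; rewrite gt_eqF.
  by rewrite lerDl; apply: mulr_ge0; lra.
have cR4 : cR * (KR * enorm J + (1 + Kg) ^+ 2) <= 4^-1 by apply: cRle; rewrite /Z; lra.
pose Kd := (m0 p)^-1 * KF.
have Kd0 : 0 <= Kd by rewrite mulr_ge0 // invr_ge0 ltW.
(* The links decay at rate 1/8; with this weight they absorb the terms 2 |d|^2 of the position and
   attitude rates and keep a decay of 1. *)
pose lam := 8 * (2 * Kd ^+ 2 + 2 * KM ^+ 2 + 1).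
have Kd2 := sqr_ge0 Kd; have KM2 := sqr_ge0 KM.
have lam8 : 8 <= lam by rewrite /lam; lra.
pose kap := Num.min 4^-1 (4^-1 * j).
have kap1 : kap <= 4^-1 by rewrite ge_min lexx.
have kap2 : kap <= 4^-1 * j by rewrite ge_min lexx orbT.
have kap0 : 0 < kap by rewrite lt_min invr_gt0 // mulr_gt0 ?invr_gt0 // ltr0n.
pose K := 3 + enorm J + 2 * lam.
have K_gt0 : 0 < K by rewrite /K; lra.
(* Bounds |e_om| so that its product with |qd'| <= B is at most 1/4, as [link_rate_le] requires. *)
pose r2 := (4 * (B + 1))^-1.
have r2_gt0 : 0 < r2 by rewrite invr_gt0; lra.
(* In turn: membership in [region], the bound on qd', the bound on e_om. *)
pose r := Num.min 1 (Num.min (r1 ^+ 2) (r2 ^+ 2)).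
have r_gt0 : 0 < r by rewrite !lt_min ltr01 !exprn_gt0.
exists (lyap cR lam), (lyap_rate cR lam), kap, K, (cR / 2 / K), r.
have bounds s t : closed_loop_at p c k s t ->
  kap * sqdist p c k s t <= lyap cR lam s t <= K * sqdist p c k s t.
  move=> cl; rewrite /lyap /sqdist.
  have /andP[x1 x2] := position_lyap_bounds (e_x c s t) (e_v c s t).
  have /andP[a1 a2] := attitude_lyap_bounds cR_gt0 j_gt0 (hj (e_Om c s t)) cR2 cR3
    (sqr_e_R_le c_ok cl).
  have l12 i := link_lyap_bounds (e_om p c k s i t) (sqr_e_q_le cl i).
  set X := \sum_i (psiq _ _ _ _ _ _ + _).
  set Y := \sum_i (_ + _ + _).
  have X0 : 0 <= X by apply: sumr_ge0 => i _; rewrite addr_ge0 ?sqr_ge0 ?(psiq_ge0 cl).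
  have l1 : 4^-1 * X <= Y.
    by rewrite mulr_sumr; apply: ler_sum => i _; case/andP: (l12 i).
  have l2 : Y <= 2 * X.
    by rewrite mulr_sumr; apply: ler_sum => i _; case/andP: (l12 i).
  have ex0 := sqr_ge0 (enorm (e_x c s t)); have ev0 := sqr_ge0 (enorm (e_v c s t)).
  have eO0 := sqr_ge0 (enorm (e_Om c s t)); have ps0 := psiR_ge0 c_ok cl.
  have lY1 : 8 * Y <= lam * Y by rewrite ler_wpM2r //; lra.
  have lY2 : lam * Y <= lam * (2 * X) by rewrite ler_wpM2l //; lra.
  have k1 z : 0 <= z -> kap * z <= 4^-1 * z by move=> z0; rewrite ler_wpM2r.
  have k2 : kap * enorm (e_Om c s t) ^+ 2 <= 4^-1 * j * enorm (e_Om c s t) ^+ 2.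
    by rewrite ler_wpM2r.
  have kx := k1 _ ex0; have kv := k1 _ ev0; have kp := k1 _ ps0; have kX := k1 _ X0.
  apply/andP; split.
    rewrite !mulrDr; lra.
  have m1 : enorm J * enorm (e_Om c s t) ^+ 2 >= 0 by rewrite mulr_ge0.
  have m2 z : 0 <= z -> 0 <= enorm J * z by move=> z0; rewrite mulr_ge0.
  have m3 z : 0 <= z -> 0 <= lam * z by move=> z0; rewrite mulr_ge0 //; lra.
  have := m2 _ ex0; have := m2 _ ev0; have := m2 _ ps0; have := m2 _ X0.
  have := m3 _ ex0; have := m3 _ ev0; have := m3 _ ps0; have := m3 _ eO0.
  rewrite /K; move=> *; lra.
split=> //.
- split=> //; first by rewrite !divr_gt0.
  by rewrite ge_min lexx.
- by move=> s t; exact: is_derive_lyap.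
move=> s t cl t0; rewrite !lt_min => /and3P[S1 Sr1 Sr2].
have Dst : region p c k (s, t) by split=> //=; exact: ltW.
have /andP[_ VK] := bounds s t cl.
(* The slowest decay is that of the attitude, cR / 2; dividing by the upper constant K converts it
   into a rate for the function itself. *)
suff main : lyap_rate cR lam s t <= - (cR / 2) * sqdist p c k s t.
  have h : lyap cR lam s t / K <= sqdist p c k s t by rewrite ler_pdivrMr // mulrC.
  have h0 : 0 <= cR / 2 by rewrite divr_ge0 // ltW.
  apply: (le_trans main); rewrite !mulNr lerN2.
  by rewrite -[leLHS]mulrA [K^-1 * _]mulrC ler_wpM2l.
have [_ _ psi_le _ link_le] := sqdist_ge c_ok cl.
have hx := position_rate_le (e_x c s t) (e_v c s t) ((m0 p)^-1 *: F_err p c k s t).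
have cR01 : 0 < cR <= 2^-1 by rewrite cR_gt0.
have ha := attitude_rate_le (e_R c s t) (M_err p c k s t) JT uJ cR01 Kg0 KR0
  (gyroE p c s t) (hg (s, t) Dst) (hR (s, t) Dst) cR4.
have hl i : 2^-1 * (dot (e_om_rate s i t) (e_om p c k s i t)
                   + dot (e_om p c k s i t) (e_om_rate s i t))
      + dot (e_q p c k s i t) (e_om p c k s i t)
      + 2^-1 * (dot (e_q_rate s i t) (e_om p c k s i t)
               + dot (e_q p c k s i t) (e_om_rate s i t))
   <= - 8^-1 * (enorm (e_q p c k s i t) ^+ 2 + enorm (e_om p c k s i t) ^+ 2).
  have [[_ /(_ i) [q1 qo]] _ _ _] := cl.
  apply: (link_rate_le _ (qd_unit cl i) qo (omd_cross_qd p_ok c_ok cl i)) => //.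
  - by rewrite dot_enorm q1 expr1n.
  - by rewrite /e_om mulmxA.
  have eom_le : enorm (e_om p c k s i t) <= r2.
    rewrite -(@ler_pXn2r _ 2) ?nnegrE ?enorm_ge0 ?ltW //.
    by rewrite (le_lt_trans _ Sr2) //; case: (link_le i).
  rewrite (le_trans (ler_pM (enorm_ge0 _) (enorm_ge0 _) (hB s t Dst (ltW Sr1) i) eom_le)) //.
  rewrite /r2 ler_pdivrMr; lra.
set EQ := \sum_i enorm (e_q p c k s i t) ^+ 2.
set EO := \sum_i enorm (e_om p c k s i t) ^+ 2.
set PS := \sum_i psiq p c k s i t.
have EQ0 : 0 <= EQ by apply: sumr_ge0 => i _; exact: sqr_ge0.
have EO0 : 0 <= EO by apply: sumr_ge0 => i _; exact: sqr_ge0.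
have PS0 : 0 <= PS by apply: sumr_ge0 => i _; exact: (psiq_ge0 cl).
(* As psi <= 1, one has psi <= psi (2 - psi) = |e_q|^2, so decay in e_q is decay in [psiq]. *)
have PSEQ : PS <= EQ.
  apply: ler_sum => i _; rewrite (sqr_e_q cl); case: (link_le i) => h _.
  by rewrite ler_peMr ?(psiq_ge0 cl) //; lra.
have psiR_le : psiR c s t <= enorm (e_R c s t) ^+ 2.
  by rewrite (sqr_e_R c_ok cl) ler_peMr ?(psiR_ge0 c_ok cl) //; lra.
have ld2 : link_dist p c k (s, t) ^+ 2 = EQ by rewrite sqr_sqrtr.
have ld0 : 0 <= link_dist p c k (s, t) by exact: sqrtr_ge0.
have mi : 0 <= (m0 p)^-1 by rewrite invr_ge0 ltW.
have d2 : enorm ((m0 p)^-1 *: F_err p c k s t) ^+ 2 <= Kd ^+ 2 * EQ.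
  rewrite -ld2 -exprMn ler_pXn2r ?nnegrE ?enorm_ge0 ?mulr_ge0 //.
  rewrite enormZ (ger0_norm mi) /Kd -mulrA ler_wpM2l //.
  exact: (hF (s, t) Dst).
have e2 : enorm (M_err p c k s t) ^+ 2 <= KM ^+ 2 * EQ.
  rewrite -ld2 -exprMn ler_pXn2r ?nnegrE ?enorm_ge0 ?mulr_ge0 //.
  exact: (hM (s, t) Dst).
have hls := @ler_sum R 'I_n (index_enum _) xpredT _ _ (fun i _ => hl i).
rewrite -mulr_sumr [X in _ <= _ * X]big_split /= -/EQ -/EO in hls.
have SE : sqdist p c k s t = enorm (e_x c s t) ^+ 2 + enorm (e_v c s t) ^+ 2
    + psiR c s t + enorm (e_Om c s t) ^+ 2 + (PS + EO).
  by rewrite /sqdist big_split.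
rewrite SE /lyap_rate.
have lam0 : 0 <= lam := le_trans (ler0n _ 8) lam8.
have {}hls := ler_wpM2l lam0 hls.
apply: le_trans.
  apply: lerD; last exact: hls.
  apply: lerD; first exact: hx.
  exact: ha.
have lamE : lam * (- 8^-1 * (EQ + EO)) = - (2 * Kd ^+ 2 + 2 * KM ^+ 2 + 1) * (EQ + EO).
  by rewrite /lam; field.
rewrite lamE.
have ex0 := sqr_ge0 (enorm (e_x c s t)); have ev0 := sqr_ge0 (enorm (e_v c s t)).
have eO0 := sqr_ge0 (enorm (e_Om c s t)); have ps0 := psiR_ge0 c_ok cl.
have al_le z : 0 <= z -> cR / 2 * z <= 4^-1 * z by move=> z0; rewrite ler_wpM2r //; lra.
have := al_le _ ex0; have := al_le _ ev0; have := al_le _ eO0.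
have := al_le _ PS0; have := al_le _ EO0.
have p1 : 0 <= Kd ^+ 2 * EO by rewrite mulr_ge0.
have p2 : 0 <= KM ^+ 2 * EO by rewrite mulr_ge0.
have p3 : cR * psiR c s t <= cR * enorm (e_R c s t) ^+ 2 by rewrite ler_wpM2l // ltW.
move=> *; lra.
Qed.

End Stability.

(** * The commanded motion *)

Section CommandedMotion.
Variables (R : realType) (n : nat).
Variables (p : plant R n) (c : command R) (k : gains R).
Hypotheses (p_ok : plant_ok p) (c_ok : command_ok c) (l_ok : link_commands_ok p c).
Implicit Types t u : R.

Local Notation s := (commanded_motion p c).

Let Rd_SO3 u : SO3 (Rd c u). Proof. by case: c_ok. Qed.
Let RdRd u : (Rd c u)^T *m Rd c u = 1%:M. Proof. by case: (Rd_SO3 u). Qed.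

Lemma cmd_e_x u : e_x c s u = 0. Proof. exact: subrr. Qed.
Lemma cmd_e_v u : e_v c s u = 0. Proof. exact: subrr. Qed.
Lemma cmd_e_R u : e_R c s u = 0.
Proof. by rewrite /e_R subrr vee0 scaler0. Qed.
Lemma cmd_e_Om u : e_Om c s u = 0.
Proof. by rewrite /e_Om /= RdRd mul1mx subrr. Qed.

(** An identity between functions of time, since the control law differentiates [qd] and [omd]. *)
Lemma cmd_mud i : mud p c k s i = cmd_tension p c i.
Proof.
apply/funext => u; rewrite /mud /cmd_tension; congr tension.
  by rewrite /Fd cmd_e_x cmd_e_v !scaler0 subrr add0r.
rewrite /Md cmd_e_R cmd_e_Om !scaler0 subrr add0r /= RdRd mul1mx.
by rewrite -(mulmxA (J0 p)) RdRd mulmx1.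
Qed.

Lemma cmd_qdE i : qd p c k s i = cmd_qd p c i.
Proof. by apply/funext => u; rewrite /qd cmd_mud. Qed.

Lemma cmd_omdE i : omd p c k s i = cmd_omd p c i.
Proof. by apply/funext => u; rewrite /omd cmd_qdE. Qed.

Section AtTime.
Variable t : R.
Hypothesis t_ge0 : 0 <= t.

Lemma cmd_tension_neq0 i : cmd_tension p c i t != 0.
Proof.
case: l_ok => -[nu nu_gt0 /(_ i t t_ge0) h] _.
by rewrite -enorm_gt0 (lt_le_trans nu_gt0).
Qed.

(** The lower bound on the tensions concerns nonnegative times, whereas derivatives at 0 also
    involve negative ones; continuity gives a full neighborhood. *)
Lemma near_cmd_tension_neq0 i : \forall u \near t, cmd_tension p c i u != 0.
Proof.
have h := smooth_derive t (@smooth_cmd_tension R n p c c_ok i).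
have hc := is_derive_continuous (is_derive_dot h h).
have pos : 0 < dot (cmd_tension p c i t) (cmd_tension p c i t).
  by rewrite dot_enorm exprn_gt0 // enorm_gt0 cmd_tension_neq0.
near=> u; have : 0 < dot (cmd_tension p c i u) (cmd_tension p c i u).
  by near: u; exact: (cvgr_gt _ hc _ pos).
by apply: contraTneq => ->; rewrite dot0l ltxx.
Unshelve. all: by end_near. Qed.

Definition cmd_qd_rate i u : 'cV[R]_3 :=
  let x := cmd_tension p c i u in let dx := derive1 (cmd_tension p c i) u in
  (enorm x ^- 3 * dot x dx) *: x - (enorm x)^-1 *: dx.

Lemma is_derive_cmd_qd i u : cmd_tension p c i u != 0 ->
  is_derive u 1 (cmd_qd p c i) (cmd_qd_rate i u).
Proof.
move=> x0; have h := smooth_derive u (@smooth_cmd_tension R n p c c_ok i).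
exact: is_derive_unit_opp x0 h.
Qed.

(** The formula for the first derivative holds near t, which suffices to differentiate it again. The
    control law needs this for the rate of [omd]. *)
Lemma is_derive_cmd_qd2 i : is_derive t 1 (derive1 (cmd_qd p c i))
  (derive1 (derive1 (cmd_qd p c i)) t).
Proof.
have x0 := cmd_tension_neq0 i.
have h := smooth_derive t (@smooth_cmd_tension R n p c c_ok i).
have h2 := smooth_derive t (smooth_derive1 (@smooth_cmd_tension R n p c c_ok i)).
have he := is_derive_enorm x0 h.
have e0 : enorm (cmd_tension p c i t) != 0 by rewrite enorm_eq0.
have hi := @is_derive_inv _ (fun u => enorm (cmd_tension p c i u)) t _ e0 he.
have e3 : enorm (cmd_tension p c i t) * (enorm (cmd_tension p c i t) *
  enorm (cmd_tension p c i t)) != 0 by rewrite !mulf_neq0.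
have hi3 := @is_derive_inv _ (fun u => enorm (cmd_tension p c i u) *
  (enorm (cmd_tension p c i u) * enorm (cmd_tension p c i u))) t _ e3
  (is_derive_fM he (is_derive_fM he he)).
have h1 := is_derive_scale (is_derive_fM hi3 (is_derive_dot h h2)) h.
have h3 := is_derive_fD h1 (is_derive_fN (is_derive_scale hi h2)).
apply: is_derive_derive1; apply: near_eq_is_derive h3.
near=> u; have x0u : cmd_tension p c i u != 0.
  by near: u; exact: near_cmd_tension_neq0.
by rewrite (is_derive1 (is_derive_cmd_qd x0u)) /cmd_qd_rate !exprS expr0 mulr1.
Unshelve. all: by end_near. Qed.

Lemma is_derive_cmd_omd i :
  is_derive t 1 (cmd_omd p c i) (derive1 (cmd_omd p c i) t).
Proof.
have h1 := is_derive_derive1 (is_derive_cmd_qd (cmd_tension_neq0 i)).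
have h2 := is_derive_cmd_qd2 i.
exact: is_derive_derive1 (is_derive_mulmx (is_derive_hat h1) h2).
Qed.

Lemma cmd_qd_unit i : S2 (cmd_qd p c i t).
Proof. exact: enorm_unit_opp (cmd_tension_neq0 i). Qed.

Lemma cmd_qd_cross i :
  derive1 (cmd_qd p c i) t = cross (cmd_omd p c i t) (cmd_qd p c i t).
Proof.
apply: unit_rate_cross; first by rewrite dot_enorm cmd_qd_unit expr1n.
have h := smooth_derive t (@smooth_cmd_tension R n p c c_ok i).
exact: unit_opp_rate_orth (cmd_tension_neq0 i) h.
Qed.

Lemma cmd_qd_omd i u : dot (cmd_qd p c i u) (cmd_omd p c i u) = 0.
Proof. exact: dot_hat_self. Qed.

(** Obtained by differentiating the orthogonality of [cmd_qd] and [cmd_omd]. The closed loop only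
    realises angular accelerations normal to the link, so the commanded one must be of this kind. *)
Lemma cmd_qd_omd_rate i : dot (cmd_qd p c i t) (derive1 (cmd_omd p c i) t) = 0.
Proof.
have h1 := is_derive_derive1 (is_derive_cmd_qd (cmd_tension_neq0 i)).
have h := is_derive_dot h1 (is_derive_cmd_omd i).
have e : (fun u => dot (cmd_qd p c i u) (cmd_omd p c i u)) = cst 0.
  by apply/funext => u; exact: cmd_qd_omd.
rewrite e in h; have := is_derive1 h; rewrite derive1_cst => h0.
have z : dot (derive1 (cmd_qd p c i) t) (cmd_omd p c i t) = 0.
  exact: dot_hat_selfr.
by rewrite z add0r in h0.
Qed.

Lemma cmd_e_q i : e_q p c k s i t = 0.
Proof. by rewrite /e_q cmd_qdE /cross hat_self. Qed.

Lemma cmd_e_om i : e_om p c k s i t = 0.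
Proof.
rewrite /e_om cmd_omdE /= -mulmxA hat_hat cmd_qd_omd dot_enorm cmd_qd_unit.
by rewrite expr1n scale0r scale1r sub0r subrr.
Qed.

Lemma cmd_mu i : mu p c k s i t = cmd_tension p c i t.
Proof.
have e0 : enorm (cmd_tension p c i t) != 0 by rewrite enorm_eq0 cmd_tension_neq0.
rewrite /mu cmd_mud /= qq_mul /cmd_qd /unit_opp dotZl scalerA dot_enorm.
by rewrite -[RHS]scale1r; congr (_ *: _); field.
Qed.

Lemma commanded_closed_loop : closed_loop_at p c k s t.
Proof.
have [xs Rs _ _ _] := c_ok; have [[m0_gt0 _] _ Jpos _ rk] := p_ok.
have con : constraints s t.
  split; first exact: Rd_SO3.
  by move=> i; split; [exact: cmd_qd_unit|exact: cmd_qd_omd].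
split=> //.
- split.
  + by split; [case: (smooth_derive t xs)|case: (smooth_derive t (smooth_derive1 xs))].
  + exact: is_derive_Rd.
  + by case: (smooth_derive t (smooth_Omd c_ok)).
  + move=> i; split; last by case: (is_derive_cmd_omd i).
    rewrite -cmd_qd_cross.
    exact: is_derive_derive1 (is_derive_cmd_qd (cmd_tension_neq0 i)).
- move=> i; rewrite cmd_mud cmd_qdE cmd_omdE; split.
  + exact: cmd_tension_neq0.
  + by case: (is_derive_cmd_qd (cmd_tension_neq0 i)).
  + by case: (is_derive_cmd_omd i).
apply/(dynamicsE c k p_ok con); split=> /= [||i].
- rewrite /payload_acc (eq_bigr _ (fun i _ => cmd_mu i)) sum_tension //.
  by rewrite scalerA mulVf ?gt_eqF // scale1r.
- rewrite /payload_angacc /=.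
  rewrite (eq_bigr _ (fun i _ => congr1 (mulmx _) (cmd_mu i))).
  by rewrite sum_moment_tension // addrC addKr mulKmx // posdef_unitmx.
- rewrite /link_input cmd_e_q cmd_e_om cmd_omdE /= cmd_qd_omd.
  rewrite !scaler0 scale0r !subr0 sub0r !mulmxN opprK -[hat _ *m hat _ *m _]mulmxA.
  rewrite hat_hat_hat !hat_hat cmd_qd_omd_rate dot_enorm cmd_qd_unit expr1n.
  by rewrite scale0r !scale1r sub0r scaleNr scale1r opprK.
Qed.

Lemma commanded_err_norm : err_norm p c k s t = 0.
Proof.
rewrite /err_norm cmd_e_x cmd_e_v cmd_e_R cmd_e_Om enorm0 expr0n !addr0 add0r.
by rewrite big1 ?sqrtr0 // => i _; rewrite cmd_e_q cmd_e_om enorm0 expr0n addr0.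
Qed.

End AtTime.
End CommandedMotion.

(** * Exponential stability *)

Section ErrorVector.
Variables (R : realType) (n : nat) (p : plant R n) (c : command R) (k : gains R).
Hypotheses (c_ok : command_ok c).
Implicit Types (s : motion R n) (t : R).

Lemma sqr_err_norm s t : err_norm p c k s t ^+ 2 =
  enorm (e_x c s t) ^+ 2 + enorm (e_v c s t) ^+ 2
  + enorm (e_R c s t) ^+ 2 + enorm (e_Om c s t) ^+ 2
  + \sum_i (enorm (e_q p c k s i t) ^+ 2 + enorm (e_om p c k s i t) ^+ 2).
Proof.
rewrite sqr_sqrtr // !addr_ge0 ?sqr_ge0 //.
by apply: sumr_ge0 => i _; rewrite addr_ge0 ?sqr_ge0.
Qed.

Lemma err_norm_le s t : closed_loop_at p c k s t ->
  err_norm p c k s t ^+ 2 <= 2 * sqdist p c k s t.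
Proof.
move=> cl; rewrite sqr_err_norm /sqdist.
have hR := sqr_e_R_le c_ok cl.
have hs : \sum_i (enorm (e_q p c k s i t) ^+ 2 + enorm (e_om p c k s i t) ^+ 2) <=
   2 * \sum_i (psiq p c k s i t + enorm (e_om p c k s i t) ^+ 2).
  rewrite mulr_sumr; apply: ler_sum => i _.
  by have := sqr_e_q_le cl i; have := sqr_ge0 (enorm (e_om p c k s i t)); lra.
have := sqr_ge0 (enorm (e_x c s t)); have := sqr_ge0 (enorm (e_v c s t)).
by have := sqr_ge0 (enorm (e_Om c s t)); lra.
Qed.

(** For psi <= 1 one has psi <= psi (2 - psi); farther away the error vector does not control the
    distance. *)
Lemma sqdist_le s t : closed_loop_at p c k s t -> sqdist p c k s t <= 1 ->
  sqdist p c k s t <= err_norm p c k s t ^+ 2.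
Proof.
move=> cl S1; have [_ _ psiR1 _ link1] := sqdist_ge c_ok cl.
rewrite sqr_err_norm /sqdist !lerD //.
  by rewrite (sqr_e_R c_ok cl) ler_peMr ?(psiR_ge0 c_ok cl) //; lra.
apply: ler_sum => i _; rewrite lerD2r (sqr_e_q cl).
by case: (link1 i) => h _; rewrite ler_peMr ?(psiq_ge0 cl) //; lra.
Qed.

(** The neighborhood compares Om0 with Omd directly, whereas [e_Om] transports Omd to the payload
    frame. The discrepancy R0^T (R0 - Rd) Omd is small because Omd is bounded. *)
Lemma near_equilibrium_sqdist : exists2 M : R, 0 <= M &
  forall s t delta, 0 <= t -> 0 < delta -> closed_loop_at p c k s t ->
    near_equilibrium p c k s delta t -> sqdist p c k s t <= M * delta ^+ 2.
Proof.
have [_ _ Rd_SO3 _ [[B hB] _]] := c_ok.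
have B0 : 0 <= B by rewrite (le_trans _ (hB 0 (lexx 0))) ?enorm_ge0.
(* 3 for e_x, e_v and [psiR], then e_Om, where the 2 bounds the norm of a rotation, and 2 for each
   link. *)
exists (3 + (1 + 2 * B) ^+ 2 + n%:R * 2).
  by apply: addr_ge0; [apply: addr_ge0; rewrite ?sqr_ge0 // ler0n | apply: mulr_ge0].
move=> s t d t0 d0 cl [hx hv hR hO hl].
have hR0 : SO3 (R0 s t) by case: cl => -[].
have d0' := ltW d0.
have B1 : 0 <= 1 + 2 * B by lra.
have sq (a : R) : 0 <= a -> a < d -> a ^+ 2 <= d ^+ 2.
  by move=> a0 /ltW ad; rewrite ler_pXn2r ?nnegrE //.
have hx2 := sq _ (enorm_ge0 _) hx; have hv2 := sq _ (enorm_ge0 _) hv.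
have hR2 := sq _ (enorm_ge0 _) hR.
have hO2 : enorm (e_Om c s t) ^+ 2 <= (1 + 2 * B) ^+ 2 * d ^+ 2.
  rewrite -exprMn ler_pXn2r ?nnegrE ?enorm_ge0 ?(mulr_ge0 B1 d0') //.
  have -> : e_Om c s t = Om0 s t - Omd c t
      + (R0 s t)^T *m (R0 s t - Rd c t) *m Omd c t.
    rewrite mulmxBr mulmxBl; case: (hR0) => -> _; rewrite mul1mx /e_Om; linmx.
  rewrite (le_trans (enormD _ _)) // mulrDl mul1r lerD ?(ltW hO) //.
  rewrite (le_trans (enormM _ _)) // mulrAC ler_pM ?enorm_ge0 ?hB //.
  rewrite (le_trans (enormM _ _)) // enorm_tr ler_pM ?enorm_ge0 ?enorm_SO3 //.
  exact: ltW.
rewrite /sqdist (psiR_dist c_ok) //.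
have hs : \sum_i (psiq p c k s i t + enorm (e_om p c k s i t) ^+ 2) <=
    n%:R * 2 * d ^+ 2.
  have -> : n%:R * 2 * d ^+ 2 = \sum_(i < n) (2 * d ^+ 2).
    by rewrite sumr_const card_ord -mulrA mulr_natl.
  apply: ler_sum => i _; rewrite psiq_dist //; have [h1 h2] := hl i.
  have h3 := sq _ (enorm_ge0 _) h1; have h4 := sq _ (enorm_ge0 _) h2.
  by have := sqr_ge0 d; lra.
have := sqr_ge0 d; rewrite /e_x /e_v !mulrDl; lra.
Qed.

End ErrorVector.

Theorem proposition1 (R : realType) (n : nat) (p : plant R n) (c : command R)
  (p_ok : plant_ok p) (c_ok : command_ok c) (links_ok : link_commands_ok p c) :
  exists2 k : gains R, gains_pos k & exponentially_stable p c k.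
Proof.
exists (unit_gains R); first by split; rewrite ?ltr01 //; split; rewrite ltr01.
split.
  by move=> t t_ge0; split; [exact: commanded_closed_loop|exact: commanded_err_norm].
have [V [dV [kap [K [al [r [[kap0 K0 al0 r0 r1] hd hV hdV]]]]]]] :=
  lyapunov_exists p_ok c_ok links_ok.
have [M M0 hM] := near_equilibrium_sqdist p (unit_gains R) c_ok.
(* The radius is [Z^-1]: the 1 makes it at most 1, the M gives an initial [sqdist] of at most 1, and
   the last summand puts the initial V below [kap * r]. *)
pose Z := 1 + M + 2 * K * M / (kap * r).
have KM0 : 0 <= 2 * K * M / (kap * r).
  by rewrite divr_ge0 ?mulr_ge0 // ltW.
have Z1 : 1 <= Z by rewrite /Z -addrA lerDl addr_ge0.
have Z0 : 0 < Z by rewrite (lt_le_trans ltr01).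
have d0 : 0 < Z^-1 by rewrite invr_gt0.
have dle1 : Z^-1 <= 1 by rewrite invf_le1.
have d1 : Z^-1 ^+ 2 <= Z^-1 by rewrite expr2 ler_piMr // ltW.
(* V is quadratic in the errors, so both its constant and its rate are halved in the exponent. The 2
   comes from |e|^2 <= 2 psi. *)
exists (Num.sqrt (2 * K / kap)), (al / 2), Z^-1; split=> //.
- by rewrite sqrtr_gt0 divr_gt0 // mulr_gt0.
- by rewrite divr_gt0.
move=> s lo t0 hi t0_ge0 /andP[lot0 t0hi] cl near0.
have t0I : t0 <= t0 < hi by rewrite lexx.
have cl' t : t0 <= t < hi -> closed_loop_at p c (unit_gains R) s t.
  by move=> /andP[t0t thi]; apply: cl; rewrite (lt_le_trans lot0).
have S0 : sqdist p c (unit_gains R) s t0 <= M * Z^-1.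
  by rewrite (le_trans (hM _ _ _ t0_ge0 d0 (cl' _ t0I) near0)) // ler_wpM2l.
have S0_le1 : sqdist p c (unit_gains R) s t0 <= 1.
  by rewrite (le_trans S0) // ler_pdivrMr // mul1r /Z; lra.
have V0 : V s t0 < kap * r.
  have /andP[_ h] := hV s t0 (cl' _ t0I).
  rewrite (le_lt_trans h) // (le_lt_trans (ler_wpM2l (ltW K0) S0)) //.
  rewrite mulrA ltr_pdivrMr //.
  have -> : kap * r * Z = kap * r + kap * r * M + 2 * (K * M).
    by rewrite /Z; field; rewrite !gt_eqF.
  have h1 : 0 < kap * r by rewrite mulr_gt0.
  have h2 : 0 <= K * M by rewrite mulr_ge0 // ltW.
  have h3 : 0 <= kap * r * M by rewrite mulr_ge0 // ltW.
  lra.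
have decay : forall t, t0 <= t < hi -> V s t <= expR (- al * (t - t0)) * V s t0.
  (* Below this level kap [sqdist] <= V forces [sqdist] < r, where V decays. *)
  apply: (barrier_exp_decay (dV := dV s) (eps := kap * r)) => //.
  - exact: ltW.
  - by move=> t tI; exact/hd/cl'.
  - move=> t tI; have /andP[h _] := hV s t (cl' t tI); rewrite (le_trans _ h) //.
    by rewrite mulr_ge0 ?(sqdist_ge0 c_ok (cl' t tI)) // ltW.
  move=> t tI Vlt; have ct := cl' t tI; apply: hdV => //.
    by rewrite (le_trans t0_ge0) //; case/andP: tI.
  have /andP[h _] := hV s t ct.
  by rewrite -(ltr_pM2l kap0) (le_lt_trans h).
move=> t tI; have ct := cl' t tI.
have key : err_norm p c (unit_gains R) s t ^+ 2 <= 2 * K / kap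
    * expR (- al * (t - t0)) * err_norm p c (unit_gains R) s t0 ^+ 2.
  rewrite (le_trans (err_norm_le c_ok ct)) //.
  have /andP[h1 _] := hV s t ct; have /andP[_ h2] := hV s t0 (cl' _ t0I).
  have h3 := sqdist_le c_ok (cl' _ t0I) S0_le1.
  have h4 := decay t tI.
  have ex0 := expR_ge0 (- al * (t - t0)).
  have h5 : kap * sqdist p c (unit_gains R) s t <=
      expR (- al * (t - t0)) * (K * err_norm p c (unit_gains R) s t0 ^+ 2).
    rewrite (le_trans h1) // (le_trans h4) // ler_wpM2l //.
    by rewrite (le_trans h2) // ler_wpM2l // ltW.
  have -> : 2 * K / kap * expR (- al * (t - t0)) * err_norm p c (unit_gains R) s t0 ^+ 2 =
    2 * ((expR (- al * (t - t0)) * (K * err_norm p c (unit_gains R) s t0 ^+ 2)) / kap).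
    by field; rewrite gt_eqF.
  by rewrite ler_wpM2l // ler_pdivlMr // mulrC.
have N0 : 0 <= err_norm p c (unit_gains R) s t by exact: sqrtr_ge0.
have N1 : 0 <= err_norm p c (unit_gains R) s t0 by exact: sqrtr_ge0.
move: key N0 N1; move: (err_norm _ _ _ _ t) (err_norm _ _ _ _ t0) => y y0 key N0 N1.
have e0 : 0 <= expR (- (al / 2) * (t - t0)) by exact: expR_ge0.
have e2 : expR (- (al / 2) * (t - t0)) ^+ 2 = expR (- al * (t - t0)).
  by rewrite expr2 -expRD; congr expR; field.
have C0 : 0 <= 2 * K / kap by rewrite divr_ge0 ?mulr_ge0 // ltW.
rewrite -(@ler_pXn2r _ 2) ?nnegrE ?mulr_ge0 ?sqrtr_ge0 //.
by rewrite !exprMn sqr_sqrtr // e2.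
Qed.
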